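(* Let $\mathbf{k}$ be an algebraically closed field of characteristic $p>2$. Let $X=\operatorname{Spec} B$ be an affine Poisson variety over $\mathbf{k}$, and let $A$ be a weakly central quantization of $B$, with quotient map $\rho:A\to A/\hbar A=B$. Let $y\in \operatorname{Spec} B$ be a closed point with maximal ideal $m_y\subset B$, let $Y$ be a symplectic leaf in $\operatorname{Spec} B$ containing $y$, and put $\dim Y=2n$. Let $A_{\bar y}$ be the completion of $A$ with respect to the two-sided ideal $\rho^{-1}(m_y)$. Then there exists an algebra $A^{+}_{\hat y}$ which is a weakly central quantization of a complete local Poisson $\mathbf{k}$-algebra, and which is an algebra over the center $Z(\overline{W_{n,\hbar}})$ of the complete Weyl algebra $\overline{W_{n,\hbar}}$, such that $A_{\bar y}$ is isomorphic, as a $\mathbf{k}[[\hbar]]$-algebra, to $$\overline{W_{n,\hbar}}\otimes_{Z(\overline{W_{n,\hbar}})}A^{+}_{\hat y}.$$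
   Context: Conventions. For an algebra $R$, $Z(R)$ denotes its center. A Poisson algebra over $\mathbf{k}$ is a commutative $\mathbf{k}$-algebra with a $\mathbf{k}$-linear Poisson bracket $\{\ ,\ \}$. A Poisson ideal of a Poisson algebra $B$ is an ideal $I$ with $\{B,I\}\subset I$. An affine Poisson variety is an affine variety $X=\operatorname{Spec} B$ over $\mathbf{k}$ (so $B$ is a finitely generated $\mathbf{k}$-algebra) with $B$ a Poisson algebra. Quantization. A quantization of a Poisson algebra $(B,\{\ ,\ \})$ is an associative $\mathbf{k}[[\hbar]]$-algebra $A$ that is a topologically free $\mathbf{k}[[\hbar]]$-module, with $B=A/\hbar A$ and $\{a \bmod \hbar,\, b\bmod\hbar\}=\left(\frac1\hbar[a,b]\right)\bmod \hbar$ for all $a,b\in A$. Weakly central. A quantization $A$ of $B$ is weakly central if for every $a\in A$ there exists $a^{[p]}\in A$ such that $a^p-\hbar^{p-1}a^{[p]}\in Z(A)$. Symplectic leaf. A symplectic leaf in $X=\operatorname{Spec} B$ is a maximal locally closed connected subvariety $Y\subset X$ such that the ideal $I(\overline Y)$ of its closure is a Poisson ideal and $Y$ is a smooth symplectic variety under the Poisson bracket induced from $B$. Complete Weyl algebra. $\overline{W_{n,\hbar}}=\mathbf{k}[[\hbar]]\langle x_1,\dots,x_n,y_1,\dots,y_n\rangle$ with relations $[x_i,x_j]=0=[y_i,y_j]$, $[x_i,y_j]=\hbar\delta_{ij}$. Local Poisson algebra. A local Poisson $\mathbf{k}$-algebra is a local $\mathbf{k}$-algebra equipped with a Poisson bracket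 such that the maximal ideal is a Poisson ideal; complete means complete with respect to the maximal ideal. The $Z(\overline{W_{n,\hbar}})$-algebra structure on $A^{+}_{\hat y}$ is given by a $\mathbf{k}[[\hbar]]$-algebra homomorphism $Z(\overline{W_{n,\hbar}})\to Z(A^{+}_{\hat y})$. *)

(* Defs.v *)
From HB Require Import structures.
From mathcomp Require Import all_boot all_algebra.
From mathcomp Require Import all_classical topology.

Set Implicit Arguments.
Unset Strict Implicit.
Unset Printing Implicit Defensive.

Import GRing.Theory.
Local Open Scope classical_set_scope.
Local Open Scope ring_scope.

Record fps (k : comNzRingType) := Fps { coef_fps :> nat -> k }.

Section PowerSeries.
Variable k : comNzRingType.
Implicit Types f g h : fps k.

HB.instance Definition _ := gen_eqMixin (fps k).
HB.instance Definition _ := gen_choiceMixin (fps k).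

Let fps_ext f g : (forall n, f n = g n) -> f = g.
Proof. by case: f g => [f] [g] /funext /= ->. Qed.

Definition fps_zero : fps k := Fps (fun=> 0).
Definition fps_opp f : fps k := Fps (fun n => - f n).
Definition fps_add f g : fps k := Fps (fun n => f n + g n).
Definition fps_one : fps k := Fps (fun n => (n == 0)%N%:R).
Definition fps_mul f g : fps k := Fps (fun n => \sum_(i < n.+1) f i * g (n - i)%N).
Definition hbar : fps k := Fps (fun n => (n == 1)%N%:R).

Fact fps_addA : associative fps_add.
Proof. by move=> f g h; apply: fps_ext => n /=; rewrite addrA. Qed.

Fact fps_addC : commutative fps_add.
Proof. by move=> f g; apply: fps_ext => n /=; rewrite addrC. Qed.

Fact fps_add0 : left_id fps_zero fps_add.
Proof. by move=> f; apply: fps_ext => n /=; rewrite add0r. Qed.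

Fact fps_addN : left_inverse fps_zero fps_opp fps_add.
Proof. by move=> f; apply: fps_ext => n /=; rewrite addNr. Qed.

HB.instance Definition _ := GRing.isZmodule.Build (fps k)
  fps_addA fps_addC fps_add0 fps_addN.

Let trunc n f : {poly k} := \poly_(i < n.+1) f i.

Let fps_mulE f g n m : (n <= m)%N -> fps_mul f g n = (trunc m f * trunc m g)`_n.
Proof.
move=> le_nm; rewrite coefM; apply: eq_bigr => i _; rewrite !coef_poly !ltnS.
by rewrite (leq_trans (leq_ord i) le_nm) (leq_trans (leq_subr _ _) le_nm).
Qed.

Let coef_mulr (P Q R : {poly k}) n :
  (forall m, (m <= n)%N -> P`_m = Q`_m) -> (P * R)`_n = (Q * R)`_n.
Proof. by move=> eqPQ; rewrite !coefM; apply: eq_bigr => i _; rewrite eqPQ // -ltnS. Qed.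

Let trunc_mul f g n m :
  (m <= n)%N -> (trunc n (fps_mul f g))`_m = (trunc n f * trunc n g)`_m.
Proof. by move=> le_mn; rewrite coef_poly ltnS le_mn (fps_mulE _ _ le_mn). Qed.

Fact fps_mulC : commutative fps_mul.
Proof. by move=> f g; apply: fps_ext => n; rewrite !(fps_mulE _ _ (leqnn n)) mulrC. Qed.

Fact fps_mulA : associative fps_mul.
Proof.
move=> f g h; apply: fps_ext => n; rewrite !(fps_mulE _ _ (leqnn n)).
rewrite [RHS](coef_mulr _ (@trunc_mul f g n)) mulrC.
by rewrite (coef_mulr _ (@trunc_mul g h n)) mulrC mulrA.
Qed.

Fact fps_mul1 : left_id fps_one fps_mul.
Proof.
move=> f; apply: fps_ext => n.
rewrite /= big_ord_recl mul1r subn0 big1 ?addr0 // => i _.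
by rewrite mul0r.
Qed.

Fact fps_mulDl : left_distributive fps_mul +%R.
Proof.
move=> f g h; apply: fps_ext => n; rewrite /= -big_split /=.
by apply: eq_bigr => i _; rewrite -mulrDl.
Qed.

Fact fps_one_neq0 : fps_one != 0.
Proof. by apply/eqP => /(congr1 (fun f : fps k => f 0%N)) /eqP; rewrite /= oner_eq0. Qed.

HB.instance Definition _ := GRing.Zmodule_isComNzRing.Build (fps k)
  fps_mulA fps_mulC fps_mul1 fps_mulDl fps_one_neq0.

End PowerSeries.

Arguments hbar {k}.

(* The action of k[[hbar]] on V[[hbar]] = (nat -> V). *)
Definition fps_scale (k : comNzRingType) (V : lmodType k)
    (c : fps k) (u : nat -> V) : nat -> V :=
  fun n => \sum_(i < n.+1) c i *: u (n - i)%N.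

Definition topologically_free (k : comNzRingType) (M : lmodType (fps k)) : Prop :=
  exists (V : lmodType k) (e : (nat -> V) -> M),
    [/\ bijective e,
        forall u v, e (fun n => u n + v n) = e u + e v
      & forall c u, e (fps_scale c u) = c *: e u].

Definition commutator (R : pzRingType) (a b : R) : R := a * b - b * a.

Definition central (R : pzRingType) : {pred R} :=
  fun z => `[< forall a : R, z * a = a * z >].

Section Center.
Variables (K : comNzRingType) (A : algType K).

Record center := Center { center_val : A; _ : central center_val }.

HB.instance Definition _ := [isSub for center_val].
HB.instance Definition _ := [Choice of center by <:].

Fact central_subalg_closed : GRing.subsemialg_closed (@central A).
Proof.
split; first by apply/asboolP => a; rewrite mul1r mulr1.
- split; first by apply/asboolP => a; rewrite mul0r mulr0.
  by move=> u v /asboolP cu /asboolP cv; apply/asboolP => a; rewrite mulrDl mulrDr cu cv.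
- by move=> c u /asboolP cu; apply/asboolP => a; rewrite -scalerAl -scalerAr cu.
by move=> u v /asboolP cu /asboolP cv; apply/asboolP => a; rewrite -mulrA cv mulrA cu mulrA.
Qed.

HB.instance Definition _ :=
  GRing.SubChoice_isSubAlgebra.Build K A (@central A) center central_subalg_closed.

End Center.

Section Ideals.
Variable R : nzRingType.
Implicit Types I J : set R.

Definition two_sided_ideal I : Prop :=
  [/\ I 0, forall a b, I a -> I b -> I (a - b)
    & forall a b, I b -> I (a * b) /\ I (b * a)].

Definition ideal_mul I J : set R :=
  [set x | exists s : seq (R * R),
     (forall u, u \in s -> I u.1 /\ J u.2) /\ x = \sum_(u <- s) u.1 * u.2].

Definition ideal_pow J (n : nat) : set R := iter n (ideal_mul J) setT.

(* [ring_quotient.idealr_closed] includes properness *)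
Definition maximal_ideal (M : {pred R}) : Prop :=
  idealr_closed M /\
  forall Q : {pred R}, idealr_closed Q -> {subset M <= Q} -> {subset Q <= M}.

(* Completeness includes separatedness (the limit is unique). *)
Definition adically_complete J : Prop :=
  forall a : nat -> R, (forall n, ideal_pow J n (a n.+1 - a n)) ->
    exists! x, forall n, ideal_pow J n (x - a n).

End Ideals.

(* [iota : A -> Ah] exhibits Ah as the inverse limit of the A / J^n; the ideal
   [F n] is the kernel of the projection of Ah onto A / J^n. *)
Definition is_completion (A Ah : nzRingType) (J : set A) (iota : A -> Ah) : Prop :=
  exists F : nat -> set Ah,
    [/\ forall n, two_sided_ideal (F n) /\ F n.+1 `<=` F n,
        forall n a, F n (iota a) <-> ideal_pow J n a,
        forall n x, exists a, F n (x - iota a)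
      & forall a : nat -> A, (forall n, ideal_pow J n (a n.+1 - a n)) ->
          exists! x, forall n, F n (x - iota (a n))].

Definition alg_isomorphic (K : comNzRingType) (A A' : algType K) : Prop :=
  exists h : {lrmorphism A -> A'}, bijective h.

Definition finitely_generated_algebra (k : comNzRingType) (B : comAlgType k) : Prop :=
  exists s : seq B, forall S : {pred B},
    GRing.subalg_closed S -> {subset s <= S} -> forall b, b \in S.

Record spec (R : comNzRingType) := Spec {
  prime_of :> {pred R};
  prime_of_ideal : idealr_closed prime_of;
  prime_of_prime : prime_idealr_closed prime_of
}.

Section Zariski.
Variable R : comNzRingType.

HB.instance Definition _ := gen_eqMixin (spec R).
HB.instance Definition _ := gen_choiceMixin (spec R).

Definition zariski_open (U : set (spec R)) : Prop :=
  exists S : set R, U = [set P : spec R | exists2 f, S f & f \notin prime_of P].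

Fact zariski_openT : zariski_open setT.
Proof.
exists setT; apply/esym/seteqP; split=> // P _; exists 1 => //.
by case: (prime_of_ideal P).
Qed.

Fact zariski_openI : setI_closed zariski_open.
Proof.
move=> _ _ [S ->] [T ->]; exists [set f * g | f in S & g in T].
apply/seteqP; split=> P /=.
  move=> [[f Sf fP] [g Tg gP]]; exists (f * g); first by exists f => //; exists g.
  by apply/negP => /prime_of_prime /orP[]; apply/negP.
have [P0 _ PM] := prime_of_ideal P.
move=> [_ [f Sf [g Tg <-]] fgP]; split.
  exists f => //; apply: contra fgP => fP.
  by rewrite mulrC -[_ * _]addr0 PM.
by exists g => //; apply: contra fgP => gP; rewrite -[_ * _]addr0 PM.
Qed.

Fact zariski_open_bigcup (I : Type) (U : I -> set (spec R)) :
  (forall i, zariski_open (U i)) -> zariski_open (\bigcup_i U i).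
Proof.
move=> /choice[S US]; exists (\bigcup_i S i); apply/seteqP; split=> P /=.
  by move=> [i _]; rewrite US => -[f Sf fP]; exists f => //; exists i.
by move=> [f [i _ Sf] fP]; exists i => //; rewrite US; exists f.
Qed.

HB.instance Definition _ := isOpenTopological.Build (spec R)
  zariski_openT zariski_openI zariski_open_bigcup.

Implicit Types (Y : set (spec R)) (P : spec R).

Definition locally_closed Y : Prop :=
  exists U F : set (spec R), [/\ open U, closed F & Y = U `&` F].

Definition vanishing_ideal Y : set R :=
  [set f | forall P, Y P -> f \in prime_of P].

Definition spec_chain Y (d : nat) (c : nat -> spec R) : Prop :=
  (forall i, (i <= d)%N -> Y (c i)) /\
  (forall i, (i < d)%N -> {subset prime_of (c i) <= prime_of (c i.+1)} /\
                          ~ {subset prime_of (c i.+1) <= prime_of (c i)}).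

Definition krull_dim Y (d : nat) : Prop :=
  (exists c, spec_chain Y d c) /\
  (forall e c, spec_chain Y e c -> (e <= d)%N).

(* For Y locally closed, with its reduced structure, the primes of the local
   ring of Y at P are the points of Y contained in P, so this is the Krull
   dimension of that local ring. *)
Definition local_dim Y P (d : nat) : Prop :=
  (exists2 c, spec_chain Y d c & c d = P) /\
  (forall e c, spec_chain Y e c -> c e = P -> (e <= d)%N).

(* P^2 + I(closure of Y), so that P / cotangent_kernel Y P is the cotangent
   space at P of Y with its reduced structure. *)
Definition cotangent_kernel Y P : set R :=
  [set f + g | f in ideal_mul [set` prime_of P] [set` prime_of P]
             & g in vanishing_ideal (closure Y)].

End Zariski.

(* The local rings at the closed points of Y are regular.  The residue field
   at a closed point is k, for k algebraically closed and B finitely generated,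
   so the cotangent space is measured by a k-basis e. *)
Definition smooth_subvariety (k : fieldType) (B : comAlgType k)
    (Y : set (spec B)) : Prop :=
  forall P : spec B, Y P -> closed [set P] ->
    exists d, local_dim Y P d /\
      exists e : 'I_d -> B,
        (forall i, e i \in prime_of P) /\
        (forall f, f \in prime_of P -> exists! c : {ffun 'I_d -> k},
           cotangent_kernel Y P (f - \sum_i c i *: e i)).

Section Poisson.
Variables (k : fieldType) (B : comAlgType k) (br : B -> B -> B).

Definition poisson_bracket : Prop :=
  [/\ (forall f, linear (br f)) /\ (forall f, linear (br^~ f)),
      forall f, br f f = 0,
      forall f g h, br f (br g h) + br g (br h f) + br h (br f g) = 0
    & forall f g h, br f (g * h) = br f g * h + g * br f h].

Definition poisson_ideal (I : set B) : Prop :=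
  two_sided_ideal I /\ forall b f, I f -> I (br b f).

(* The bracket induced on Y is nondegenerate: at each closed point P, the
   pairing (f, g) |-> {f, g} mod P on the cotangent space of Y is. *)
Definition symplectic_subvariety (Y : set (spec B)) : Prop :=
  forall P : spec B, Y P -> closed [set P] ->
    forall f, f \in prime_of P ->
      (forall g, g \in prime_of P -> br f g \in prime_of P) ->
      cotangent_kernel Y P f.

Definition smooth_symplectic_piece (Y : set (spec B)) : Prop :=
  [/\ locally_closed Y, connected Y,
      poisson_ideal (vanishing_ideal (closure Y)),
      smooth_subvariety Y & symplectic_subvariety Y].

Definition symplectic_leaf (Y : set (spec B)) : Prop :=
  smooth_symplectic_piece Y /\
  forall Y', smooth_symplectic_piece Y' -> Y `<=` Y' -> Y' `<=` Y.

Definition complete_local_poisson : Prop :=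
  poisson_bracket /\
  exists M : {pred B},
    [/\ maximal_ideal M, forall M' : {pred B}, maximal_ideal M' -> M' =i M,
        poisson_ideal [set` M] & adically_complete [set` M]].

End Poisson.

(* rho is the quotient map A -> A / hbar A = B, and [a, b] = hbar * c forces
   {rho a, rho b} = rho c; such c exists as B is commutative, and is unique as
   A is hbar-torsion free. *)
Definition quantization (k : fieldType) (B : comAlgType k) (br : B -> B -> B)
    (A : algType (fps k)) (rho : {rmorphism A -> B}) : Prop :=
  [/\ topologically_free A,
      forall (c : fps k) a, rho (c *: a) = c 0%N *: rho a,
      forall b, exists a, rho a = b,
      forall a, rho a = 0 <-> exists a', a = hbar *: a'
    & forall a b c, commutator a b = hbar *: c -> br (rho a) (rho b) = rho c].

Definition weakly_central (k : fieldType) (p : nat) (A : algType (fps k)) : Prop :=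
  forall a : A, exists ap : A, a ^+ p - hbar ^+ p.-1 *: ap \in @central A.

Definition weyl_relations (k : fieldType) (n : nat) (R : algType (fps k))
    (x y : 'I_n -> R) : Prop :=
  forall i j, [/\ commutator (x i) (x j) = 0, commutator (y i) (y j) = 0
                & commutator (x i) (y j) = hbar *: (i == j)%:R].

(* The universal property of k[[hbar]]<x, y> modulo the Weyl relations. *)
Definition weyl_presentation (k : fieldType) (n : nat) (W0 : algType (fps k))
    (x y : 'I_n -> W0) : Prop :=
  weyl_relations x y /\
  forall (R : algType (fps k)) (u v : 'I_n -> R), weyl_relations u v ->
    exists h : {lrmorphism W0 -> R},
      (forall i, h (x i) = u i /\ h (y i) = v i) /\
      forall h' : {lrmorphism W0 -> R},
        (forall i, h' (x i) = u i /\ h' (y i) = v i) -> h' =1 h.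

(* "Complete" is taken in the hbar-adic sense: W contains the series of
   noncommutative polynomials in x and y that converge hbar-adically. *)
Definition complete_weyl_algebra (k : fieldType) (n : nat) (W : algType (fps k)) : Prop :=
  exists (W0 : algType (fps k)) (x y : 'I_n -> W0) (j : {lrmorphism W0 -> W}),
    weyl_presentation x y /\
    is_completion [set a : W0 | exists b, a = hbar *: b] j.

Section Tensor.
Variables (K : comNzRingType) (W A : algType K).
Variable phi : {lrmorphism center W -> center A}.

Definition balanced (M : zmodType) (t : W -> A -> M) : Prop :=
  [/\ forall w w' a, t (w + w') a = t w a + t w' a,
      forall w a a', t w (a + a') = t w a + t w a'
    & forall w (z : center W) a, t (w * val z) a = t w (val (phi z) * a)].

(* T, with pure tensors t w a, is the algebra W (x)_Z(W) A, where Z(W) acts on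
   A through phi. *)
Definition is_tensor_product (T : algType K) (t : W -> A -> T) : Prop :=
  [/\ balanced t,
      forall (M : zmodType) (b : W -> A -> M), balanced b ->
        exists h : {additive T -> M}, (forall w a, h (t w a) = b w a) /\
          forall h' : {additive T -> M}, (forall w a, h' (t w a) = b w a) -> h' =1 h,
      forall w w' a a', t w a * t w' a' = t (w * w') (a * a'),
      t 1 1 = 1
    & forall c w a, c *: t w a = t (c *: w) a].

End Tensor.

(* Main.v *)
(* Give hbar weight 2 and the maximal ideal at y weight 1.  For the resulting
   filtration of A, the operation hbar^-1 [ , ] lowers weights by 2, Jacobson's
   formula makes a |-> a^[p] compatible with weights, and an Artin-Rees argument
   controls division by hbar in the completion A_y; it runs on the central elements
   z^p - hbar^(p-1) z^[p], so that only the ascending chain condition in B is needed.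
   Lifts X, Y of symplectic coordinates satisfy hbar^-1 [X, Y] = 1 modulo weight 1.
   Replacing X by X + Y^(p-1) X^[p] raises the weight of X^[p], so in the limit X^p
   is central; then Y can be corrected so that hbar^-1 [X, Y] = 1 and Y^p is central.
   As (hbar^-1 [X, .])^p = 0, Taylor expansion in Y makes A_y free with basis
   1, ..., Y^(p-1) over the commutant of X.
   Repeating this with the next pair inside the commutant of the previous ones
   gives n commuting pairs, hence a map from the complete Weyl algebra W to A_y.
   Its image is spanned over the center by monomials with exponents below p, so
   A_y = W (x)_Z(W) S, with S the commutant of all the pairs.  The rank of the
   Poisson bracket on the cotangent space at y equals the dimension 2n of the
   leaf, because the dimension of the cotangent space is constant along the
   connected leaf; hence the bracket of two elements of weight 1 in S has weight 1,
   and S / hbar S is a complete local Poisson algebra. *)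

Require Import Defs.
From HB Require Import structures.
From mathcomp Require Import all_boot all_algebra.
From mathcomp Require Import all_classical topology.
From mathcomp Require Import zify.

Set Implicit Arguments.
Unset Strict Implicit.
Unset Printing Implicit Defensive.

Import GRing.Theory.
Local Open Scope classical_set_scope.
Local Open Scope ring_scope.

(** * Jacobson's formula *)

(** The weights make the relation [x, y] = hbar homogeneous. As hbar itself lies in the ideal J at
    y, weight 2n lies in J^n and J^n in weight n, so both filtrations define the same completion.
    Weak centrality gives a^[p] only up to central elements and with no bound on its weight, so it
    is treated as a relation, [ppow], and a representative of the right weight has to be built.
    Products are the obstacle: a square has an explicit restricted power, a product has none, so ab
    is recovered from squares and a bracket, dividing by 2. Torsion freeness and divisibility of
    commutators by hbar do not pass to the completion formally; both come from the Artin-Rees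
    statement. The same statement later shows that hbar S is closed in S, hence that S / hbar S is
    separated. Each Darboux pair is used twice, with the roles of coordinate and derivation
    exchanged. A one-variable Taylor expansion, iterated over these 2n conjugate pairs, then gives
    generators of the maximal ideal of S, the approximate orthogonalization of new pairs and the
    universal property of the tensor product. *)

Section AdjointPowers.
Variable R : nzRingType.
Implicit Types a b c : R.

Lemma commutatorDr a b c : commutator a (b + c) = commutator a b + commutator a c.
Proof. by rewrite /commutator mulrDr mulrDl opprD addrACA. Qed.

Lemma commutatorDl a b c : commutator (a + b) c = commutator a c + commutator b c.
Proof. by rewrite /commutator mulrDr mulrDl opprD addrACA. Qed.

Lemma commutatorC a b : commutator a b = - commutator b a.
Proof. by rewrite /commutator opprB. Qed.

Lemma commutatorMr a b c :
  commutator a (b * c) = commutator a b * c + b * commutator a c.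
Proof. by rewrite /commutator mulrBl mulrBr !mulrA addrA subrK. Qed.

Lemma commutatorMl a b c :
  commutator (a * b) c = a * commutator b c + commutator a c * b.
Proof. by rewrite /commutator mulrBl mulrBr !mulrA addrA subrK. Qed.

Lemma iter_commutator n a b :
  iter n (commutator a) b =
  \sum_(i < n.+1) ((-1) ^+ i * (a ^+ (n - i) * b * a ^+ i)) *+ 'C(n, i).
Proof.
elim: n => [|n IHn] /=; first by rewrite big_ord1 !expr0 !mul1r mulr1 bin0.
rewrite IHn /commutator mulr_sumr mulr_suml.
rewrite [in RHS]big_ord_recl /= [X in X - _]big_ord_recl /= !bin0 !mulr1n.
rewrite !expr0 !mulr1 !mul1r !subn0 mulrA -exprS -addrA; congr (_ + _).
rewrite [X in _ - X](_ : _ = \sum_(i < n.+1)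
    ((-1) ^+ i * (a ^+ (n - i) * b * a ^+ i.+1)) *+ 'C(n, i)); last first.
  by apply: eq_bigr => i _; rewrite mulrnAl -!mulrA -exprSr.
rewrite [in RHS](eq_bigr (fun i : 'I_n.+1 =>
    ((-1) ^+ i.+1 * (a ^+ (n - i) * b * a ^+ i.+1)) *+ 'C(n, i.+1)
    - ((-1) ^+ i * (a ^+ (n - i) * b * a ^+ i.+1)) *+ 'C(n, i))); last first.
  move=> i _; rewrite /bump /= add1n subSS binS mulrnDr; congr (_ + _).
  by rewrite exprS mulN1r mulNr mulNrn.
rewrite sumrB; congr (_ - _).
rewrite [RHS]big_ord_recr /= bin_small // mulr0n addr0.
apply: eq_bigr => i _; rewrite /bump /= add1n mulrnAr; congr (_ *+ _).
rewrite !mulrA; congr (_ * _ * _).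
by rewrite [a * _](commr_sign a) -mulrA -exprS -subSn.
Qed.

Section Char.
Variables (p : nat) (charR : p \in [pchar R]).

(** Pascal's rule and the vanishing of the inner binomial coefficients of p make consecutive
    coefficients ['C(p.-1, i)] opposite. *)
Lemma sign_bin_pchar i : (i < p)%N -> ((-1) ^+ i : R) *+ 'C(p.-1, i) = 1.
Proof.
have p_pr := pcharf_prime charR; have p0 := prime_gt0 p_pr.
elim: i => [|i IHi] lt_ip; first by rewrite bin0.
have /eqP := bin_lt_pcharf_0 charR (lt_ip : (0 < i.+1 < p)%N).
rewrite -{1}(prednK p0) binS natrD addr_eq0 => /eqP e.
by rewrite -mulr_natr e mulrN exprS mulN1r mulNr opprK mulr_natr IHi // ltnW.
Qed.

Lemma iter_commutator_pred a b :
  iter p.-1 (commutator a) b = \sum_(i < p) a ^+ (p.-1 - i) * b * a ^+ i.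
Proof.
have p0 := prime_gt0 (pcharf_prime charR).
rewrite iter_commutator prednK //; apply: eq_bigr => i _.
by rewrite -mulrnAl sign_bin_pchar // mul1r.
Qed.

(** Multiplying the sum of [iter_commutator_pred] by [a] on either side gives words that cancel in
    pairs, except for the two extreme ones. *)
Lemma iter_commutator_pchar a b : iter p (commutator a) b = commutator (a ^+ p) b.
Proof.
have telescope m : commutator a (\sum_(i < m.+1) a ^+ (m - i) * b * a ^+ i)
    = commutator (a ^+ m.+1) b.
  rewrite /commutator mulr_sumr mulr_suml big_ord_recl big_ord_recr /=.
  rewrite expr0 mulr1 subn0 mulrA -exprS subnn expr0 mul1r -mulrA -exprSr.
  rewrite opprD addrA; congr (_ - _).
  rewrite -addrA -sumrB big1 ?addr0 // => i _; rewrite /bump /= add1n.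
  rewrite !mulrA -exprS -[_ * a ^+ i * a]mulrA -exprSr.
  apply/eqP; rewrite subr_eq0; apply/eqP; congr (_ ^+ _ * _ * _).
  by have := ltn_ord i; lia.
have p0 := prime_gt0 (pcharf_prime charR).
by rewrite -[in LHS](prednK p0) iterS iter_commutator_pred -(prednK p0) telescope.
Qed.

End Char.
End AdjointPowers.

Section Jacobson.
Variables (R : nzRingType) (p : nat) (charR : p \in [pchar R]).
Implicit Types a b : R.

Local Notation line a b := (a%:P * 'X + b%:P).

Lemma coef_line_exp a b n :
  ((line a b ^+ n)`_n = a ^+ n) /\ (forall m, (n < m)%N -> (line a b ^+ n)`_m = 0).
Proof.
elim: n => [|n [IHt IHz]].
  by rewrite expr0; split=> [|[|m] //]; rewrite coefC.
split=> [|[|m] //]; rewrite exprS mulrDl -mulrA -commr_polyX mulrA coefD coefMX /= !coefCM.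
  by rewrite IHt (IHz n.+1) // mulr0 addr0 exprS.
by rewrite ltnS => lt_nm; rewrite (IHz m) // (IHz m.+1) ?mulr0 ?addr0 // ltnW.
Qed.

Lemma deriv_line_exp a b n : (line a b ^+ n)^`() =
  \sum_(i < n) line a b ^+ (n.-1 - i) * a%:P * line a b ^+ i.
Proof.
elim: n => [|n IHn]; first by rewrite expr0 derivC big_ord0.
rewrite exprSr derivM IHn mulr_suml.
have -> : (line a b)^`() = a%:P.
  by rewrite derivD derivC addr0 derivM derivC mul0r add0r derivX mulr1.
rewrite addrC [in RHS]big_ord_recl subn0 expr0 mulr1 /=; congr (_ + _).
apply: eq_bigr => i _; rewrite /bump /= add1n -[LHS]mulrA -exprSr.
by congr (_ ^+ _ * _ * _); lia.
Qed.

(* Differentiating (a t + b)^p in t turns the sum of the words of a given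
   degree in a into an iterated commutator. *)
Lemma jacobson a b : exists s : nat -> R,
  (a + b) ^+ p = a ^+ p + b ^+ p + \sum_(i < p.-1) s i /\
  forall i, s i *+ i.+1 = (iter p.-1 (commutator (line a b)) a%:P)`_i.
Proof.
have p0 := prime_gt0 (pcharf_prime charR).
have [lead big] := coef_line_exp a b p.
(* The words of degree i + 1 in [a]; the shift and the factor [i.+1] both come from the
   derivative. *)
exists (fun i => (line a b ^+ p)`_i.+1); split; last first.
  move=> i; rewrite -coef_deriv deriv_line_exp iter_commutator_pred //.
  exact: (rmorph_pchar polyC).
(* Evaluation is multiplicative only at elements commuting with [a] and [b]; it is used at 1 and at
   0. *)
have horner_exp x n : GRing.comm a x -> GRing.comm b x ->
    (line a b ^+ n).[x] = (a * x + b) ^+ n.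
  move=> cax cbx; elim: n => [|n IHn]; first by rewrite !expr0 hornerC.
  rewrite !exprSr hornerM_comm ?IHn ?hornerMXaddC ?hornerC //.
  rewrite /comm_poly ?hornerMXaddC ?hornerC mulrDl mulrDr cbx; congr (_ + _).
  by rewrite mulrA -cax.
have <- : (line a b ^+ p).[1] = (a + b) ^+ p.
  by rewrite horner_exp ?mulr1 //; apply: commr1.
have sz : (size (line a b ^+ p) <= p.+1)%N by apply/leq_sizeP => j /big.
rewrite (horner_coef_wide _ sz) -lead -[p in b ^+ p](prednK p0).
have <- : (line a b ^+ p)`_0 = b ^+ p.-1.+1.
  rewrite prednK // -horner_coef0 horner_exp ?mulr0 ?add0r //; exact: commr0.
rewrite -(prednK p0) big_ord_recl big_ord_recr /= !expr1n !mulr1.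
rewrite addrA addrC addrA; congr (_ + _ + _).
by apply: eq_bigr => i _; rewrite expr1n mulr1.
Qed.

End Jacobson.

(** * Filtered quantizations *)

Section Constants.
Variable k : comNzRingType.

Lemma fps_ext (f g : fps k) : (forall n, f n = g n) -> f = g.
Proof. by case: f g => [f] [g] /funext /= ->. Qed.

Definition fpsC (c : k) : fps k := Fps (fun n => if n is 0 then c else 0).

Fact fpsC_is_zmod_morphism : zmod_morphism fpsC.
Proof. by move=> a b; apply: fps_ext => -[|n] //=; rewrite subr0. Qed.

Fact fpsC_is_monoid_morphism : monoid_morphism fpsC.
Proof.
split; first by apply: fps_ext => -[|n].
move=> a b; apply: fps_ext => n /=; rewrite big_ord_recl subn0 big1 ?addr0.
  by case: n => //=; rewrite mulr0.
by move=> i _; rewrite mul0r.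
Qed.

HB.instance Definition _ := GRing.isZmodMorphism.Build k (fps k) fpsC
  fpsC_is_zmod_morphism.
HB.instance Definition _ := GRing.isMonoidMorphism.Build k (fps k) fpsC
  fpsC_is_monoid_morphism.

Lemma pchar_fps_alg p (R : algType (fps k)) : p \in [pchar k] -> p \in [pchar R].
Proof. by move=> /(rmorph_pchar fpsC) /(rmorph_pchar (in_alg R)). Qed.

Lemma fps_hbarM (f : fps k) n : (hbar * f) n = if n is m.+1 then f m else 0.
Proof.
rewrite [LHS]/=; case: n => [|n]; first by rewrite big_ord1 mul0r.
rewrite !big_ord_recl mul0r add0r mul1r subn1 big1 ?addr0 // => i _.
by rewrite mul0r.
Qed.

Lemma fps_split (f : fps k) : f = fpsC (f 0%N) + hbar * Fps (fun n => f n.+1).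
Proof.
apply: fps_ext => n; have coefD (g h : fps k) : (g + h) n = g n + h n by [].
by rewrite coefD fps_hbarM; case: n {coefD} => [|n] /=; rewrite ?addr0 ?add0r.
Qed.

End Constants.

Section Central.
Variables (K : comNzRingType) (R : algType K).
Implicit Types a b z : R.

Lemma centralE z : z \in @central R -> forall a, z * a = a * z.
Proof. by move/asboolP. Qed.

Lemma centralI z : (forall a, z * a = a * z) -> z \in @central R.
Proof. by move=> h; apply/asboolP. Qed.

Lemma centralP z : z \in @central R <-> forall a, commutator a z = 0.
Proof.
split=> [/centralE h a|h]; first by rewrite /commutator h subrr.
by apply: centralI => a; apply/esym/eqP; rewrite -subr_eq0; apply/eqP/h.
Qed.

Lemma centralB a b : a \in @central R -> b \in @central R -> a - b \in @central R.
Proof.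
by move=> /centralE ca /centralE cb; apply: centralI => c; rewrite mulrBl mulrBr ca cb.
Qed.

Lemma central0 : 0 \in @central R.
Proof. by apply: centralI => a; rewrite mul0r mulr0. Qed.

Lemma central1 : 1 \in @central R.
Proof. by apply: centralI => a; rewrite mul1r mulr1. Qed.

Lemma centralD a b : a \in @central R -> b \in @central R -> a + b \in @central R.
Proof.
by move=> /centralE ca /centralE cb; apply: centralI => c; rewrite mulrDl mulrDr ca cb.
Qed.

Lemma centralZ (c : K) a : a \in @central R -> c *: a \in @central R.
Proof.
by move=> /centralE ca; apply: centralI => b; rewrite -scalerAl -scalerAr ca.
Qed.

Lemma centralM a b : a \in @central R -> b \in @central R -> a * b \in @central R.
Proof.
move=> /centralE ca /centralE cb; apply: centralI => c.
by rewrite -mulrA cb mulrA ca mulrA.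
Qed.

Lemma centralX a n : a \in @central R -> a ^+ n \in @central R.
Proof.
move=> ca; elim: n => [|n IHn]; first exact: central1.
by rewrite exprS; apply: centralM.
Qed.

Lemma commutatorZr (c : K) a b : commutator a (c *: b) = c *: commutator a b.
Proof. by rewrite /commutator -scalerAl -scalerAr scalerBr. Qed.

Lemma commutatorZl (c : K) a b : commutator (c *: a) b = c *: commutator a b.
Proof. by rewrite /commutator -scalerAl -scalerAr scalerBr. Qed.

End Central.

(* Weights: hbar has weight 2, so that hbar^-1 [ , ] lowers weights by 2. *)
Record filtered_quantization (k : fieldType) (R : algType (fps k))
    (G : nat -> set R) : Prop := FilteredQuantization {
  filtT : forall a, G 0%N a;
  filt0 : forall n, G n 0;
  filtB : forall n a b, G n a -> G n b -> G n (a - b);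
  filtS : forall n a, G n.+1 a -> G n a;
  filtM : forall i j a b, G i a -> G j b -> G (i + j)%N (a * b);
  filt_hbar : forall n a, G n a -> G n.+2 (hbar *: a);
  filt_comm : forall i j a b, G i a -> G j b ->
    exists2 c, G (i + j - 2)%N c & commutator a b = hbar *: c;
  filt_tf : forall a : R, hbar *: a = 0 -> a = 0 }.

(* hbar^-1 [a, b], or 0 when hbar does not divide the commutator. *)
Definition dl (k : comNzRingType) (R : algType (fps k)) (a b : R) : R :=
  xget 0 [set c | commutator a b = hbar *: c].

(* b can serve as a^[p]. *)
Definition ppow (k : comNzRingType) (p : nat) (R : algType (fps k)) (a b : R) : Prop :=
  a ^+ p - hbar ^+ p.-1 *: b \in @central R.

Section Filtered.
Variables (k : fieldType) (R : algType (fps k)) (G : nat -> set R).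
Hypothesis FQ : filtered_quantization G.
Implicit Types (a b c : R) (i j n m : nat).

Lemma filtN n a : G n a -> G n (- a).
Proof. by move=> Ga; rewrite -sub0r; apply: (filtB FQ) => //; apply: (filt0 FQ). Qed.

Lemma filtD n a b : G n a -> G n b -> G n (a + b).
Proof. by move=> Ga Gb; rewrite -[b]opprK; apply: (filtB FQ) => //; apply: filtN. Qed.

Lemma filtW n m a : (m <= n)%N -> G n a -> G m a.
Proof.
elim: n => [|n IHn]; first by rewrite leqn0 => /eqP->.
by rewrite leq_eqVlt => /predU1P[->//|/IHn h /(filtS FQ)/h].
Qed.

Lemma filtMl n a b : G n b -> G n (a * b).
Proof. by move=> Gb; rewrite -[n]add0n; apply: (filtM FQ) => //; apply: (filtT FQ). Qed.

Lemma filtMr n a b : G n a -> G n (a * b).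
Proof. by move=> Ga; rewrite -[n]addn0; apply: (filtM FQ) => //; apply: (filtT FQ). Qed.

Lemma filtZ n (c : fps k) a : G n a -> G n (c *: a).
Proof. by move=> Ga; rewrite -[a]mul1r scalerAl; apply: filtMl. Qed.

Lemma filtX n a m : G n a -> G (m * n)%N (a ^+ m).
Proof.
move=> Ga; elim: m => [|m IHm]; first exact: (filtT FQ).
by rewrite exprS mulSn; apply: (filtM FQ).
Qed.

Lemma filt_hbarX n m a : G n a -> G (2 * m + n)%N (hbar ^+ m *: a).
Proof.
move=> Ga; elim: m => [|m IHm]; first by rewrite expr0 scale1r.
by rewrite exprS -scalerA mulnS !addSn add0n; apply: (filt_hbar FQ).
Qed.

Lemma filt_sum (I : Type) (r : seq I) (P : pred I) (F : I -> R) n :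
  (forall x, P x -> G n (F x)) -> G n (\sum_(x <- r | P x) F x).
Proof. by move=> h; apply: big_ind => //; [apply: (filt0 FQ) | move=> *; apply: filtD]. Qed.

Lemma filtMn n a m : G n a -> G n (a *+ m).
Proof.
by move=> Ga; elim: m => [|m IHm]; rewrite ?mulr0n ?mulrS; [apply: (filt0 FQ)|apply: filtD].
Qed.

Lemma hbar_inj a b : hbar *: a = hbar *: b -> a = b.
Proof.
by move=> e; apply/eqP; rewrite -subr_eq0; apply/eqP/(filt_tf FQ); rewrite scalerBr e subrr.
Qed.

Lemma hbarX_inj n a b : hbar ^+ n *: a = hbar ^+ n *: b -> a = b.
Proof.
elim: n => [|n IHn]; first by rewrite !expr0 !scale1r.
by rewrite exprS -!scalerA => /hbar_inj/IHn.
Qed.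

Lemma hbarX_eq0 n a : hbar ^+ n *: a = 0 -> a = 0.
Proof. by move=> e; apply: (@hbarX_inj n); rewrite e scaler0. Qed.

Lemma dlE a b : commutator a b = hbar *: dl a b.
Proof.
have [c _ e] := filt_comm FQ (filtT FQ a) (filtT FQ b).
by rewrite /dl; case: xgetP => [d _ //|/(_ c)].
Qed.

Lemma dl_eq a b c : commutator a b = hbar *: c -> dl a b = c.
Proof. by rewrite dlE => /hbar_inj. Qed.

Lemma dl_filt i j a b : G i a -> G j b -> G (i + j - 2)%N (dl a b).
Proof. by move=> Ga Gb; have [c Gc /dl_eq->] := filt_comm FQ Ga Gb. Qed.

Lemma dl_filt1 j a b : G 1%N a -> G j b -> G j.-1 (dl a b).
Proof. by move=> Ga /(dl_filt Ga); rewrite add1n subSS subn1. Qed.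

Lemma dlDr a b c : dl a (b + c) = dl a b + dl a c.
Proof. by apply: dl_eq; rewrite commutatorDr !dlE scalerDr. Qed.

Lemma dlDl a b c : dl (a + b) c = dl a c + dl b c.
Proof. by apply: dl_eq; rewrite commutatorDl !dlE scalerDr. Qed.

Lemma dlZr (s : fps k) a b : dl a (s *: b) = s *: dl a b.
Proof. by apply: dl_eq; rewrite commutatorZr dlE !scalerA mulrC. Qed.

Lemma dlZl (s : fps k) a b : dl (s *: a) b = s *: dl a b.
Proof. by apply: dl_eq; rewrite commutatorZl dlE !scalerA mulrC. Qed.

Lemma dlNr a b : dl a (- b) = - dl a b.
Proof. by rewrite -scaleN1r dlZr scaleN1r. Qed.

Lemma dlNl a b : dl (- a) b = - dl a b.
Proof. by rewrite -scaleN1r dlZl scaleN1r. Qed.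

Lemma dlBr a b c : dl a (b - c) = dl a b - dl a c.
Proof. by rewrite dlDr dlNr. Qed.

Lemma dlBl a b c : dl (a - b) c = dl a c - dl b c.
Proof. by rewrite dlDl dlNl. Qed.

Lemma dlC a b : dl a b = - dl b a.
Proof. by apply: dl_eq; rewrite commutatorC dlE scalerN. Qed.

Lemma dlMr a b c : dl a (b * c) = dl a b * c + b * dl a c.
Proof. by apply: dl_eq; rewrite commutatorMr !dlE scalerDr -scalerAl -scalerAr. Qed.

Lemma dlMl a b c : dl (a * b) c = a * dl b c + dl a c * b.
Proof. by apply: dl_eq; rewrite commutatorMl !dlE scalerDr -scalerAl -scalerAr. Qed.

Lemma dl_commute a b : dl a b = 0 <-> a * b = b * a.
Proof.
split=> [e|e]; last by apply: dl_eq; rewrite scaler0 /commutator e subrr.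
by apply/eqP; rewrite -subr_eq0 -/(commutator a b) dlE e scaler0.
Qed.

Lemma dlxx a : dl a a = 0.
Proof. exact/dl_commute. Qed.

Lemma dl0r a : dl a 0 = 0.
Proof. by apply/dl_commute; rewrite mulr0 mul0r. Qed.

Lemma dl1r a : dl a 1 = 0.
Proof. by apply/dl_commute; rewrite mulr1 mul1r. Qed.

Lemma dl_central a z : z \in @central R -> dl a z = 0.
Proof. by move/centralE => cz; apply/dl_commute. Qed.

Lemma dl_central_l a z : z \in @central R -> dl z a = 0.
Proof. by move/dl_central => cz; rewrite dlC cz oppr0. Qed.

(** Multiplied by hbar twice, this is the Jacobi identity for commutators; hbar can be cancelled. *)
Lemma dl_jacobi a b c : dl a (dl b c) = dl (dl a b) c + dl b (dl a c).
Proof.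
apply/hbar_inj/hbar_inj; rewrite !scalerDr.
have e (x y z : R) : hbar *: (hbar *: dl x (dl y z)) = commutator x (commutator y z).
  by rewrite (dlE y) commutatorZr dlE.
rewrite !e (dlC (dl a b)) !scalerN e.
rewrite /commutator !mulrBl !mulrBr !mulrA !opprB [RHS]addrACA !subrKA.
by rewrite addrACA [RHS]addrACA [- _ - _ in RHS]addrC.
Qed.

Lemma dl_sum (I : Type) (r : seq I) (P : pred I) (F : I -> R) a :
  dl a (\sum_(x <- r | P x) F x) = \sum_(x <- r | P x) dl a (F x).
Proof. by apply: (big_morph (dl a)); [move=> *; rewrite dlDr | rewrite dl0r]. Qed.

Lemma iter_dl_commutator n a b :
  iter n (commutator a) b = hbar ^+ n *: iter n (dl a) b.
Proof.
elim: n => [|n IHn] /=; first by rewrite expr0 scale1r.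
by rewrite IHn commutatorZr dlE scalerA -exprSr.
Qed.

Lemma iter_dlD n a b c : iter n (dl a) (b + c) = iter n (dl a) b + iter n (dl a) c.
Proof. by elim: n => //= n ->; rewrite dlDr. Qed.

Lemma iter_dlZ n a (s : fps k) b : iter n (dl a) (s *: b) = s *: iter n (dl a) b.
Proof. by elim: n => //= n ->; rewrite dlZr. Qed.

Lemma iter_dlMr n a b c : dl a c = 0 -> iter n (dl a) (b * c) = iter n (dl a) b * c.
Proof. by move=> e; elim: n => //= n ->; rewrite dlMr e mulr0 addr0. Qed.

Lemma iter_dlMl n a b c : dl a b = 0 -> iter n (dl a) (b * c) = b * iter n (dl a) c.
Proof. by move=> e; elim: n => //= n ->; rewrite dlMr e mul0r add0r. Qed.

Lemma iter_dl0 n a : iter n (dl a) 0 = 0.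
Proof. by elim: n => //= n ->; rewrite dl0r. Qed.

Lemma iter_dl_filt n a j b : G 1%N a -> G j b -> G (j - n)%N (iter n (dl a) b).
Proof.
move=> Ga Gb; elim: n => [|n IHn] /=; first by rewrite subn0.
by rewrite subnS; apply: dl_filt1.
Qed.

End Filtered.

Section RestrictedPowers.
Variables (k : fieldType) (R : algType (fps k)) (G : nat -> set R).
Hypothesis FQ : filtered_quantization G.
Variables (p : nat) (chark : p \in [pchar k]) (p_gt2 : (2 < p)%N).
Implicit Types (a b c : R) (i j n m : nat).

Let charR : p \in [pchar R] := pchar_fps_alg R chark.
Let p_pr : prime p := pcharf_prime chark.
Let p0 : (0 < p)%N := prime_gt0 p_pr.

Lemma pnatr_neq0 i : (0 < i < p)%N -> (i%:R : k) != 0.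
Proof.
move=> /andP[i0 ip]; rewrite -(dvdn_pcharf chark).
by apply/negP => /(dvdn_leq i0); rewrite leqNgt ip.
Qed.

Lemma fpsC_natV i a : (0 < i < p)%N -> fpsC (i%:R^-1 : k) *: (a *+ i) = a.
Proof.
move=> h; rewrite -scaler_nat scalerA -(rmorph_nat (@fpsC k)) -rmorphM mulVf ?pnatr_neq0 //.
by rewrite rmorph1 scale1r.
Qed.

(** The axiom ad(a)^p = ad(a^[p]) of a restricted Lie algebra, obtained from ad(a)^p = ad(a^p) by
    cancelling hbar^p. *)
Lemma ppow_iter a b c : ppow p a b -> iter p (dl a) c = dl b c.
Proof.
move=> /centralP h; apply: (hbarX_inj FQ (n := p)).
rewrite -(iter_dl_commutator FQ) (iter_commutator_pchar charR).
have /eqP := h c; rewrite commutatorDr -scaleNr commutatorZr scaleNr.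
rewrite subr_eq0 => /eqP e.
by rewrite [LHS]commutatorC e (dlE FQ) scalerA -exprSr prednK // (dlC FQ c) scalerN opprK.
Qed.

Lemma ppow_commute a b c : ppow p a b -> dl c a = 0 -> dl c b = 0.
Proof.
move=> /centralP h /(dl_commute FQ) e; apply/(dl_commute FQ).
have /eqP := h c; rewrite commutatorDr -scaleNr commutatorZr.
have -> : commutator c (a ^+ p) = 0.
  by rewrite /commutator (commrX p (e : GRing.comm c a)) subrr.
rewrite add0r scaleNr oppr_eq0 => /eqP /(hbarX_eq0 FQ) /eqP.
by rewrite subr_eq0 => /eqP.
Qed.

Lemma ppow_dl a b : ppow p a b -> dl a b = 0.
Proof. by move=> h; apply: (ppow_commute h); apply: (dlxx FQ). Qed.

Lemma ppowZ (s : fps k) a b : ppow p a b -> ppow p (s *: a) (s ^+ p *: b).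
Proof.
rewrite /ppow => h; rewrite exprZn scalerA mulrC -scalerA -scalerBr.
exact: centralZ.
Qed.

Lemma ppowN a b : ppow p a b -> ppow p (- a) (- b).
Proof.
move=> /(ppowZ (-1)); rewrite -signr_odd.
have -> : odd p by case: (even_prime p_pr) p_gt2 => [->|].
by rewrite expr1 !scaleN1r.
Qed.

Lemma ppow_central a b z : ppow p a b -> z \in @central R -> ppow p a (b + z).
Proof.
by move=> h cz; rewrite /ppow scalerDr opprD addrA; apply/centralB/centralZ.
Qed.

(** With a^p = L + hbar^(p-1) b and L central, (a^2)^p = L^2 + hbar^(p-1) (2 L b + hbar^(p-1) b^2),
    and L^2 is central. *)
Lemma ppow_sq a b : ppow p a b ->
  ppow p (a ^+ 2) ((a ^+ p - hbar ^+ p.-1 *: b) * b *+ 2 + hbar ^+ p.-1 *: b ^+ 2).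
Proof.
rewrite /ppow -exprM mulnC exprM => h.
move: (a ^+ p - _ *: b) h (subrK (hbar ^+ p.-1 *: b) (a ^+ p)) => L h' <-.
move: (hbar ^+ p.-1) (centralE h' b) => t cL.
rewrite expr2 mulrDl !mulrDr -!scalerAl -!scalerAr -cL scalerDr addrACA.
rewrite -!addrA [X in L * L + X](_ : _ = 0) ?addr0; first exact: centralM.
by rewrite -expr2 mulr2n scalerDr !addrA subrr.
Qed.

(* The coefficients of the iterated bracket of t a + b with a. *)
Fixpoint jac a b (q : nat) : nat -> R :=
  if q is q'.+1 then
    fun i => dl b (jac a b q' i) + (if i is i'.+1 then dl a (jac a b q' i') else 0)
  else fun i => if i is 0 then a else 0.

(** Jacobson's Lie polynomial, which measures how far p-th powers are from additive, with [dl] in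
    place of the commutator; the factors 1/(i+1) undo the derivative in [jacobson]. *)
Definition jacL a b : R :=
  \sum_(i < p.-1) fpsC (i.+1%:R^-1 : k) *: jac a b p.-1 i.

Lemma coef_jac a b q i :
  (iter q (commutator (a%:P * 'X + b%:P)) a%:P)`_i = hbar ^+ q *: jac a b q i.
Proof.
elim: q i => [|q IHq] i; first by rewrite expr0 scale1r coefC; case: i.
rewrite iterS commutatorDl coefD addrC exprSr -scalerA [jac _ _ _ _]/= !scalerDr; congr (_ + _).
  by rewrite coefB coefCM coefMC IHq -[LHS]/(commutator _ _) commutatorZr (dlE FQ).
rewrite coefB -mulrA -commr_polyX !mulrA !coefMX coefCM; case: i => [|i] /=.
  by rewrite subrr !scaler0.
by rewrite coefMC IHq -[LHS]/(commutator _ _) commutatorZr (dlE FQ).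
Qed.

Lemma jacobson_filt a b : (a + b) ^+ p = a ^+ p + b ^+ p + hbar ^+ p.-1 *: jacL a b.
Proof.
have [s [-> es]] := jacobson charR a b; congr (_ + _).
rewrite /jacL scaler_sumr; apply: eq_bigr => i _.
have hi : (0 < i.+1 < p)%N by have := ltn_ord i; lia.
by rewrite -(fpsC_natV (s i) hi) es coef_jac !scalerA mulrC.
Qed.

Lemma ppowD a b a' b' :
  ppow p a a' -> ppow p b b' -> ppow p (a + b) (a' + b' + jacL a b).
Proof.
rewrite /ppow jacobson_filt => ha hb; rewrite !scalerDr opprD addrACA subrr addr0.
by rewrite opprD addrACA; apply: centralD.
Qed.

Lemma jac_small a b q i : (q < i)%N -> jac a b q i = 0.
Proof.
elim: q i => [|q IHq] [|i] //= lt_qi; rewrite !IHq ?(dl0r FQ) ?addr0 //; lia.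
Qed.

(** The words are q-fold brackets with i + 1 entries [a] and q - i entries [b], and each bracket
    costs 2. The bound is stated without subtraction because weights are truncated at 0. *)
Lemma jac_filt al be a b q i e : G al a -> G be b -> (i <= q)%N ->
  (e + 2 * q <= i.+1 * al + (q - i) * be)%N -> G e (jac a b q i).
Proof.
move=> Ga Gb; elim: q i e => [|q IHq] i e le_iq le_e /=.
  by move: le_iq le_e; rewrite leqn0 => /eqP-> le_e; apply: (filtW FQ _ Ga); lia.
apply: (filtD FQ).
  have [le_iq'|lt_qi] := leqP i q; last first.
    by rewrite jac_small // (dl0r FQ); apply: (filt0 FQ).
  have h := IHq i (i.+1 * al + (q - i) * be - 2 * q)%N le_iq'.
  case: (leqP (2 * q) (i.+1 * al + (q - i) * be)) => hq.
    apply: (filtW FQ _ (dl_filt FQ Gb (h _))); last by rewrite subnK.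
    by move: le_e; rewrite (subSn le_iq') mulSn; lia.
  have h0 := filtT FQ (jac a b q i).
  by apply: (filtW FQ _ (dl_filt FQ Gb h0)); move: le_e; rewrite (subSn le_iq') mulSn; lia.
case: i le_iq le_e => [|i] le_iq le_e; first exact: (filt0 FQ).
have le_iq' : (i <= q)%N by [].
have h := IHq i (i.+1 * al + (q - i) * be - 2 * q)%N le_iq'.
case: (leqP (2 * q) (i.+1 * al + (q - i) * be)) => hq.
  apply: (filtW FQ _ (dl_filt FQ Ga (h _))); last by rewrite subnK.
  by move: le_e; rewrite subSS (mulSn i.+1); lia.
have h0 := filtT FQ (jac a b q i).
by apply: (filtW FQ _ (dl_filt FQ Ga h0)); move: le_e; rewrite subSS (mulSn i.+1); lia.
Qed.

Lemma jacL_filt al be a b e : G al a -> G be b ->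
    (forall i, (i <= p.-2)%N -> (0 < e)%N -> (e + 2 * p.-1 <= i.+1 * al + (p.-1 - i) * be)%N) ->
  G e (jacL a b).
Proof.
case: e => [|e] Ga Gb h; first exact: (filtT FQ).
apply: (filt_sum FQ) => i _; apply: (filtZ FQ).
by apply: (jac_filt Ga Gb); [have := ltn_ord i | apply: h => //; have := ltn_ord i]; lia.
Qed.

(* The words of degree one in b contribute dl_a^(p-1) b; all others are smaller. *)
Lemma jacL_leading be a b : G 1%N a -> G be b -> (0 < be)%N ->
  G (2 * be - p)%N (jacL a b - iter p.-1 (dl a) b).
Proof.
move=> Ga Gb be0; case: (leqP (2 * be) p) => [|be_p].
  by rewrite -subn_eq0 => /eqP->; apply: (filtT FQ).
(* Index q of the (q+1)-fold bracket collects the words with a single [b]. Index q + 1, with no [b],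
   vanishes because [dl a a = 0], so a single word is left; the sign comes from
   [dl b a = - dl a b]. *)
have top q : jac a b q.+1 q = - iter q.+1 (dl a) b.
  elim: q => [|q IHq]; first by rewrite /= addr0 (dlC FQ).
  have jac0 : jac a b q.+1 q.+1 = 0.
    elim: q {IHq} => [|q IHq]; first by rewrite /= (dl0r FQ) (dlxx FQ) addr0.
    rewrite -/(jac a b q.+2 q.+2) [jac _ _ _ _]/= -/(jac a b q.+1 _).
    by rewrite -[dl b _ + _]/(dl b (jac a b q.+1 q.+2) + dl a (jac a b q.+1 q.+1)) IHq jac_small // !(dl0r FQ) addr0.
  rewrite -[jac a b q.+2 q.+1]/(dl b (jac a b q.+1 q.+1) + dl a (jac a b q.+1 q)).
  by rewrite jac0 IHq (dl0r FQ) add0r (dlNr FQ).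
rewrite /jacL; have -> : p.-1 = p.-2.+1 by lia.
rewrite big_ord_recr [nat_of_ord ord_max]/= top scalerN.
(* The last coefficient of [jacL] is 1/(p-1) = -1 and cancels the sign in [top]. *)
have -> : (p.-2.+1%:R^-1 : k) = -1.
  have -> : p.-2.+1%:R = -1 :> k.
    apply/eqP; rewrite -subr_eq0 opprK natr1; have -> : p.-2.+2 = p by lia.
    by rewrite (pcharf0 chark).
  by rewrite invrN invr1.
rewrite rmorphN1 scaleN1r opprK addrK.
apply: (filt_sum FQ) => i _; apply: (filtZ FQ).
apply: (jac_filt Ga Gb) => /=; first by have := ltn_ord i; lia.
have := ltn_ord i; move: (nat_of_ord i) => j lt_j.
have -> : (p.-2.+1 - j = 2 + (p.-2 - j.+1))%N by lia.
have : (p.-2 - j.+1 <= (p.-2 - j.+1) * be)%N by rewrite leq_pmulr.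
by rewrite muln1 mulnDl; lia.
Qed.

End RestrictedPowers.

Section RestrictedFiltration.
Variables (k : fieldType) (R : algType (fps k)) (G : nat -> set R).
Hypothesis FQ : filtered_quantization G.
Variables (p : nat) (chark : p \in [pchar k]) (p_gt2 : (2 < p)%N).
Implicit Types (a b c u v w : R) (i j n m : nat).

Definition restricted_filtration :=
  forall n a, (0 < n)%N -> G n a -> exists2 b, G n b & ppow p a b.

(** The worst word has one entry [b] and p - 1 entries [a]. Its weight n + (p-1) m - 2 (p-1) is at
    least n because m is at least 2. *)
Lemma jacL_filt_ge2 m n a b :
  (1 < m <= n)%N -> G m a -> G n b -> G n (jacL p a b).
Proof.
move=> /andP[m1 mn] Ga Gb; apply: (jacL_filt FQ chark p_gt2 Ga Gb) => i le_i _.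
have -> : (p.-1 - i = (p.-2 - i).+1)%N by lia.
have : (i.+1 * 2 <= i.+1 * m)%N by rewrite leq_mul2l m1 orbT.
have : ((p.-2 - i) * 2 <= (p.-2 - i) * n)%N by rewrite leq_mul2l (leq_trans m1 mn) orbT.
by rewrite mulSn; lia.
Qed.

(** With [a] of weight 1, the word with a single [b] has weight n + (p-1) - 2 (p-1) only. This loss
    of p - 1 is what [ppow_anticommutator] has to make up for. *)
Lemma jacL_filt1 n a b : (0 < n)%N -> G 1%N a -> G n b -> G (n.+1 - p)%N (jacL p a b).
Proof.
move=> n0 Ga Gb; apply: (jacL_filt FQ chark p_gt2 Ga Gb) => i le_i e0.
have -> : (p.-1 - i = (p.-2 - i).+1)%N by lia.
have : (p.-2 - i <= (p.-2 - i) * n)%N by rewrite leq_pmulr.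
by rewrite mulSn; lia.
Qed.

(* jacL_filt_ge2 would lose too much here: the point is that the bracket of
   a and b, not only b, lies in [G n]. *)
Lemma jacL_filt_dl n a b :
  G 2%N a -> G 2%N b -> G n (dl b a) -> G n (jacL p a b).
Proof.
move=> Ga Gb Gab; apply: (filt_sum FQ) => i _; apply: (filtZ FQ).
have e1 : p.-1 = p.-2.+1 by lia.
move: (nat_of_ord i) => {}i; rewrite e1.
elim: p.-2 i => [|q IHq] i.
  rewrite /=; case: i => [|[|i]]; rewrite ?(dlxx FQ) ?(dl0r FQ) ?addr0 ?add0r //;
  exact: (filt0 FQ).
have step x : G 2%N x -> forall y, G n y -> G n (dl x y).
  by move=> Gx y Gy; have := dl_filt FQ Gx Gy; rewrite addKn.
rewrite -[jac a b q.+2 i]/(dl b (jac a b q.+1 i) +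
  (if i is i'.+1 then dl a (jac a b q.+1 i') else 0)).
apply: (filtD FQ); first exact: step.
by case: i => [|i]; [apply: (filt0 FQ) | apply: step].
Qed.

(** Polarization of [ppow_sq]: ab + ba = (a+b)^2 - a^2 - b^2. The terms of low weight cancel. In
    those that remain, the loss of weight in [jacL p a b] is compensated by a central factor [La] or
    [Lb] of weight p, or by hbar^(p-1) of weight 2p - 2. *)
Lemma ppow_anticommutator n a b a' b' : (0 < n)%N ->
    G 1%N a -> G n b -> G 1%N a' -> G n b' -> ppow p a a' -> ppow p b b' ->
  exists2 c, G n.+1 c & ppow p (a * b + b * a) c.
Proof.
move=> n0 Ga Gb Ga' Gb' ha hb.
have p_pr := pcharf_prime chark.
pose L := jacL p a b; pose t : fps k := hbar ^+ p.-1.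
have GL : G (n.+1 - p)%N L by apply: jacL_filt1.
pose r := b' + L.
have Gr : G (n.+1 - p)%N r by apply: (filtD FQ) => //; apply: (filtW FQ _ Gb'); lia.
have hs : ppow p (a + b) (a' + r) by rewrite addrA; apply: (ppowD FQ chark p_gt2).
have e2 : a * b + b * a = (a + b) ^+ 2 + (- a ^+ 2 + - b ^+ 2).
  by rewrite !expr2 mulrDl !mulrDr [RHS]addrACA addrK [a * a + _]addrC addrK.
have Gaa : G 2%N (a ^+ 2) by apply: (filtX FQ 2 Ga).
have Gbb : G (2 * n)%N (b ^+ 2) by apply: (filtX FQ 2 Gb).
have Gbb2 : G 2%N (b ^+ 2) by apply: (filtW FQ _ Gbb); lia.
have Gs : G 1%N (a + b) by apply: (filtD FQ) => //; apply: (filtW FQ _ Gb).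
have Gss : G 2%N ((a + b) ^+ 2) by apply: (filtX FQ 2 Gs).
have Gn2 : G 2%N (- a ^+ 2 + - b ^+ 2) by apply: (filtD FQ); apply: (filtN FQ).
pose La := a ^+ p - t *: a'; pose Lb := b ^+ p - t *: b'.
have GLa : G p La.
  apply: (filtB FQ); first by rewrite -[p in G p]muln1; apply: (filtX FQ).
  by apply: (filtW FQ _ (filt_hbarX FQ p.-1 Ga')); lia.
have GLb : G p Lb.
  apply: (filtB FQ); first by apply: (filtW FQ _ (filtX FQ p Gb)); rewrite leq_pmulr.
  by apply: (filtW FQ _ (filt_hbarX FQ p.-1 Gb')); lia.
have eL : (a + b) ^+ p - t *: (a' + r) = La + Lb.
  by rewrite (jacobson_filt FQ chark) // -/L -/t /r addrA scalerDr opprD addrACA subrr addr0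
             scalerDr opprD addrACA.
have hsq := ppow_sq hs; have hsqa := ppow_sq ha; have hsqb := ppow_sq hb.
rewrite -/t eL -/La -/Lb in hsq hsqa hsqb.
have hsum := ppowD FQ chark p_gt2 hsq
  (ppowD FQ chark p_gt2 (ppowN chark p_gt2 hsqa) (ppowN chark p_gt2 hsqb)).
rewrite -e2 in hsum; refine (ex_intro2 _ _ _ _ hsum).
apply: (filtD FQ); last first.
  (* Both arguments have weight 2 only, but their sum [a * b + b * a] has weight n + 1, and
     therefore so has their bracket. *)
  apply: jacL_filt_dl => //.
  have -> : (a + b) ^+ 2 = (a * b + b * a) - (- a ^+ 2 + - b ^+ 2) by rewrite e2 addrK.
  rewrite (dlBr FQ) (dlxx FQ) subr0.
  have GT : G n.+1 (a * b + b * a).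
    by apply: (filtD FQ); [exact: (filtM FQ Ga Gb) | rewrite -addn1; exact: (filtM FQ Gb Ga)].
  by have := dl_filt FQ Gn2 GT; rewrite addKn.
rewrite [X in G _ X]addrA; apply: (filtD FQ); last first.
  apply: (@filtW _ _ _ FQ (2 * n)%N); first by lia.
  by apply: (@jacL_filt_ge2 2); [lia | apply: (filtN FQ)..].
have -> : (La + Lb) * (a' + r) *+ 2 + t *: (a' + r) ^+ 2
    + (- (La * a' *+ 2 + t *: a' ^+ 2) - (Lb * b' *+ 2 + t *: b' ^+ 2))
  = (La * r + Lb * (a' + r) - Lb * b') *+ 2 +
    t *: ((a' * r + r * a') + (r ^+ 2 - b' ^+ 2)).
  have zmod x y z w u v : (x + y) + (z + w) + (- (x + z) - (u + v)) = (y - u) + (w - v) :> R.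
    by rewrite [x + y + _]addrACA [LHS]addrACA subrr add0r opprD addrACA.
  have dist x y z w : (x + y) * (z + w) = x * z + (x * w + y * (z + w)) :> R.
    by rewrite mulrDl [x * _]mulrDr addrA.
  have sq x y : (x + y) ^+ 2 = x ^+ 2 + (x * y + y * x + y ^+ 2) :> R.
    by rewrite !expr2 dist mulrDr -addrA.
  rewrite (dist La) (sq a').
  rewrite [in LHS]mulrnDl [in LHS]scalerDr zmod -mulrnBl -scalerBr.
  by rewrite [X in t *: X]addrA.
have Gt x : G (n.+1 - p)%N x -> G n.+1 (t *: x).
  by move=> /(filt_hbarX FQ p.-1) Gx; apply: (filtW FQ _ Gx); lia.
have Gp x y : G p x -> G (n.+1 - p)%N y -> G n.+1 (x * y).
  by move=> Gx Gy; apply: (filtW FQ _ (filtM FQ Gx Gy)); lia.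
have Gb'' : G (n.+1 - p)%N b' by apply: (filtW FQ _ Gb'); lia.
apply: (filtD FQ).
  apply: (filtMn FQ); apply: (filtB FQ); last exact: Gp.
  apply: (filtD FQ); first exact: Gp.
  rewrite mulrDr; apply: (filtD FQ); last exact: Gp.
  have GLb2 : G n Lb.
    apply: (filtB FQ); first by apply: (filtW FQ _ (filtX FQ p Gb)); nia.
    by apply: (filtW FQ _ (filt_hbarX FQ p.-1 Gb')); lia.
  by rewrite -addn1; apply: (filtM FQ).
apply: Gt; apply: (filtD FQ).
  by apply: (filtD FQ); [apply: (filtMl FQ) | apply: (filtMr FQ)].
by rewrite !expr2; apply: (filtB FQ); apply: (filtMl FQ).
Qed.

(** Here 2 is inverted: ab is half of ab + ba + hbar [dl a b]. The bracket has weight n - 1 only,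
    but hbar restores the two missing units. *)
Lemma ppow_mul n a b a' b' d : (0 < n)%N ->
    G 1%N a -> G n b -> G 1%N a' -> G n b' -> G n.-1 d ->
    ppow p a a' -> ppow p b b' -> ppow p (dl a b) d ->
  exists2 c, G n.+1 c & ppow p (a * b) c.
Proof.
move=> n0 Ga Gb Ga' Gb' Gd ha hb hd.
have [c Gc hc] := ppow_anticommutator n0 Ga Gb Ga' Gb' ha hb.
have hh := ppowZ hbar hd.
have hs := ppowZ (fpsC (2%:R^-1 : k)) (ppowD FQ chark p_gt2 hc hh).
have e : a * b = fpsC (2%:R^-1 : k) *: (a * b + b * a + hbar *: dl a b).
  rewrite -(dlE FQ) /commutator addrACA subrr addr0.
  rewrite -mulr2n (fpsC_natV chark) //; lia.
rewrite -e in hs; refine (ex_intro2 _ _ _ _ hs); apply: (filtZ FQ).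
have Gh : G n.+1 (hbar ^+ p *: d) by apply: (filtW FQ _ (filt_hbarX FQ p Gd)); lia.
apply: (filtD FQ); first exact: (filtD FQ).
apply: (@jacL_filt_ge2 n.+1); first by rewrite leqnn; lia.
  by apply: (filtD FQ); [exact: (filtM FQ Ga Gb) | rewrite -addn1; exact: (filtM FQ Gb Ga)].
by apply: (filtW FQ _ (filt_hbar FQ (dl_filt FQ Ga Gb))); lia.
Qed.

Definition filtration_generated := forall n (P : R -> Prop),
  P 0 -> (forall a b, P a -> P b -> P (a + b)) ->
  (forall u v, G 1%N u -> G n.+1 v -> P (u * v)) ->
  (forall w, G n w -> P (hbar *: w)) -> forall a, G n.+2 a -> P a.

(** A restricted power may be changed by central elements, in particular by its constant term. *)
Lemma ppow_filt1 a b : (forall c, exists s : k, G 1%N (c - fpsC s *: 1)) ->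
  ppow p a b -> exists2 b', G 1%N b' & ppow p a b'.
Proof.
move=> res h; have [s Gs] := res b; exists (b - fpsC s *: 1) => //.
by apply: ppow_central => //; rewrite -scaleNr; apply/centralZ/central1.
Qed.

(** Induction on the weight along the generators. Two consecutive weights are carried along because
    a product u v, with v of weight n + 1, needs restricted powers of v and of [dl u v], which has
    weight n. *)
Lemma generated_restricted : (forall a, exists b, ppow p a b) ->
    (forall c, exists s : k, G 1%N (c - fpsC s *: 1)) -> filtration_generated ->
  restricted_filtration.
Proof.
move=> wc res gen.
have p1 a : G 1%N a -> exists2 b, G 1%N b & ppow p a b.
  by move=> _; have [b h] := wc a; apply: ppow_filt1 h.
suff Q n : (forall a, G n a -> exists2 b, G n b & ppow p a b) /\
           (forall a, G n.+1 a -> exists2 b, G n.+1 b & ppow p a b).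
  by case=> [|n] a // _ Ga; apply: (Q n).2.
elim: n => [|n [IH0 IH1]].
  by split=> // a _; have [b h] := wc a; exists b => //; apply: (filtT FQ).
split=> // a Ga.
suff [_ //] : G n.+2 a /\ exists2 b, G n.+2 b & ppow p a b.
apply: (gen n (fun a => G n.+2 a /\ exists2 b, G n.+2 b & ppow p a b)) Ga.
- split; first exact: (filt0 FQ).
  exists 0; first exact: (filt0 FQ).
  rewrite /ppow scaler0 subr0 expr0n; case: eqP p_gt2 => [->//|_ _]; exact: central0.
- move=> {}a b [Ga [a' Ga' ha]] [Gb [b' Gb' hb]]; split; first exact: (filtD FQ).
  exists (a' + b' + jacL p a b); last exact: (ppowD FQ chark p_gt2).
  by apply: (filtD FQ); [apply: (filtD FQ) | apply: (@jacL_filt_ge2 n.+2); rewrite ?leqnn].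
- move=> u v Gu Gv; split; first exact: (filtM FQ Gu Gv).
  have [u' Gu' hu] := p1 u Gu; have [v' Gv' hv] := IH1 v Gv.
  have [d Gd hd] := IH0 _ (dl_filt1 FQ Gu Gv).
  exact: (ppow_mul _ Gu Gv Gu' Gv' Gd hu hv hd).
move=> w Gw; split; first exact: (filt_hbar FQ).
have [d Gd hd] := IH0 w Gw; exists (hbar ^+ p *: d); last exact: ppowZ.
by apply: (filtW FQ _ (filt_hbarX FQ p Gd)); lia.
Qed.

End RestrictedFiltration.

(** * Darboux coordinates in complete quantizations *)

Lemma dependent_choice_seq (T : Type) (P : nat -> T -> Prop) (Q : nat -> T -> T -> Prop) :
  (exists s, P 0%N s) ->
  (forall n s, P n s -> exists s', P n.+1 s' /\ Q n s s') ->
  exists u : nat -> T, (forall n, P n (u n)) /\ (forall n, Q n (u n) (u n.+1)).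
Proof.
move=> [s0 P0] step.
have /choice[f hf] (ns : nat * T) : exists s', P ns.1 ns.2 -> P ns.1.+1 s' /\ Q ns.1 ns.2 s'.
  case: (pselect (P ns.1 ns.2)) => [/step[s' h]|nP]; first by exists s'.
  by exists ns.2 => /nP.
pose u := fix u n := if n is n'.+1 then f (n', u n') else s0.
have Pu n : P n (u n) by elim: n => //= n /(hf (n, u n))[].
by exists u; split=> // n; case: (hf (n, u n) (Pu n)).
Qed.

(** These properties are shared by the completion of A and by commutants inside it ([sub_complete]),
    so the reduction modulo hbar can be carried out in a commutant. *)
Record complete_quantization (k : fieldType) (p : nat) (R : algType (fps k))
    (G : nat -> set R) : Prop := CompleteQuantization {
  cq_filtered : filtered_quantization G;
  cq_restricted : restricted_filtration G p;
  cq_lim : forall x : nat -> R, (forall n, G n (x n.+1 - x n)) ->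
    exists X, forall n, G n (X - x n);
  cq_sep : forall a : R, (forall n, G n a) -> a = 0;
  cq_residue : forall a : R, exists s : k, G 1%N (a - fpsC s *: 1) }.

Section DarbouxPair.
Variables (k : fieldType) (p : nat) (R : algType (fps k)) (G : nat -> set R).
Hypothesis CQ : complete_quantization p G.
Hypotheses (chark : p \in [pchar k]) (p_gt2 : (2 < p)%N).
Implicit Types (a b c s w x y : R).

Let FQ := cq_filtered CQ.
Let p_pr : prime p := pcharf_prime chark.
Let charR : p \in [pchar R] := pchar_fps_alg R chark.

Lemma central_lim z :
  (forall n, exists2 z', z' \in @central R & G n (z - z')) -> z \in @central R.
Proof.
move=> h; apply/centralP => a; apply: (cq_sep CQ) => n; have [z' /centralP cz' Gz] := h n.
have -> : commutator a z = commutator a (z - z') + commutator a z'.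
  by rewrite -commutatorDr subrK.
rewrite cz' addr0; apply: (filtB FQ); [exact: (filtMl FQ) | exact: (filtMr FQ)].
Qed.

Lemma filt_expB n a b m : G n (a - b) -> G n (a ^+ m - b ^+ m).
Proof.
move=> Gab; elim: m => [|m IHm]; first by rewrite subrr; apply: (filt0 FQ).
have -> : a ^+ m.+1 - b ^+ m.+1 = (a - b) * a ^+ m + b * (a ^+ m - b ^+ m).
  by rewrite mulrBl mulrBr -!exprS addrA subrK.
by apply: (filtD FQ); [apply: (filtMr FQ) | apply: (filtMl FQ)].
Qed.

Lemma unit_one_sub u : G 1%N u -> exists2 b, (1 - u) * b = 1 & b * (1 - u) = 1.
Proof.
move=> Gu; have Gun n : G n (u ^+ n) by rewrite -[n in G n]muln1; apply: (filtX FQ).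
have [|b hb] := cq_lim CQ (x := fun n => \sum_(i < n) u ^+ i).
  by move=> n; rewrite big_ord_recr /= addrAC subrr add0r.
pose S n : R := \sum_(i < n) u ^+ i.
have e n : (1 - u) * S n = 1 - u ^+ n by rewrite -opprB mulNr -subrX1 opprB.
have e' n : S n * (1 - u) = 1 - u ^+ n.
  rewrite -e mulr_sumr mulr_suml; apply: eq_bigr => i _.
  by rewrite mulrBl mulrBr mul1r mulr1 -exprS -exprSr.
exists b; apply/eqP; rewrite -subr_eq0; apply/eqP/(cq_sep CQ) => n.
  have -> : (1 - u) * b - 1 = (1 - u) * (b - S n) - u ^+ n.
    by rewrite mulrBr e opprB -addrA [_ - 1 - _]addrAC subrr add0r.
  by apply: (filtB FQ) => //; apply: (filtMl FQ).
have -> : b * (1 - u) - 1 = (b - S n) * (1 - u) - u ^+ n.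
  by rewrite mulrBl e' opprB -addrA [_ - 1 - _]addrAC subrr add0r.
by apply: (filtB FQ) => //; apply: (filtMr FQ).
Qed.

Lemma unit_residue1 a : G 1%N (a - 1) -> exists2 b, a * b = 1 & b * a = 1.
Proof.
move=> /(filtN FQ)/unit_one_sub[b]; rewrite opprK addrCA subrr addr0 => *; by exists b.
Qed.

Lemma dl_inv s a b : a * b = 1 -> b * a = 1 -> dl s a = 0 -> dl s b = 0.
Proof.
move=> ab ba sa; have := dlMr FQ s a b; rewrite ab (dl1r FQ) sa mul0r add0r => /esym e.
by rewrite -[dl s b]mul1r -ba -mulrA e mulr0.
Qed.

Lemma dl_comm_dl s x y : dl s x = 0 -> dl s y = 0 -> dl s (dl x y) = 0.
Proof. by move=> sx sy; rewrite (dl_jacobi FQ) sx sy (dl0r FQ) (dlC FQ) (dl0r FQ) oppr0 addr0. Qed.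

Lemma dl_comm_exp s y n : dl s y = 0 -> dl s (y ^+ n) = 0.
Proof.
move=> sy; elim: n => [|n IHn]; first by rewrite (dl1r FQ).
by rewrite exprS (dlMr FQ) sy IHn mul0r mulr0 addr0.
Qed.

Lemma dl_comm_iter s x y n : dl s x = 0 -> dl s y = 0 -> dl s (iter n (dl x) y) = 0.
Proof. by move=> sx sy; elim: n => //= n; apply: dl_comm_dl. Qed.

Lemma dl_exp_leading x y n : G 1%N x -> G 1%N y -> G 1%N (dl x y - 1) ->
  G n (dl x (y ^+ n) - (y ^+ n.-1) *+ n).
Proof.
move=> Gx Gy Gxy; elim: n => [|n IHn]; first exact: (filtT FQ).
rewrite exprS (dlMr FQ).
have -> : dl x y * y ^+ n + y * dl x (y ^+ n) - (y ^+ n.+1.-1) *+ n.+1 =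
    (dl x y - 1) * y ^+ n + y * (dl x (y ^+ n) - (y ^+ n.-1) *+ n).
  rewrite mulrBl mul1r mulrBr mulrnAr -exprS addrACA -opprD /=; congr (_ - _).
  by case: n {IHn} => [|n]; rewrite ?mulr0n ?addr0 //= -mulrS.
apply: (filtD FQ); last by rewrite -add1n; apply: (filtM FQ).
rewrite -add1n; apply: (filtM FQ) => //.
by rewrite -[n in G n]muln1; apply: (filtX FQ).
Qed.

Lemma iter_dl_exp_leading x y n j : G 1%N x -> G 1%N y -> G 1%N (dl x y - 1) ->
  (j <= n)%N -> G (n - j).+1 (iter j (dl x) (y ^+ n) - (y ^+ (n - j)) *+ (n ^_ j)).
Proof.
move=> Gx Gy Gxy; elim: j => [|j IHj] lt_jn.
  by rewrite subn0 subrr; apply: (filt0 FQ).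
have -> : (n - j.+1).+1 = (n - j)%N by lia.
have := dl_filt1 FQ Gx (IHj (ltnW lt_jn)); rewrite (dlBr FQ) /= => h.
have h2 := filtMn FQ (n ^_ j) (dl_exp_leading (n - j) Gx Gy Gxy).
have := filtD FQ h h2; rewrite -[dl x (y ^+ (n - j) *+ _)]/(dl x _).
have -> : dl x (y ^+ (n - j) *+ n ^_ j) = dl x (y ^+ (n - j)) *+ n ^_ j.
  by elim: (n ^_ j) => [|m IHm]; rewrite ?mulr0n ?(dl0r FQ) // !mulrS (dlDr FQ) IHm.
by rewrite mulrnBl addrA subrK -mulrnA mulnC ffactnSr subnS.
Qed.

(** The leading coefficient is (p-1)!, which is -1 by Wilson's theorem. *)
Lemma iter_dl_exp_pred x y : G 1%N x -> G 1%N y -> G 1%N (dl x y - 1) ->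
  G 1%N (iter p.-1 (dl x) (y ^+ p.-1) + 1).
Proof.
move=> Gx Gy Gxy; have := iter_dl_exp_leading Gx Gy Gxy (leqnn p.-1).
rewrite subnn expr0 ffactnn; have -> : (p.-1)`!%:R = -1 :> R; last by rewrite opprK.
apply/eqP; rewrite -subr_eq0 opprK natr1 -(dvdn_pcharf charR) -Wilson //; lia.
Qed.

(** The new restricted power is w + c^[p] + [jacL p x c] for c = y^(p-1) w. Since w commutes with x,
    the leading part of the last term is (dl x)^(p-1) (y^(p-1)) w, that is -w up to higher weight,
    and cancels w. *)
Lemma central_exp_correction_step m x y w : G 1%N x -> G 1%N y -> G 1%N (dl x y - 1) ->
    ppow p x w -> G m.+1 w ->
  exists2 w', G m.+2 w' & ppow p (x + y ^+ p.-1 * w) w'.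
Proof.
move=> Gx Gy Gxy hx Gw; set c := _ * w.
have Gc : G (m + p)%N c.
  have -> : (m + p = p.-1 + m.+1)%N by lia.
  by apply: (filtM FQ) => //; have := filtX FQ p.-1 Gy; rewrite muln1.
have [c' Gc' hc] := cq_restricted CQ (ltac:(lia) : (0 < m + p)%N) Gc.
exists (w + c' + jacL p x c); last exact: (ppowD FQ chark p_gt2).
rewrite addrAC; apply: (filtD FQ); last by apply: (filtW FQ _ Gc'); lia.
have h1 : G m.+2 (jacL p x c - iter p.-1 (dl x) c).
  by apply: (filtW FQ _ (jacL_leading FQ chark p_gt2 Gx Gc _)); lia.
have h2 : G m.+2 (w + iter p.-1 (dl x) c).
  rewrite /c (iter_dlMr FQ); last exact: (ppow_dl FQ hx).
  rewrite -{1}[w]mul1r -mulrDl addrC -[m.+2]add1n.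
  by apply: (filtM FQ) => //; apply: iter_dl_exp_pred.
by have := filtD FQ h1 h2; rewrite -addrA [w + _]addrC addKr addrC.
Qed.

(* Successively killing the leading term of a restricted p-th power of x. *)
Lemma central_exp_correction x y : G 1%N x -> G 1%N y -> G 1%N (dl x y - 1) ->
  exists X, [/\ G 1%N X, G 1%N (dl X y - 1), X ^+ p \in @central R,
    forall s, dl s x = 0 -> dl s y = 0 -> dl s X = 0 & dl x y = 1 -> dl X y = 1].
Proof.
move=> Gx Gy Gxy.
(* [u.1] is the current approximation of X and [u.2] its restricted power, whose weight grows with
   n. The last two clauses keep the corrections inside every commutant that contains x and y, and
   keep an exact bracket exact. *)
pose P n (u : R * R) := [/\ G 1%N u.1, G 1%N (dl u.1 y - 1), ppow p u.1 u.2, G n.+1 u.2 &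
  (forall s, dl s x = 0 -> dl s y = 0 -> dl s u.1 = 0) /\ (dl x y = 1 -> dl u.1 y = 1)].
have [| |u [Pu Qu]] := @dependent_choice_seq _ P (fun n u v => G n.+3 (v.1 - u.1)).
- have [w Gw hw] := cq_restricted CQ (isT : (0 < 1)%N) Gx.
  by exists (x, w); split=> //; split.
- move=> n [x1 w] [/= G1 G1y h1 Gw [comm ex]].
  have [w' Gw' hw'] := central_exp_correction_step G1 Gy G1y h1 Gw.
  have Gc : G n.+3 (y ^+ p.-1 * w).
    apply: (filtW FQ _ (filtM FQ (filtX FQ p.-1 Gy) Gw)); lia.
  exists (x1 + y ^+ p.-1 * w, w') => /=; rewrite addrAC subrr add0r; split=> //; split=> //=.
  + by apply: (filtD FQ) => //; apply: (filtW FQ _ Gc).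
  + rewrite (dlDl FQ) addrAC; apply: (filtD FQ) => //.
    by apply: (filtW FQ _ (dl_filt FQ Gc Gy)); lia.
  split=> [s sx sy|e1].
    rewrite (dlDr FQ) comm // add0r (dlMr FQ) dl_comm_exp // mul0r add0r.
    by rewrite (ppow_commute FQ h1) ?mulr0 //; apply: comm.
  (* As w is a restricted power of x1, its bracket with y is (dl x1)^p y, which is 0 because
     [dl x1 y = 1] is killed by the next bracket. *)
  rewrite (dlDl FQ) ex // (dlMl FQ) (dlC FQ (y ^+ _)) dl_comm_exp ?(dlxx FQ) //.
  rewrite oppr0 mul0r addr0 -(ppow_iter FQ chark y h1).
  have -> : p = p.-2.+2 by lia.
  by rewrite !iterSr ex // (dl1r FQ) (iter_dl0 FQ) mulr0 addr0.
have [|X hX] := cq_lim CQ (x := fun n => (u n).1).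
  by move=> n; apply: (filtW FQ _ (Qu n)); lia.
have GX : G 1%N X.
  by rewrite -[X](subrK (u 1%N).1); apply: (filtD FQ); [apply: hX | case: (Pu 1%N)].
have dlX n : G n (dl X y - dl (u n.+1).1 y).
  by rewrite -(dlBl FQ); apply: (filtW FQ _ (dl_filt FQ (hX n.+1) Gy)); lia.
exists X; split=> //.
- rewrite -[dl X y](subrK (dl (u 2).1 y)) -addrA.
  by apply: (filtD FQ); [apply: dlX | case: (Pu 2)].
(* X^p is the limit of the central elements x_n^p - hbar^(p-1) w_n, because the w_n tend to 0. *)
- apply: central_lim => n; have [_ _ h Gw _] := Pu n; exists ((u n).1 ^+ p - hbar ^+ p.-1 *: (u n).2) => //.
  rewrite opprB addrCA addrC; apply: (filtD FQ); first exact: filt_expB.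
  by apply: (filtZ FQ); apply: (filtW FQ _ Gw).
- move=> s sx sy; apply: (cq_sep CQ) => n; have [_ _ _ _ [comm _]] := Pu n.+2.
  rewrite -[X](subrK (u n.+2).1) (dlDr FQ) comm // addr0.
  by apply: (filtW FQ _ (dl_filt FQ (filtT FQ s) (hX n.+2))); lia.
move=> e1; apply/eqP; rewrite -subr_eq0; apply/eqP/(cq_sep CQ) => n.
by have [_ _ _ _ [_ ex]] := Pu n.+1; have := dlX n; rewrite ex.
Qed.

(** Once X^p is central, (dl X)^p = 0. Hence s = (dl X)^(p-1) (y^(p-1)), a unit close to -1, is
    killed by [dl X], while t = (dl X)^(p-2) (y^(p-1)) satisfies [dl X t = s]; dividing t by s gives
    a bracket equal to 1. The correction is then applied to that quotient and -X, and preserves the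
    exact bracket. *)
Lemma darboux_pair x y : G 1%N x -> G 1%N y -> G 1%N (dl x y - 1) ->
  exists X Y, [/\ G 1%N X /\ G 1%N Y, dl X Y = 1,
    X ^+ p \in @central R, Y ^+ p \in @central R &
    forall s, dl s x = 0 -> dl s y = 0 -> dl s X = 0 /\ dl s Y = 0].
Proof.
move=> Gx Gy Gxy; have [X [GX GXy cX commX _]] := central_exp_correction Gx Gy Gxy.
have nil a : iter p (dl X) a = 0.
  rewrite (@ppow_iter _ _ _ FQ _ chark X 0) ?(dlC FQ 0) ?(dl0r FQ) ?oppr0 //.
  by rewrite /ppow scaler0 subr0.
pose s := iter p.-1 (dl X) (y ^+ p.-1); pose t := iter p.-2 (dl X) (y ^+ p.-1).
have st : dl X t = s by rewrite /s /t -iterS (_ : p.-2.+1 = p.-1) //; lia.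
have [b sb bs] : exists2 b, (- s) * b = 1 & b * (- s) = 1.
  by apply: unit_residue1; rewrite -opprD; apply/(filtN FQ)/iter_dl_exp_pred.
have Xs : dl X s = 0 by rewrite -iterS prednK ?nil // prime_gt0.
have Xb : dl X b = 0 by apply: (dl_inv sb bs); rewrite (dlNr FQ) Xs oppr0.
pose y1 := b * - t.
have Xy1 : dl X y1 = 1 by rewrite (dlMr FQ) Xb mul0r add0r (dlNr FQ) st.
have Gt : G 1%N t.
  have := iter_dl_filt FQ p.-2 GX (filtX FQ p.-1 Gy).
  by rewrite muln1; have -> : (p.-1 - p.-2 = 1)%N by lia.
have Gy1 : G 1%N y1 by apply/(filtMl FQ)/(filtN FQ).
have GNX : G 1%N (- X) by apply: (filtN FQ).
have y1X : dl y1 (- X) = 1 by rewrite (dlNr FQ) -(dlC FQ).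
have [|Y [GY _ cY commY ex]] := central_exp_correction Gy1 GNX.
  by rewrite y1X subrr; apply: (filt0 FQ).
exists X, Y; split=> //; first by rewrite (dlC FQ) -(dlNr FQ) ex.
move=> r rx ry; have rX := commX r rx ry; split=> //; apply: commY; last first.
  by rewrite (dlNr FQ) rX oppr0.
have rt : dl r t = 0 by apply: dl_comm_iter => //; apply: dl_comm_exp.
have rs : dl r s = 0 by apply: dl_comm_iter => //; apply: dl_comm_exp.
rewrite (dlMr FQ) (dlNr FQ) rt oppr0 mulr0 addr0 (dl_inv sb bs) ?mul0r //.
by rewrite (dlNr FQ) rs oppr0.
Qed.

End DarbouxPair.

(** * Taylor expansion along a conjugate pair *)

Section ConjugatePair.
Variables (k : fieldType) (p : nat) (R : algType (fps k)) (G : nat -> set R).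
Hypothesis FQ : filtered_quantization G.
Hypotheses (chark : p \in [pchar k]).
Variables (g h : R).
Hypotheses (hg : dl h g = 1) (hp : h ^+ p \in @central R).
Implicit Types (a b r s : R) (l m n : nat).

Let p_pr : prime p := pcharf_prime chark.
Let p0 : (0 < p)%N := prime_gt0 p_pr.

Definition tcoef l : fps k := fpsC ((l`!)%:R^-1).

(* When h^p is central, this is the projection onto the kernel of dl h along
   the right multiples of g. *)
Definition cproj r : R := \sum_(l < p) ((-1) ^+ l * tcoef l) *: (g ^+ l * iter l (dl h) r).

(** The l-th Taylor coefficient of [r] in powers of [g], a constant for the derivation [dl h]. *)
Definition ccoef l r : R := tcoef l *: cproj (iter l (dl h) r).

Lemma fact_neq0 l : (l < p)%N -> (l`!%:R : k) != 0.
Proof.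
move=> lp; rewrite -(dvdn_pcharf chark); elim: l lp => [|l IHl] lp.
  by rewrite dvdn1; case: eqP p_pr => // ->.
rewrite factS Euclid_dvdM // negb_or (IHl (ltnW lp)) andbT.
by apply/negP => /dvdn_leq -/(_ isT); rewrite leqNgt lp.
Qed.

Lemma tcoef0 : tcoef 0 = 1.
Proof. by rewrite /tcoef fact0 invr1 rmorph1. Qed.

Lemma tcoefS l : (l.+1 < p)%N -> tcoef l.+1 * l.+1%:R = tcoef l.
Proof.
move=> lp; rewrite /tcoef -(rmorph_nat (@fpsC k)) -rmorphM factS natrM.
by rewrite invfM mulrAC mulVf ?mul1r // (pnatr_neq0 chark).
Qed.

Lemma tcoef_fact l : (l < p)%N -> tcoef l * (l`!)%:R = 1.
Proof.
by move=> lp; rewrite /tcoef -(rmorph_nat (@fpsC k)) -rmorphM mulVf ?fact_neq0 ?rmorph1.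
Qed.

(** As h^p is central, 0 is a restricted power of h. *)
Lemma iter_p r : iter p (dl h) r = 0.
Proof.
rewrite (@ppow_iter _ _ _ FQ _ chark h 0) ?(dlC FQ 0) ?(dl0r FQ) ?oppr0 //.
by rewrite /ppow scaler0 subr0.
Qed.

Lemma dl_hX l : dl h (g ^+ l) = g ^+ l.-1 *+ l.
Proof.
elim: l => [|l IHl]; first by rewrite (dl1r FQ) mulr0n.
rewrite exprS (dlMr FQ) hg mul1r IHl; case: l {IHl} => [|l]; first by rewrite mulr0n mulr0 addr0.
by rewrite mulrnAr -exprS /= -mulrS.
Qed.

Lemma dl_gX_comm b l : dl b g = 0 -> dl b (g ^+ l) = 0.
Proof.
move=> e; elim: l => [|l IHl]; first by rewrite (dl1r FQ).
by rewrite exprS (dlMr FQ) e IHl mul0r mulr0 addr0.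
Qed.

Lemma cprojD a b : cproj (a + b) = cproj a + cproj b.
Proof.
rewrite /cproj -big_split /=; apply: eq_bigr => l _.
by rewrite (iter_dlD FQ) mulrDr scalerDr.
Qed.

Lemma cprojZ (c : fps k) a : cproj (c *: a) = c *: cproj a.
Proof.
rewrite /cproj scaler_sumr; apply: eq_bigr => l _.
by rewrite (iter_dlZ FQ) -scalerAr !scalerA mulrC.
Qed.

Lemma ccoefD l a b : ccoef l (a + b) = ccoef l a + ccoef l b.
Proof. by rewrite /ccoef (iter_dlD FQ) cprojD scalerDr. Qed.

Lemma cproj0 : cproj 0 = 0.
Proof. by rewrite -(scale0r (0 : R)) cprojZ !scale0r. Qed.

Lemma ccoef0 l : ccoef l 0 = 0.
Proof. by rewrite /ccoef (iter_dl0 FQ) cproj0 scaler0. Qed.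

Lemma cproj_sum (I : Type) (r : seq I) (F : I -> R) :
  cproj (\sum_(i <- r) F i) = \sum_(i <- r) cproj (F i).
Proof. by apply: (big_morph cproj cprojD cproj0). Qed.

Lemma ccoef_sum l (I : Type) (r : seq I) (F : I -> R) :
  ccoef l (\sum_(i <- r) F i) = \sum_(i <- r) ccoef l (F i).
Proof. by apply: (big_morph _ (ccoefD l) (ccoef0 l)). Qed.

(** Differentiating g^l cancels the contribution of the previous term, so the sum telescopes to a
    term containing (dl h)^p r = 0. *)
Lemma dl_cproj r : dl h (cproj r) = 0.
Proof.
pose T l : R := ((-1) ^+ l * tcoef l) *: (g ^+ l * iter l.+1 (dl h) r).
have -> : dl h (cproj r) = \sum_(l < p) (T l - (if l : nat is l'.+1 then T l' else 0)).
  rewrite /cproj (dl_sum FQ); apply: eq_bigr => -[l lp] _ /=.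
  rewrite (dlZr FQ) (dlMr FQ) dl_hX scalerDr addrC; congr (_ + _).
  case: l lp => [|l] lp; first by rewrite mulr0n mul0r scaler0 oppr0.
  rewrite /T -(tcoefS lp) -scaleNr -mulNr exprS mulN1r mulrA mulr_natr -!scaler_nat.
  by rewrite -scalerAl scalerA mulr_natr.
rewrite -(big_mkord xpredT (fun l => T l - (if l is l'.+1 then T l' else 0))).
have : forall n, (0 < n)%N ->
    \sum_(0 <= l < n) (T l - (if l is l'.+1 then T l' else 0)) = T n.-1.
  elim=> // n IHn _; rewrite big_nat_recr //=; case: n IHn => [|n] IHn.
    by rewrite big_nil add0r subr0.
  by rewrite IHn //= addrC subrK.
by move=> /(_ p p0) ->; rewrite /T prednK // iter_p mulr0 scaler0.
Qed.

Lemma dl_ccoef l r : dl h (ccoef l r) = 0.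
Proof. by rewrite /ccoef (dlZr FQ) dl_cproj scaler0. Qed.

Lemma cproj_ker s : dl h s = 0 -> cproj s = s.
Proof.
move=> hs; rewrite /cproj -(prednK p0) big_ord_recl /= expr0 tcoef0 !mul1r scale1r.
rewrite big1 ?addr0 // => l _; rewrite -iterS iterSr hs.
by rewrite (iter_dl0 FQ) mulr0 scaler0.
Qed.

Lemma cprojMr r s : dl h s = 0 -> cproj (r * s) = cproj r * s.
Proof.
move=> hs; rewrite /cproj mulr_suml; apply: eq_bigr => l _.
by rewrite (iter_dlMr FQ) // mulrA scalerAl.
Qed.

Lemma iter_dl_hX l m : iter l (dl h) (g ^+ m) = g ^+ (m - l) *+ (m ^_ l).
Proof.
elim: l => [|l IHl]; first by rewrite subn0.
rewrite iterS IHl; have -> : dl h (g ^+ (m - l) *+ m ^_ l) = dl h (g ^+ (m - l)) *+ m ^_ l.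
  by elim: (m ^_ l) => [|j IHj]; rewrite ?mulr0n ?(dl0r FQ) // !mulrS (dlDr FQ) IHj.
by rewrite dl_hX -mulrnA mulnC ffactnSr subnS.
Qed.

(** The coefficients add up to the alternating binomial sum (1 - 1)^m. *)
Lemma cproj_exp m : (m < p)%N -> cproj (g ^+ m) = (m == 0)%N%:R.
Proof.
move=> mp; rewrite /cproj.
rewrite (eq_bigr (fun l : 'I_p => ((-1) ^+ l *+ 'C(m, l) : fps k) *: g ^+ m)); last first.
  move=> [l lp] _ /=; rewrite iter_dl_hX; case: (leqP l m) => [lm|ml]; last first.
    by rewrite ffact_small // bin_small // !mulr0n mulr0 scaler0 scale0r.
  rewrite mulrnAr -exprD subnKC // -scaler_nat scalerA -mulrA -bin_ffact natrM.
  by rewrite [tcoef l * _]mulrC -mulrA [_%:R * tcoef l]mulrC tcoef_fact // mulr1 mulr_natr.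
rewrite -scaler_suml.
have -> : \sum_(l < p) (-1) ^+ l *+ 'C(m, l) = (1 - 1) ^+ m :> fps k.
  rewrite exprDn (big_ord_widen_cond _ xpredT (fun l => (1 ^+ (m - l) * (-1) ^+ l) *+ 'C(m, l)) mp).
  rewrite [LHS](bigID (fun l : 'I_p => (l < m.+1)%N)) /= [X in _ + X]big1 ?addr0 => [|l].
    by apply: eq_bigr => l _; rewrite expr1n mul1r.
  by rewrite -leqNgt => /bin_small->.
by rewrite subrr expr0n; case: m {mp} => [|m]; rewrite ?scale1r ?expr0 ?scale0r.
Qed.

Lemma cprojS_exp_pred s : dl h s = 0 -> cproj (g ^+ p * s) = g ^+ p * s.
Proof.
move=> hs; apply: cproj_ker; rewrite (dlMr FQ) hs mulr0 addr0 dl_hX.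
by rewrite -mulr_natr (pcharf0 (pchar_fps_alg R chark)) mulr0 mul0r.
Qed.

Lemma ccoef_exp l m s : (l < p)%N -> (m < p)%N -> dl h s = 0 ->
  ccoef l (g ^+ m * s) = if l == m then s else 0.
Proof.
move=> lp mp hs; rewrite /ccoef (iter_dlMr FQ) // cprojMr // iter_dl_hX.
have -> : cproj (g ^+ (m - l) *+ m ^_ l) = cproj (g ^+ (m - l)) *+ m ^_ l.
  by elim: (m ^_ l) => [|j IHj]; rewrite ?mulr0n ?cproj0 // !mulrS cprojD IHj.
rewrite cproj_exp; last by rewrite (leq_ltn_trans (leq_subr _ _)).
case: (ltngtP l m) => [lm|ml|->].
- by rewrite subn_eq0 leqNgt lm mul0rn mul0r scaler0.
- by rewrite ffact_small // mulr0n mul0r scaler0.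
by rewrite subnn eqxx ffactnn mulr_natl -scaler_nat scalerA tcoef_fact // scale1r.
Qed.

(** Induction on the number of derivations that kill the element: subtracting g^n (dl h)^n a / n!
    lowers it by one, and p derivations kill everything. *)
Lemma taylor r : r = \sum_(l < p) g ^+ l * ccoef l r.
Proof.
suff: forall n, (n <= p)%N -> forall a, iter n (dl h) a = 0 ->
    a = \sum_(l < p) g ^+ l * ccoef l a.
  by move=> /(_ p (leqnn p) r); apply; apply: iter_p.
elim=> [|n IHn] np a.
  by move=> /= ->; rewrite big1 // => l _; rewrite ccoef0 mulr0.
move=> an; pose s := tcoef n *: iter n (dl h) a.
have hs : dl h s = 0 by rewrite (dlZr FQ) -iterS an scaler0.
have e : iter n (dl h) (a - g ^+ n * s) = 0.
  rewrite -scaleN1r (iter_dlD FQ) (iter_dlZ FQ) scaleN1r (iter_dlMr FQ) // iter_dl_hX.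
  rewrite subnn ffactnn /s -scalerAr mulr_natl -scaler_nat scalerA tcoef_fact //.
  by rewrite scale1r subrr.
pose F b : R := \sum_(l < p) g ^+ l * ccoef l b.
have FD b c : F (b + c) = F b + F c.
  by rewrite /F -big_split; apply: eq_bigr => l _; rewrite ccoefD mulrDr.
have Fg : F (g ^+ n * s) = g ^+ n * s.
  rewrite /F (bigD1 (Ordinal np)) //= ccoef_exp // eqxx big1 ?addr0 // => l ln.
  rewrite ccoef_exp //; case: eqP => [e'|_]; last by rewrite mulr0.
  by case/eqP: ln; apply: val_inj.
have e1 : a - g ^+ n * s = F (a - g ^+ n * s) := IHn (ltnW np) _ e.
by rewrite -[RHS]/(F a) -{2}[a](subrK (g ^+ n * s)) FD Fg -e1 subrK.
Qed.

(** By the Jacobi identity, [dl b] commutes with [dl h] as soon as [dl b h] is central. *)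
Lemma cproj_comm b r : dl b g = 0 -> dl b h \in @central R ->
  dl b (cproj r) = cproj (dl b r).
Proof.
move=> bg bh; have bD n : dl b (iter n (dl h) r) = iter n (dl h) (dl b r).
  by elim: n => //= n IHn; rewrite (dl_jacobi FQ) IHn (dl_central_l FQ) // add0r.
rewrite /cproj (dl_sum FQ); apply: eq_bigr => l _.
by rewrite (dlZr FQ) (dlMr FQ) (dl_gX_comm _ bg) mul0r add0r bD.
Qed.

Lemma ccoef_comm b l r : dl b g = 0 -> dl b h \in @central R ->
  dl b r = 0 -> dl b (ccoef l r) = 0.
Proof.
move=> bg bh br; rewrite /ccoef (dlZr FQ) cproj_comm //.
have -> : dl b (iter l (dl h) r) = 0.
  elim: l => //= n IHn; rewrite (dl_jacobi FQ) IHn (dl_central_l FQ) // add0r.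
  exact: (dl0r FQ).
by rewrite cproj0 scaler0.
Qed.

Lemma cproj_filt n r : G 1%N g -> G 1%N h -> G n r -> G n (cproj r).
Proof.
move=> Gg Gh Gr; apply: (filt_sum FQ) => l _; apply: (filtZ FQ).
apply: (filtW FQ _ (filtM FQ (filtX FQ l Gg) (iter_dl_filt FQ l Gh Gr))).
by rewrite muln1 addnC; lia.
Qed.

Lemma cproj_near r : G 1%N g -> G 1%N h -> G 1%N (dl h r) -> G 2%N (cproj r - r).
Proof.
move=> Gg Gh Gr; rewrite /cproj -(prednK p0) big_ord_recl /= expr0 tcoef0 !mul1r scale1r.
rewrite addrC addKr; apply: (filt_sum FQ) => l _; apply: (filtZ FQ).
rewrite /bump /= add1n; case: (nat_of_ord l) => [|m].
  by rewrite expr1; apply: (filtM FQ Gg).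
apply/(filtMr FQ)/(filtW FQ _ (filtX FQ m.+2 Gg)); lia.
Qed.

Lemma cproj_sub_mul r : exists2 r', r = cproj r + g * r' &
  forall b, dl b g = 0 -> dl b h \in @central R -> dl b r = 0 -> dl b r' = 0.
Proof.
exists (\sum_(l < p.-1) g ^+ l * ccoef l.+1 r).
  have : r = \sum_(l < p.-1.+1) g ^+ l * ccoef l r by rewrite prednK // -taylor.
  rewrite big_ord_recl expr0 mul1r /ccoef /= tcoef0 scale1r {1}mulr_sumr => {1}->.
  by congr (_ + _); apply: eq_bigr => l _; rewrite /bump /= add1n mulrA -exprS.
move=> b bg bh br; rewrite (dl_sum FQ) big1 // => l _.
by rewrite (dlMr FQ) ccoef_comm // (dl_gX_comm _ bg) mul0r mulr0 addr0.
Qed.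

(** Multiplication by g shifts the Taylor expansion. The projection kills the positive powers of g
    below p, but g^p is itself a constant and survives. *)
Lemma cproj_mul_g r : cproj (g * r) = g ^+ p * ccoef p.-1 r.
Proof.
rewrite {1}[r]taylor mulr_sumr cproj_sum.
have lp : (p.-1 < p)%N by rewrite prednK.
rewrite (bigD1 (Ordinal lp)) //= mulrA -exprS prednK // cprojS_exp_pred ?dl_ccoef //.
rewrite big1 ?addr0 // => -[l /= lp'] lne.
rewrite mulrA -exprS cprojMr ?dl_ccoef // cproj_exp ?mul0r //.
have : (l != p.-1) by apply: contra lne => /eqP e; apply/eqP/val_inj.
by move=> /eqP; lia.
Qed.

End ConjugatePair.

(** * Systems of conjugate pairs and their commutants *)

Section DarbouxSystem.
Variables (k : fieldType) (p : nat) (R : algType (fps k)) (G : nat -> set R).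
Hypothesis CQ : complete_quantization p G.
Hypotheses (chark : p \in [pchar k]) (p_gt2 : (2 < p)%N).
Hypothesis G1_proper : ~ G 1%N 1.
Implicit Types (a b c r x y z : R) (d e q : R * R) (ds hs s : seq (R * R)).

Let FQ := cq_filtered CQ.
Let p_pr : prime p := pcharf_prime chark.

(** In a pair [d], [d.1] is the coordinate and the bracket with [d.2] differentiates along it; this
    is the ring of constants of all these derivations. *)
Definition hker hs : set R := [set r | forall d, d \in hs -> dl d.2 r = 0].

Definition conj_pair d : Prop :=
  [/\ G 1%N d.1, G 1%N d.2, dl d.2 d.1 = 1, d.2 ^+ p \in @central R & d.1 ^+ p \in @central R].

(** Only centrality is asked of [dl e.2 d.2]: for the two conjugate pairs that come from one Darboux
    pair it is a nonzero constant. *)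
Definition conj_compat e d : Prop :=
  [/\ dl e.2 d.1 = 0, dl d.2 e.1 = 0 & dl e.2 d.2 \in @central R].

Fixpoint conj_sys ds : Prop :=
  if ds is d :: ds' then
    [/\ conj_pair d, forall e, e \in ds' -> conj_compat d e & conj_sys ds']
  else True.

Lemma hker_cons d hs r : hker (d :: hs) r <-> dl d.2 r = 0 /\ hker hs r.
Proof.
split=> [h|[h1 h2] e]; last by rewrite inE => /predU1P[->|/h2].
by split=> [|e he]; apply: h; [rewrite inE eqxx | rewrite inE he orbT].
Qed.

Lemma hker_subalg hs : [/\ hker hs 1, (forall a b, hker hs a -> hker hs b -> hker hs (a - b)),
  (forall a b, hker hs a -> hker hs b -> hker hs (a * b)) &
  (forall (t : fps k) a, hker hs a -> hker hs (t *: a))].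
Proof.
split=> [d _|a b ha hb d dh|a b ha hb d dh|t a ha d dh]; first exact: (dl1r FQ).
- by rewrite (dlBr FQ) ha ?hb ?subrr.
- by rewrite (dlMr FQ) ha ?hb // mul0r mulr0 addr0.
by rewrite (dlZr FQ) ha ?scaler0.
Qed.

Lemma hkerB hs a b : hker hs a -> hker hs b -> hker hs (a - b).
Proof. by case: (hker_subalg hs) => _ + _ _; apply. Qed.

Lemma hkerM hs a b : hker hs a -> hker hs b -> hker hs (a * b).
Proof. by case: (hker_subalg hs) => _ _ + _; apply. Qed.

Lemma hkerZ hs t a : hker hs a -> hker hs (t *: a).
Proof. by case: (hker_subalg hs) => _ _ _; apply. Qed.

Lemma hker0 hs : hker hs 0.
Proof. by move=> d _; apply: (dl0r FQ). Qed.

Lemma hkerD hs a b : hker hs a -> hker hs b -> hker hs (a + b).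
Proof. by move=> ha hb d dh; rewrite (dlDr FQ) ha ?hb ?addr0. Qed.

Lemma hker_sum (I : Type) (l : seq I) (F : I -> R) hs :
  (forall i, hker hs (F i)) -> hker hs (\sum_(i <- l) F i).
Proof. by move=> h; apply: big_ind => //; [apply: hker0 | move=> *; apply: hkerD]. Qed.

Lemma hker_dl hs a b : hker hs a -> hker hs b -> hker hs (dl a b).
Proof. by move=> ha hb d dh; apply: (dl_comm_dl CQ); [apply: ha|apply: hb]. Qed.

Lemma hker_hbar hs a : hker hs (hbar *: a) -> hker hs a.
Proof. by move=> h d dh; apply: (filt_tf FQ); rewrite -(dlZr FQ) h. Qed.

Lemma hker_exp hs a n : hker hs a -> hker hs (a ^+ n).
Proof.
move=> ha; elim: n => [|n IHn]; first by case: (hker_subalg hs).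
by rewrite exprS; apply: hkerM.
Qed.

Lemma hker_iter hs d a n : (forall e, e \in hs -> conj_compat e d) ->
  hker hs a -> hker hs (iter n (dl d.2) a).
Proof.
move=> comp ha; elim: n => //= n IHn e he; have [_ _ c] := comp e he.
by rewrite (dl_jacobi FQ) IHn // (dl_central_l FQ) // (dl0r FQ) addr0.
Qed.

Lemma hker_g hs d : (forall e, e \in hs -> conj_compat e d) -> hker hs d.1.
Proof. by move=> comp e /comp[]. Qed.

Lemma hker_cproj hs d a : (forall e, e \in hs -> conj_compat e d) ->
  hker hs a -> hker hs (cproj p d.1 d.2 a).
Proof.
move=> comp ha; apply: hker_sum => l; apply/hkerZ/hkerM; last exact: hker_iter.
exact/hker_exp/hker_g.
Qed.

Lemma hker_cproj_cons hs d a : conj_pair d -> (forall e, e \in hs -> conj_compat e d) ->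
  hker hs a -> hker (d :: hs) (cproj p d.1 d.2 a).
Proof.
move=> [_ _ hg hp _] comp ha; apply/hker_cons; split; last exact: hker_cproj.
exact: (dl_cproj FQ chark hg hp).
Qed.

Lemma hker_ccoef_cons hs d l a : conj_pair d -> (forall e, e \in hs -> conj_compat e d) ->
  hker hs a -> hker (d :: hs) (ccoef p d.1 d.2 l a).
Proof.
by move=> pd comp ha; apply/hkerZ/hker_cproj_cons => //; apply: hker_iter.
Qed.

Lemma conj_compat_cons d e hs ds :
    (forall e, e \in ds -> conj_compat d e) ->
    (forall f e, f \in hs -> e \in d :: ds -> conj_compat f e) ->
  forall f e, f \in d :: hs -> e \in ds -> conj_compat f e.
Proof.
move=> cd ch f e'; rewrite inE => /predU1P[->|fh] eds; first exact: cd.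
by apply: ch => //; rewrite inE eds orbT.
Qed.

(** Finite generation, modulo hbar, of the maximal ideal of the commutant; [residue_series] needs it
    to sum series inside a power of that ideal. *)
Definition fin_gen_ker hs : Prop := exists zs : seq R,
  (forall i, hker hs zs`_i /\ G 1%N zs`_i) /\
  forall m, hker hs m -> G 1%N m -> exists (c : nat -> R) r,
    [/\ forall i, hker hs (c i), hker hs r & m = \sum_(i < size zs) zs`_i * c i + hbar *: r].

(** The projection behaves like evaluation at g = 0. It fails to be multiplicative in two ways:
    moving [cproj z] past g^l costs a multiple of hbar, and the constant g^p is not killed. *)
Lemma cproj_mul hs d z c : conj_pair d -> (forall e, e \in hs -> conj_compat e d) ->
    hker hs z -> hker hs c ->
  exists u v, [/\ hker (d :: hs) u, hker (d :: hs) v & cproj p d.1 d.2 (z * c) =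
    cproj p d.1 d.2 z * cproj p d.1 d.2 c + d.1 ^+ p * u + hbar *: v].
Proof.
move=> pd comp hz hc; have [Gg Gh hg hp _] := pd.
set P := cproj p d.1 d.2.
have hPz := hker_cproj_cons pd comp hz; have [DPz KPz] := (hker_cons _ _ _).1 hPz.
have [z' ez hz'] := cproj_sub_mul FQ chark hg hp z.
have Kz' : hker hs z'.
  by move=> e he; have [c1 _ c2] := comp e he; apply: hz' => //; apply: hz.
pose v : R := \sum_(l < p) ((-1) ^+ l * tcoef k l) *: (dl (d.1 ^+ l) (P z) * iter l (dl d.2) c).
have ev : P (P z * c) = P z * P c + hbar *: v.
  rewrite /v scaler_sumr {2}/P /cproj mulr_sumr -big_split; apply: eq_bigr => l _ /=.
  move: ((-1) ^+ l * tcoef k l) => t.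
  rewrite (iter_dlMl FQ) // -scalerAr scalerA [hbar * _]mulrC -scalerA -scalerDr.
  by rewrite [hbar *: _]scalerAl -(dlE FQ) /commutator mulrBl !mulrA addrC subrK.
have Kv : hker hs v.
  apply: hker_sum => l; apply/hkerZ/hkerM; last exact: hker_iter.
  by apply: hker_dl => //; apply/hker_exp/hker_g.
exists (ccoef p d.1 d.2 p.-1 (z' * c)), v; split.
- by apply: hker_ccoef_cons => //; apply: hkerM.
- apply: hker_hbar; have -> : hbar *: v = P (P z * c) - P z * P c.
    by rewrite ev addrC addKr.
  apply: hkerB; first by apply: hker_cproj_cons => //; apply: hkerM.
  by apply: hkerM => //; apply: hker_cproj_cons.
rewrite {1}ez mulrDl /P (cprojD p FQ) -mulrA (cproj_mul_g FQ chark hg hp) -/P ev.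
by rewrite addrAC.
Qed.

(** The projections of the old generators suffice once g^p, which appears in [cproj_mul], is added
    to them. *)
Lemma fin_gen_ker_cons hs d : conj_pair d -> (forall e, e \in hs -> conj_compat e d) ->
  fin_gen_ker hs -> fin_gen_ker (d :: hs).
Proof.
move=> pd comp [zs [hzs gen]]; have [Gg Gh hg hp gp] := pd.
pose P := cproj p d.1 d.2; exists (d.1 ^+ p :: map P zs).
have P0 : P 0 = 0 by apply: (cproj0 p FQ).
split=> [[|i] /=|m /hker_cons[Dm Km] Gm].
- split; first by move=> e he; apply: (dl_central FQ).
  by apply: (filtW FQ _ (filtX FQ p Gg)); rewrite muln1 prime_gt0.
- have [Kz Gz] := hzs i; have -> : (map P zs)`_i = P zs`_i.
    case: (ltnP i (size zs)) => lt_i; first by rewrite (nth_map 0).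
    by rewrite !nth_default ?size_map // P0.
  by split; [apply: hker_cproj_cons | apply: (cproj_filt FQ chark hp)].
have [c [r [Kc Kr em]]] := gen m Km Gm.
have /choice[uv huv] (i : nat) : exists uv : R * R, [/\ hker (d :: hs) uv.1,
    hker (d :: hs) uv.2 & P (zs`_i * c i) = P zs`_i * P (c i) + d.1 ^+ p * uv.1 + hbar *: uv.2].
  by have [u [v h]] := cproj_mul pd comp (hzs i).1 (Kc i); exists (u, v).
exists (fun i => if i is i'.+1 then P (c i') else \sum_(i < size zs) (uv i).1).
exists (\sum_(i < size zs) (uv i).2 + P r); split.
- by case=> [|i]; [apply: hker_sum => i; case: (huv i) | apply: hker_cproj_cons].
- apply: hkerD; last exact: hker_cproj_cons.
  by apply: hker_sum => i; case: (huv i).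
rewrite -[LHS](cproj_ker FQ chark d.1 Dm) -/P em /P (cprojD p FQ) (cprojZ p FQ) (cproj_sum p FQ) -/P.
rewrite /= size_map big_ord_recl /= scalerDr addrA; congr (_ + _).
rewrite (eq_bigr (fun i : 'I_(size zs) =>
  P zs`_i * P (c i) + d.1 ^+ p * (uv i).1 + hbar *: (uv i).2)); last first.
  by move=> i _; case: (huv i).
rewrite !big_split /= -mulr_sumr -scaler_sumr; congr (_ + _); rewrite addrC; congr (_ + _).
by apply: eq_bigr => i _; rewrite add0n (nth_map 0).
Qed.

(** The form [catrev] reflects the induction, in which the pairs of [ds] move one at a time to the
    front of [hs]. *)
Lemma fin_gen_ker_sys ds hs : conj_sys ds ->
    (forall e d, e \in hs -> d \in ds -> conj_compat e d) ->
  fin_gen_ker hs -> fin_gen_ker (catrev ds hs).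
Proof.
elim: ds hs => [|d ds IHds] hs //= [pd cd sys] comp fg.
apply: IHds => //; first exact: conj_compat_cons comp.
by apply: fin_gen_ker_cons => // e he; apply: comp; rewrite ?inE ?eqxx.
Qed.

(** Each projection changes r in weight 2 only: the first correction is g times a derivative of
    weight 1, the others contain g^2. Such a change is not seen by the form [om]. *)
Lemma hker_approx ds hs r : conj_sys ds ->
    (forall e d, e \in hs -> d \in ds -> conj_compat e d) ->
    hker hs r -> G 1%N r -> (forall d, d \in ds -> G 1%N (dl d.2 r)) ->
  exists2 r', hker (catrev ds hs) r' & G 2%N (r' - r).
Proof.
elim: ds hs r => [|d ds IHds] hs r /=.
  by move=> _ _ hr _ _; exists r => //; rewrite subrr; apply: (filt0 FQ).
move=> [pd cd sys] comp hr Gr Gd; have [Gg Gh hg hp _] := pd.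
have cd' e : e \in hs -> conj_compat e d by move=> he; apply: comp; rewrite ?inE ?eqxx.
have near : G 2%N (cproj p d.1 d.2 r - r).
  by apply: (cproj_near FQ chark hp) => //; apply: Gd; rewrite inE eqxx.
have [||||r' hr' Gr'] := IHds (d :: hs) (cproj p d.1 d.2 r) sys.
- exact: conj_compat_cons comp.
- exact: hker_cproj_cons.
- exact: (cproj_filt FQ chark hp).
- move=> e he; rewrite -[cproj _ _ _ _](subrK r) (dlDr FQ).
  apply: (filtD FQ); last by apply: Gd; rewrite inE he orbT.
  have : G 1%N e.2; last by move=> Ge; exact: (dl_filt1 FQ Ge near).
  elim: ds sys he {IHds cd comp Gd pd} => // f ds IH /= [[_ Gf _ _ _] _ sys].
  by rewrite inE => /predU1P[->|/(IH sys)].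
exists r' => //; rewrite -[r'](subrK (cproj p d.1 d.2 r)) -addrA.
exact: (filtD FQ).
Qed.

Lemma conj_sys_mem ds d : conj_sys ds -> d \in ds -> conj_pair d.
Proof.
by elim: ds => // f ds IH /= [pf _ /IH{}IH]; rewrite inE => /predU1P[->|].
Qed.

Lemma conj_sys_dual ds i j : conj_sys ds -> (i < size ds)%N -> (j < size ds)%N ->
  dl (nth (0, 0) ds i).2 (nth (0, 0) ds j).1 = (i == j)%:R.
Proof.
elim: ds i j => // d ds IH [|i] [|j] /= [[_ _ hg _ _] cd sys] li lj //.
- by have [] := cd _ (mem_nth (0, 0) lj).
- by have [] := cd _ (mem_nth (0, 0) li).
by rewrite IH.
Qed.

Lemma scalar_filt1 (s : k) : G 1%N (fpsC s *: 1) -> s = 0.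
Proof.
move=> Gs; apply/eqP/negPn/negP => s0; apply: G1_proper.
by rewrite -(scale1r 1) -(rmorph1 (@fpsC k)) -(mulVf s0) rmorphM -scalerA; apply: (filtZ FQ).
Qed.

(* The value at the closed point of the Poisson bracket of a and b. *)
Definition om a b : k := xget 0 [set s | G 1%N (dl a b - fpsC s *: 1)].

Lemma omP a b : G 1%N (dl a b - fpsC (om a b) *: 1).
Proof.
have [s Gs] := cq_residue CQ (dl a b); rewrite /om.
by case: xgetP => [t _ //|/(_ s)].
Qed.

Lemma om_eq a b (s : k) : G 1%N (dl a b - fpsC s *: 1) -> om a b = s.
Proof.
move=> Gs; apply/eqP; rewrite -subr_eq0; apply/eqP/scalar_filt1.
have := filtB FQ Gs (omP a b); rewrite opprB addrC subrKA.
by rewrite -scalerBl -rmorphB.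
Qed.

Lemma om_dl_eq a b (s : k) : dl a b = fpsC s *: 1 -> om a b = s.
Proof. by move=> e; apply: om_eq; rewrite e subrr; apply: (filt0 FQ). Qed.

Lemma om_eq0 a b : om a b = 0 <-> G 1%N (dl a b).
Proof.
split=> [e|Gab]; first by have := omP a b; rewrite e rmorph0 scale0r subr0.
by apply: om_eq; rewrite rmorph0 scale0r subr0.
Qed.

Lemma omC a b : om a b = - om b a.
Proof.
apply: om_eq; rewrite rmorphN scaleNr opprK (dlC FQ) addrC -opprB.
exact/(filtN FQ)/omP.
Qed.

Lemma omDr a b c : om a (b + c) = om a b + om a c.
Proof.
apply: om_eq; rewrite rmorphD scalerDl opprD (dlDr FQ) addrACA.
by apply: (filtD FQ); apply: omP.
Qed.

Lemma omZr (s : k) a b : om a (fpsC s *: b) = s * om a b.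
Proof.
apply: om_eq; rewrite rmorphM -scalerA (dlZr FQ) -scalerBr.
exact/(filtZ FQ)/omP.
Qed.

Lemma omDl a b c : om (a + b) c = om a c + om b c.
Proof. by rewrite omC omDr opprD -!omC. Qed.

Lemma omZl (s : k) a b : om (fpsC s *: a) b = s * om a b.
Proof. by rewrite omC omZr -mulrN -omC. Qed.

Lemma omNr a b : om a (- b) = - om a b.
Proof. by rewrite -scaleN1r -(rmorphN1 (@fpsC k)) omZr mulN1r. Qed.

Lemma omNl a b : om (- a) b = - om a b.
Proof. by rewrite omC omNr -omC. Qed.

Lemma om0r a : om a 0 = 0.
Proof. by apply: om_dl_eq; rewrite (dl0r FQ) rmorph0 scale0r. Qed.

Lemma om_sumr (I : Type) (l : seq I) (F : I -> R) a :
  om a (\sum_(i <- l) F i) = \sum_(i <- l) om a (F i).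
Proof. by apply: (big_morph (om a)); [move=> *; rewrite omDr | rewrite om0r]. Qed.

Lemma om_suml (I : Type) (l : seq I) (F : I -> R) a :
  om (\sum_(i <- l) F i) a = \sum_(i <- l) om (F i) a.
Proof. by rewrite omC om_sumr -sumrN; apply: eq_bigr => i _; rewrite -omC. Qed.

Lemma om_filt2 a b : G 2%N a -> G 1%N b -> om a b = 0.
Proof. by move=> Ga Gb; apply/om_eq0; exact: (dl_filt FQ Ga Gb). Qed.

(** The rank of the Poisson bracket at the closed point; the last clause says that the [e i] span
    modulo the radical of the form. *)
Definition symplectic_rank N : Prop := exists e : 'I_N -> R,
  [/\ forall i, G 1%N (e i), \matrix_(i, j) om (e i) (e j) \in unitmx &
      forall a, G 1%N a -> exists c : 'I_N -> k, forall b, G 1%N b ->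
        om (a - \sum_i fpsC (c i) *: e i) b = 0].

(** The identity matrix of size [size ds] factors through k^N. *)
Lemma dual_size N ds : symplectic_rank N ->
    (forall d, d \in ds -> G 1%N d.1 /\ G 1%N d.2) ->
    (forall i j, (i < size ds)%N -> (j < size ds)%N ->
      om (nth (0, 0) ds i).2 (nth (0, 0) ds j).1 = (i == j)%:R) ->
  (size ds <= N)%N.
Proof.
move=> [e [Ge _ span]] Gd dual; set r := size ds.
have Gn (i : 'I_r) : G 1%N (nth (0, 0) ds i).1 /\ G 1%N (nth (0, 0) ds i).2.
  by apply/Gd/mem_nth.
have /choice[cg hcg] (i : 'I_r) := span _ (Gn i).1.
have /choice[ch hch] (i : 'I_r) := span _ (Gn i).2.
pose H := \matrix_(i < r, l < N) ch i l.
pose B := \matrix_(l < N, j < r) om (e l) (nth (0, 0) ds j).1.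
have e1 : H *m B = 1%:M.
  apply/matrixP => i j; rewrite !mxE.
  transitivity (om (nth (0, 0) ds i).2 (nth (0, 0) ds j).1); last first.
    by rewrite dual // -(inj_eq val_inj).
  have := hch i _ (Gn j).1; rewrite omDl omNl om_suml => /eqP; rewrite subr_eq0 => /eqP->.
  by apply: eq_bigr => l _; rewrite !mxE omZl.
rewrite -(mxrank1 k r) -e1 (leq_trans (mxrankM_maxl _ _)) // rank_leq_col //.
Qed.

(** Gram-Schmidt: subtracting combinations of the coordinates makes the [e l] orthogonal to all
    derivations, hence also to the coordinates, which are derivations up to sign. If all brackets of
    the results vanished at the point, the invertible Gram matrix would factor through a space of
    dimension [size ds], less than N. *)
Lemma orthogonal_pair N ds : symplectic_rank N -> conj_sys ds ->
    (forall d, d \in ds -> exists2 d', d' \in ds & d.1 = d'.2 \/ d.1 = - d'.2) ->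
    (size ds < N)%N ->
  exists a b, [/\ G 1%N a, G 1%N b, om a b = 1 &
    forall d, d \in ds -> om d.2 a = 0 /\ om d.2 b = 0].
Proof.
move=> [e [Ge eU _]] sys sym lt_r; set r := size ds in lt_r.
pose g (i : 'I_r) := (nth (0, 0) ds i).1; pose h (i : 'I_r) := (nth (0, 0) ds i).2.
have hgd i j : om (h i) (g j) = (i == j)%:R.
  by apply: om_dl_eq; rewrite conj_sys_dual // rmorph_nat scaler_nat -(inj_eq val_inj).
pose e' l := e l - \sum_i fpsC (om (h i) (e l)) *: g i.
have Gg i : G 1%N (g i) by have [] := conj_sys_mem sys (mem_nth (0, 0) (ltn_ord i)).
have Ge' l : G 1%N (e' l).
  by apply: (filtB FQ) => //; apply: (filt_sum FQ) => i _; apply: (filtZ FQ).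
have orth l i : om (h i) (e' l) = 0.
  rewrite omDr omNr om_sumr (bigD1 i) //= omZr hgd eqxx mulr1 big1 ?addr0 ?subrr //.
  by move=> j ji; rewrite omZr hgd eq_sym (negPf ji) mulr0.
have orthd l d : d \in ds -> om d.2 (e' l) = 0.
  move=> dd; have lt_i : (index d ds < r)%N by rewrite index_mem.
  by have := orth l (Ordinal lt_i); rewrite /h /= nth_index.
have orthg l i : om (e' l) (g i) = 0.
  have [d' d'd []] := sym _ (mem_nth (0, 0) (ltn_ord i)); rewrite -/(g i) => ->.
    by rewrite omC orthd // oppr0.
  by rewrite omC omNl orthd // !oppr0.
have [[l [m nz]]|none] := pselect (exists l m, om (e' l) (e' m) <> 0).
  exists (e' l), (fpsC (om (e' l) (e' m))^-1 *: e' m); split=> //.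
  - exact: (filtZ FQ).
  - by rewrite omZr mulVf //; apply/eqP.
  by move=> d dd; rewrite omZr !orthd // mulr0.
exfalso; have z l m : om (e' l) (e' m) = 0.
  by apply/eqP/negPn/negP => /eqP nz; apply: none; exists l, m.
pose A := \matrix_(l < N, i < r) om (h i) (e l).
pose B := \matrix_(i < r, m < N) om (g i) (e m).
have eAB : \matrix_(i, j) om (e i) (e j) = A *m B.
  apply/matrixP => l m; rewrite !mxE.
  have el j : e j = e' j + \sum_i fpsC (om (h i) (e j)) *: g i by rewrite subrK.
  rewrite {1}(el l) omDl [X in om (e' l) X](el m) omDr z add0r.
  rewrite om_sumr big1 ?add0r => [|i _]; last by rewrite omZr orthg mulr0.
  by rewrite om_suml; apply: eq_bigr => i _; rewrite !mxE omZl.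
have := mxrank_unit eU; rewrite eAB => e1.
have := mxrankM_maxl A B; rewrite e1 => le1.
by have := leq_ltn_trans (leq_trans le1 (rank_leq_col A)) lt_r; rewrite ltnn.
Qed.

Definition commuting_pairs (q q' : R * R) : Prop :=
  [/\ dl q'.1 q.1 = 0, dl q'.1 q.2 = 0, dl q'.2 q.1 = 0 & dl q'.2 q.2 = 0].

Fixpoint darboux_sys (s : seq (R * R)) : Prop :=
  if s is q :: s' then
    [/\ [/\ G 1%N q.1, G 1%N q.2, dl q.1 q.2 = 1, q.1 ^+ p \in @central R & q.2 ^+ p \in @central R],
        forall q', q' \in s' -> commuting_pairs q q' & darboux_sys s']
  else True.

(** A Darboux pair (x, y) yields the coordinate y with derivation x and the coordinate x with
    derivation -y; the sign makes both brackets equal to 1. *)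
Definition conj_of (s : seq (R * R)) : seq (R * R) :=
  flatten [seq [:: (q.2, q.1); (q.1, - q.2)] | q <- s].

Lemma mem_conj_of s d : d \in conj_of s ->
  exists2 q, q \in s & d = (q.2, q.1) \/ d = (q.1, - q.2).
Proof.
by case/flattenP => l /mapP[q qs ->]; rewrite !inE => /orP[]/eqP->; exists q; auto.
Qed.

Lemma conj_of_mem s q : q \in s -> (q.2, q.1) \in conj_of s /\ (q.1, - q.2) \in conj_of s.
Proof.
by move=> qs; split; apply/flattenP; exists [:: (q.2, q.1); (q.1, - q.2)];
  rewrite ?inE ?eqxx ?orbT //; apply/mapP; exists q.
Qed.

Lemma size_conj_of s : size (conj_of s) = (2 * size s)%N.
Proof. by elim: s => //= q s; rewrite /conj_of /= => ->; rewrite mulnS. Qed.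

Lemma conj_of_sys s : darboux_sys s -> conj_sys (conj_of s).
Proof.
elim: s => // q s IH /= [[G1 G2 e12 c1 c2] comm /IH{}IH].
have c2' : (- q.2) ^+ p \in @central R by rewrite -scaleN1r exprZn; apply: centralZ.
have z0 : 0 \in @central R := central0 _.
split=> //=.
  move=> d; rewrite inE => /predU1P[->|/mem_conj_of[q' /comm[h1 h2 h3 h4]]].
    split=> /=; rewrite ?(dlxx FQ) ?(dlNl FQ) ?(dlxx FQ) ?oppr0 //.
    by rewrite (dlNr FQ) e12 -scaleN1r; apply/centralZ/central1.
  by case=> -> ; split=> /=; rewrite ?(dlNl FQ) ?(dlNr FQ) ?(dlC FQ q.1) ?h1 ?h2 ?h3 ?h4 ?oppr0.
split=> //=.
  by split=> //=; [apply: (filtN FQ) | rewrite (dlNl FQ) -(dlC FQ)].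
move=> d /mem_conj_of[q' /comm[h1 h2 h3 h4]].
by case=> -> ; split=> /=; rewrite ?(dlNl FQ) ?(dlNr FQ) ?(dlC FQ q.2) ?h1 ?h2 ?h3 ?h4 ?oppr0 ?opprK.
Qed.

Lemma hker_conj_of s r :
  hker (conj_of s) r <-> forall q, q \in s -> dl q.1 r = 0 /\ dl q.2 r = 0.
Proof.
split=> [h q /conj_of_mem[m1 m2]|h d /mem_conj_of[q /h[h1 h2] []->] //=].
  split; first by apply: (h _ m1).
  by have := h _ m2; rewrite /= (dlNl FQ) => /eqP; rewrite oppr_eq0 => /eqP.
by rewrite (dlNl FQ) h2 oppr0.
Qed.

Lemma hker_rev hs r : hker (catrev hs [::]) r <-> hker hs r.
Proof. by split=> h d dh; apply: h; move: dh; rewrite -/(rev hs) mem_rev. Qed.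

(** A pair orthogonal to the previous ones is first moved into their commutant, which does not
    affect its bracket at the point. The last clause of [darboux_pair] guarantees that the
    corrections stay in that commutant. *)
Lemma darboux_sys_exists n m : symplectic_rank (2 * n)%N -> (m <= n)%N ->
  exists2 s, size s = m & darboux_sys s.
Proof.
move=> rk; elim: m => [|m IHm] lt_mn; first by exists [::].
have [s sz sys] := IHm (ltnW lt_mn); have csys := conj_of_sys sys.
have [|| a [b [Ga Gb ab orth]]] := orthogonal_pair rk csys.
- move=> d /mem_conj_of[q /conj_of_mem[m1 m2] [->|->]].
    by exists (q.1, - q.2) => //=; right; rewrite opprK.
  by exists (q.2, q.1) => //=; left.
- by rewrite size_conj_of sz; lia.
have nil e d : e \in [::] -> d \in conj_of s -> conj_compat e d by [].
have nilk x : hker [::] x by [].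
have Gorth x : (forall d, d \in conj_of s -> om d.2 x = 0) ->
    forall d, d \in conj_of s -> G 1%N (dl d.2 x).
  by move=> h d /h/om_eq0.
have [a' /hker_rev Ka Ga'] := hker_approx csys nil (nilk a) Ga (Gorth a (fun d dd => (orth d dd).1)).
have [b' /hker_rev Kb Gb'] := hker_approx csys nil (nilk b) Gb (Gorth b (fun d dd => (orth d dd).2)).
have Ga1 : G 1%N a' by rewrite -[a'](subrK a); apply: (filtD FQ) => //; apply: (filtS FQ).
have Gb1 : G 1%N b' by rewrite -[b'](subrK b); apply: (filtD FQ) => //; apply: (filtS FQ).
have om1 : om a' b' = 1.
  rewrite -[a'](subrK a) omDl om_filt2 // add0r.
  by rewrite -[b'](subrK b) omDr ab omC om_filt2 // oppr0 add0r.
have [|X [Y [[GX GY] XY cX cY comm]]] := darboux_pair CQ chark p_gt2 Ga1 Gb1.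
  by have := omP a' b'; rewrite om1 rmorph1 scale1r.
exists ((X, Y) :: s); first by rewrite /= sz.
split=> //= q qs.
have [a1 a2] := (hker_conj_of s a').1 Ka q qs; have [b1 b2] := (hker_conj_of s b').1 Kb q qs.
by have [? ?] := comm q.1 a1 b1; have [? ?] := comm q.2 a2 b2.
Qed.

(** If the bracket of a and b were a unit, a and a multiple of b would extend the 2n conjugate pairs
    to a dual system of size 2n + 1, against [dual_size]. *)
Lemma darboux_sys_isotropic n s a b : symplectic_rank (2 * n)%N -> darboux_sys s ->
    size s = n -> hker (conj_of s) a -> hker (conj_of s) b -> G 1%N a -> G 1%N b ->
  G 1%N (dl a b).
Proof.
move=> rk sys sz Ka Kb Ga Gb; apply/om_eq0/eqP/negPn/negP => nz.
have csys := conj_of_sys sys.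
have := @dual_size _ ((fpsC (om a b)^-1 *: b, a) :: conj_of s) rk.
rewrite /= size_conj_of sz ltnn => h; apply: notF; apply: h.
  move=> d; rewrite inE => /predU1P[->|/(conj_sys_mem csys)[]//].
  by split=> //; apply: (filtZ FQ).
have dual d x : hker (conj_of s) x -> d \in conj_of s -> om d.2 x = 0.
  by move=> Kx dd; apply: om_dl_eq; rewrite Kx // rmorph0 scale0r.
rewrite -sz -size_conj_of; case=> [|i] [|j] //= li lj.
- by rewrite omZr mulVf.
- have /mem_conj_of[q qs eq] := mem_nth (0, 0) lj.
  have [m1 m2] := conj_of_mem qs; rewrite omC.
  case: eq => -> /=; last by rewrite (dual _ _ Ka m1) oppr0.
  by have := dual _ _ Ka m2; rewrite /= omNl => ->.
- by rewrite omZr (dual _ _ Kb) ?mulr0 // mem_nth.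
by apply: om_dl_eq; rewrite conj_sys_dual // rmorph_nat scaler_nat eqSS.
Qed.

End DarbouxSystem.

(** * The weight filtration at a closed point and its completion *)

Lemma subrACA (V : zmodType) (a b c d : V) : (a - b) - (c - d) = (a - c) - (b - d).
Proof. by rewrite !opprB addrACA [RHS]addrACA; congr (_ + _); rewrite addrC. Qed.

Lemma topologically_free_tf (k : comNzRingType) (M : lmodType (fps k)) (a : M) :
  topologically_free M -> hbar *: a = 0 -> a = 0.
Proof.
move=> [V [e [[f fK eK] eD eZ]]].
have e0 : e (fun=> 0) = 0.
  have := eD (fun=> 0) (fun=> 0); have -> : (fun _ : nat => 0 + 0 : V) = fun=> 0.
    by apply/funext => n; rewrite addr0.
  by move/eqP; rewrite -subr_eq0 opprD addrA subrr sub0r oppr_eq0 => /eqP.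
rewrite -{1}(eK a) -eZ -e0 => /(can_inj fK) h.
rewrite -(eK a); congr e; apply/funext => n.
have := congr1 (fun u => u n.+1) h; rewrite /fps_scale /= !big_ord_recl /= scale0r scale1r.
by rewrite subSS subn0 big1 ?addr0 ?add0r // => i _; rewrite scale0r.
Qed.

Section IdealPowers.
Variables (A : nzRingType) (J : set A).
Hypothesis idJ : two_sided_ideal J.

Lemma ideal_pow0 n : ideal_pow J n 0.
Proof. by case: n => // n; exists [::]; rewrite big_nil. Qed.

Lemma ideal_powD n a b : ideal_pow J n a -> ideal_pow J n b -> ideal_pow J n (a + b).
Proof.
case: n => // n [s [hs ->]] [t [ht ->]]; exists (s ++ t); rewrite big_cat; split=> // u.
by rewrite mem_cat => /orP[/hs|/ht].
Qed.

Lemma ideal_powM n u v : J u -> ideal_pow J n v -> ideal_pow J n.+1 (u * v).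
Proof.
move=> Ju Jv; exists [:: (u, v)]; rewrite big_seq1; split=> // w.
by rewrite inE => /eqP->.
Qed.

Lemma ideal_pow_ind n (P : A -> Prop) : P 0 -> (forall a b, P a -> P b -> P (a + b)) ->
  (forall u v, J u -> ideal_pow J n v -> P (u * v)) -> forall a, ideal_pow J n.+1 a -> P a.
Proof.
move=> P0 PD PM _ [s [hs ->]]; elim: s hs => [|u s IHs] hs; first by rewrite big_nil.
rewrite big_cons; apply: PD; first by have [] := hs u (mem_head _ _); apply: PM.
by apply: IHs => w ws; apply: hs; rewrite inE ws orbT.
Qed.

Lemma ideal_powMl n b a : ideal_pow J n a -> ideal_pow J n (b * a).
Proof.
case: n => // n; elim/ideal_pow_ind => [|x y|u v Ju Jv]; first by rewrite mulr0; apply: (ideal_pow0 n.+1).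
  by rewrite mulrDr; apply: (@ideal_powD n.+1).
by rewrite mulrA; apply: ideal_powM => //; case: idJ => _ _ /(_ b u Ju)[].
Qed.

Lemma ideal_pow_add_ind m n (P : A -> Prop) : P 0 -> (forall a b, P a -> P b -> P (a + b)) ->
  (forall u v, ideal_pow J m u -> ideal_pow J n v -> P (u * v)) ->
  forall a, ideal_pow J (m + n) a -> P a.
Proof.
move=> P0 PD; elim: m P P0 PD => [|m IHm] P P0 PD PM a.
  by rewrite add0n => Ja; rewrite -[a]mul1r; apply: PM.
rewrite addSn; elim/ideal_pow_ind => // u v Ju.
elim/IHm => [|x y|x y Jx Jy]; [by rewrite mulr0 | by rewrite mulrDr; apply: PD |].
by rewrite mulrA; apply: PM => //; apply: ideal_powM.
Qed.

(* J^M is contained in Q + u A, and u is nilpotent modulo Q. *)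
Lemma ideal_pow_nilpotent (Q : set A) u q M : two_sided_ideal Q ->
    (forall a, Q (u * a - a * u)) -> Q (u ^+ q) ->
    (forall x, ideal_pow J M x -> exists a, Q (x - u * a)) ->
  forall x, ideal_pow J (q * M) x -> Q x.
Proof.
move=> [Q0 QB QM] cu uq step.
have QD x y : Q x -> Q y -> Q (x + y).
  by move=> Qx Qy; rewrite -[y]opprK -[- y]sub0r; apply: (QB) => //; apply: (QB).
have cuX j a : Q (u ^+ j * a - a * u ^+ j).
  elim: j => [|j IHj]; first by rewrite mul1r mulr1 subrr.
  have -> : u ^+ j.+1 * a - a * u ^+ j.+1 =
      u * (u ^+ j * a - a * u ^+ j) + (u * a - a * u) * u ^+ j.
    by rewrite exprS mulrBr mulrBl !mulrA addrA subrK.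
  by apply: QD; [case: (QM u _ IHj) | case: (QM (u ^+ j) _ (cu a))].
suff claim j : forall x, ideal_pow J (j * M) x -> exists a, Q (x - u ^+ j * a).
  move=> x /claim[a Qa]; rewrite -[x](subrK (u ^+ q * a)); apply: QD => //.
  by case: (QM a _ uq).
elim: j => [|j IHj] x; first by exists x; rewrite expr0 mul1r subrr.
rewrite mulSn; elim/ideal_pow_add_ind => {x} [|x y [a Qa] [b Qb]|x y /step[a Qa] /IHj[b Qb]].
- by exists 0; rewrite mulr0 subr0.
- by exists (a + b); rewrite mulrDr opprD addrACA; apply: QD.
exists (a * b).
have -> : x * y - u ^+ j.+1 * (a * b) =
    (x - u * a) * y + u * a * (y - u ^+ j * b) - u * ((u ^+ j * a - a * u ^+ j) * b).
  by rewrite mulrBl mulrBr mulrBl mulrBr exprS !mulrA addrA subrK opprB addrA subrK.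
apply: QB; first by apply: QD; [case: (QM y _ Qa) | case: (QM (u * a) _ Qb)].
by have [_ h] := QM b _ (cuX j a); case: (QM u _ h).
Qed.

End IdealPowers.

Definition acc (B : nzRingType) : Prop :=
  forall I : nat -> set B, (forall n, two_sided_ideal (I n)) ->
    (forall n, I n `<=` I n.+1) -> exists N, forall n, (N <= n)%N -> I n `<=` I N.

Section WeightFiltration.
Variables (k : fieldType) (p : nat) (B : comAlgType k) (br : B -> B -> B).
Variables (A : algType (fps k)) (rho : {rmorphism A -> B}).
Hypotheses (chark : p \in [pchar k]) (p_gt2 : (2 < p)%N).
Hypotheses (A_quant : quantization br rho) (A_wc : weakly_central p A).
Variable M : {pred B}.
Hypotheses (idM : idealr_closed M) (resM : forall b, exists c : k, b - c%:A \in M).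

Lemma rhoZ (c : fps k) a : rho (c *: a) = c 0%N *: rho a.
Proof. by case: A_quant. Qed.

Lemma rho_eq0 a : rho a = 0 -> exists a', a = hbar *: a'.
Proof. by case: A_quant => _ _ _ h _ /h. Qed.

Lemma rho_hbar a : rho (hbar *: a) = 0.
Proof. by rewrite rhoZ scale0r. Qed.

Lemma rho_surj b : exists a, rho a = b.
Proof. by case: A_quant. Qed.

Definition Jset : set A := [set a | rho a \in M].

Lemma M_ideal : [/\ 0 \in M, 1 \notin M, forall a b, a \in M -> b \in M -> a - b \in M &
  forall a b, b \in M -> a * b \in M].
Proof.
case: idM => M0 M1 MM; split=> // a b; last by move=> Mb; rewrite -[_ * _]addr0 MM.
by move=> Ma Mb; rewrite -mulN1r addrC MM.
Qed.

Lemma Jset_ideal : two_sided_ideal Jset.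
Proof.
have [M0 _ MB MM] := M_ideal; split; rewrite /Jset /=; first by rewrite rmorph0.
  by move=> a b Ja Jb; rewrite rmorphB MB.
by move=> a b Jb; rewrite !rmorphM [rho b * _]mulrC !MM.
Qed.

Lemma Jset_hbar a : Jset (hbar *: a).
Proof. by have [M0 _ _ _] := M_ideal; rewrite /Jset /= rho_hbar. Qed.

(** [WfiltM] asks weight at least 1 of the second factor, so that weight 1 is exactly J and the
    constructors in weight n + 2 are those required by [filtration_generated]. *)
Inductive wfilt : nat -> A -> Prop :=
| WfiltT a : wfilt 0 a
| WfiltJ a : Jset a -> wfilt 1 a
| Wfilt0 n : wfilt n 0
| WfiltD n a b : wfilt n a -> wfilt n b -> wfilt n (a + b)
| WfiltM n u v : Jset u -> wfilt n.+1 v -> wfilt n.+2 (u * v)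
| Wfilt_hbar n w : wfilt n w -> wfilt n.+2 (hbar *: w).

Lemma wfiltMl n a : wfilt n a -> forall b, wfilt n (b * a).
Proof.
have [J0 JB JM] := Jset_ideal.
elim=> {n a} [a|a Ja|n|n a a' _ IHa _ IHa'|n u v Ju _ IHv|n w _ IHw] b.
- exact: WfiltT.
- by apply: WfiltJ; case: (JM b a Ja).
- by rewrite mulr0; apply: Wfilt0.
- by rewrite mulrDr; apply: WfiltD.
- rewrite mulrA; apply: WfiltM; first by case: (JM b u Ju).
  by rewrite -[v]mul1r.
by rewrite -scalerAr; apply: Wfilt_hbar.
Qed.

Lemma wfiltB n a b : wfilt n a -> wfilt n b -> wfilt n (a - b).
Proof. by move=> ha hb; apply: WfiltD => //; rewrite -mulN1r; apply: wfiltMl. Qed.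

Lemma wfilt_pred n a : wfilt n a -> wfilt n.-1 a.
Proof.
elim=> {n a} [a|a _|n|n a a' _ IHa _ IHa'|n u v Ju hv _|n w hw _].
- exact: WfiltT.
- exact: WfiltT.
- exact: Wfilt0.
- exact: WfiltD.
- exact: wfiltMl.
case: n hw => [|n] hw /=; first exact/WfiltJ/Jset_hbar.
by rewrite -[w]mul1r scalerAl; apply: WfiltM => //; apply: Jset_hbar.
Qed.

Lemma wfiltS n a : wfilt n.+1 a -> wfilt n a.
Proof. exact: wfilt_pred. Qed.

Lemma wfilt_le n m a : (m <= n)%N -> wfilt n a -> wfilt m a.
Proof.
elim: n => [|n IHn]; first by rewrite leqn0 => /eqP->.
by rewrite leq_eqVlt => /predU1P[->//|/IHn h /wfiltS/h].
Qed.

Lemma wfilt_mul i a : wfilt i a -> forall j b, wfilt j b -> wfilt (i + j)%N (a * b).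
Proof.
have [J0 JB JM] := Jset_ideal.
elim=> {i a} [a|a Ja|n|n a a' _ IHa _ IHa'|n u v Ju _ IHv|n w _ IHw] j b hb.
- exact: wfiltMl.
- case: j hb => [|j] hb; last exact: WfiltM.
  by apply: WfiltJ; case: (JM b a Ja).
- by rewrite mul0r; apply: Wfilt0.
- by rewrite mulrDl; apply: WfiltD; [apply: IHa | apply: IHa'].
- by rewrite -mulrA !addSn; apply: WfiltM => //; apply: IHv.
by rewrite -scalerAl; apply/Wfilt_hbar/IHw.
Qed.

Lemma commutator_hbar (a b : A) : exists c : A, commutator a b = hbar *: c.
Proof. by apply: rho_eq0; rewrite rmorphB !rmorphM mulrC subrr. Qed.

(** A bracket with an arbitrary element costs 1 only, because it takes a factor in J to weight 0 and
    leaves hbar alone. This is the case needed for the single factors in [wfilt_comm]. *)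
Lemma wfilt_comm1 j b : wfilt j b -> forall a,
  exists2 c, wfilt j.-1 c & commutator a b = hbar *: c.
Proof.
elim=> {j b} [b|b _|n|n b b' _ IHb _ IHb'|n u v Ju hv IHv|n w hw IHw] a.
- by have [c e] := commutator_hbar a b; exists c => //; apply: WfiltT.
- by have [c e] := commutator_hbar a b; exists c => //; apply: WfiltT.
- by exists 0; [apply: Wfilt0 | rewrite /commutator mulr0 mul0r subrr scaler0].
- have [c hc e] := IHb a; have [c' hc' e'] := IHb' a.
  by exists (c + c'); [apply: WfiltD | rewrite commutatorDr e e' scalerDr].
- have [c e] := commutator_hbar a u; have [c' hc' e'] := IHv a.
  exists (c * v + u * c').
    by apply: WfiltD; [apply: wfiltMl | apply: (wfilt_mul (WfiltJ Ju) hc')].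
  by rewrite commutatorMr e e' scalerDr -scalerAl -scalerAr.
have [c hc e] := IHw a; exists (hbar *: c); last by rewrite commutatorZr e.
by case: n hw hc {IHw} => [|n] hw /Wfilt_hbar // /wfiltS.
Qed.

Lemma wfilt_comm i a : wfilt i a -> forall j b, wfilt j b ->
  exists2 c, wfilt (i + j - 2)%N c & commutator a b = hbar *: c.
Proof.
elim=> {i a} [a|a Ja|n|n a a' _ IHa _ IHa'|n u v Ju hv IHv|n w hw IHw] j b hb.
- have [c hc e] := wfilt_comm1 hb a; exists c => //.
  by apply: (wfilt_le _ hc); lia.
- have [c hc e] := wfilt_comm1 hb a; exists c => //.
  by apply: (wfilt_le _ hc); lia.
- by exists 0; [apply: Wfilt0 | rewrite /commutator mulr0 mul0r subrr scaler0].
- have [c hc e] := IHa j b hb; have [c' hc' e'] := IHa' j b hb.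
  by exists (c + c'); [apply: WfiltD | rewrite commutatorDl e e' scalerDr].
- have [c hc e] := wfilt_comm1 hb u; have [c' hc' e'] := IHv j b hb.
  exists (u * c' + c * v); last by rewrite commutatorMl e e' scalerDr -scalerAl -scalerAr.
  apply: WfiltD.
    by apply: (wfilt_le _ (wfilt_mul (WfiltJ Ju) hc')); lia.
  by apply: (wfilt_le _ (wfilt_mul hc hv)); lia.
have [c hc e] := IHw j b hb; exists (hbar *: c); last by rewrite commutatorZl e.
by apply: (wfilt_le _ (Wfilt_hbar hc)); lia.
Qed.

Lemma A_tf (a : A) : hbar *: a = 0 -> a = 0.
Proof. by have [h _ _ _ _] := A_quant; apply: (topologically_free_tf h). Qed.

Lemma wfilt_filtered : filtered_quantization wfilt.
Proof.
split.
- exact: WfiltT.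
- exact: Wfilt0.
- exact: wfiltB.
- exact: wfiltS.
- by move=> i j a b ha hb; apply: wfilt_mul.
- exact: Wfilt_hbar.
- by move=> i j a b ha hb; apply: wfilt_comm.
exact: A_tf.
Qed.

Lemma wfilt_J a : wfilt 1 a <-> Jset a.
Proof.
split=> [|/WfiltJ //]; have [J0 JB JM] := Jset_ideal.
suff h n b : wfilt n b -> n = 1%N -> Jset b by move/h; apply.
elim=> {n b} // n b b' _ IHb _ IHb' n1; rewrite -[b']opprK -[- b']sub0r.
by apply: (JB); [apply: IHb | apply: (JB) => //; apply: IHb'].
Qed.

Lemma wfilt_generated : filtration_generated wfilt.
Proof.
move=> n P P0 PD PM Ph a h.
suff g m b : wfilt m b -> m = n.+2 -> P b by apply: g h _.
elim=> {m b h a} // [m b b' _ IHb _ IHb' e|m u v Ju hv _ [e]|m w hw _ [e]].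
- by apply: PD; [apply: IHb | apply: IHb'].
- by apply: PM; [apply: WfiltJ | rewrite -e].
by apply: Ph; rewrite -e.
Qed.

Lemma wfilt_residue c : exists s : k, wfilt 1 (c - fpsC s *: 1).
Proof.
have [s hs] := resM (rho c); exists s; apply: WfiltJ.
by rewrite /Jset /= rmorphB rhoZ rmorph1.
Qed.

Lemma wfilt_restricted : restricted_filtration wfilt p.
Proof.
apply: (generated_restricted wfilt_filtered chark p_gt2 A_wc wfilt_residue).
exact: wfilt_generated.
Qed.

Lemma ideal_pow_wfilt n a : ideal_pow Jset n a -> wfilt n a.
Proof.
elim: n a => [|n IHn] a; first by move=> _; apply: WfiltT.
elim/ideal_pow_ind => [|x y|u v Ju /IHn hv]; [exact: Wfilt0 | exact: WfiltD |].
exact: (wfilt_mul (WfiltJ Ju) hv).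
Qed.

(** The factor 2 is due to hbar, which has weight 2 but counts as a single factor in J. *)
Lemma wfilt_ideal_pow n a : wfilt (2 * n)%N a -> ideal_pow Jset n a.
Proof.
suff h m : wfilt m a -> forall n, (2 * n <= m)%N -> ideal_pow Jset n a by move/h; apply.
elim=> {m a n} [a|a _|m|m a b _ IHa _ IHb|m u v Ju _ IHv|m w _ IHw] [|n] //.
- by move=> le; exfalso; lia.
- by move=> _; exact: (@ideal_pow0 _ _ n.+1).
- by move=> le; apply: (@ideal_powD _ _ n.+1); [apply: IHa | apply: IHb].
- by move=> le; apply: ideal_powM => //; apply: IHv; lia.
move=> le; rewrite -[w]mul1r scalerAl; apply: ideal_powM; first exact: Jset_hbar.
by apply: IHw; lia.
Qed.

(** For central [ts], the ideal generated by the n-th powers of the elements of [ts]. *)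
Definition comb (ts : seq A) (n : nat) (x : A) : Prop :=
  exists c : nat -> A, x = \sum_(i < size ts) ts`_i ^+ n * c i.

Lemma comb_le ts m n x : (m <= n)%N -> comb ts n x -> comb ts m x.
Proof.
move=> le [c ->]; exists (fun i => ts`_i ^+ (n - m) * c i); apply: eq_bigr => i _.
by rewrite mulrA -exprD subnKC.
Qed.

(* The chains of the proof consist of ideals containing hbar, so that the
   ascending chain condition is needed for B only. *)
Lemma artin_rees (ts : seq A) : acc B -> (forall t, t \in ts -> t \in @central A) ->
  forall (n : nat) (Q : set A), Q 0 -> (forall a b, Q a -> Q b -> Q (a - b)) ->
    (forall a b, Q b -> Q (a * b)) ->
  exists m, forall a x, comb ts m x -> Q (hbar *: a - x) ->
    exists2 b, comb ts n b & Q (hbar *: a - hbar *: b).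
Proof.
move=> accB; elim: ts => [|t ts IHts] cts n Q Q0 QB QM.
  exists 0%N => a x [c]; rewrite big_ord0 => -> Qa; exists 0; last by rewrite scaler0.
  by exists (fun=> 0); rewrite big_ord0.
have ct := centralE (cts t (mem_head _ _)).
have QD x z : Q x -> Q z -> Q (x + z).
  by move=> Qx Qz; rewrite -[z]opprK -[- z]sub0r; apply: (QB) => //; apply: (QB).
have ctX j a : t ^+ j * a = a * t ^+ j by apply: centralE; apply/centralX/cts/mem_head.
(* The images in B of the colon ideals of Q + hbar A by t^j; they increase with j. *)
pose I j : set B := [set b | exists m a, rho m = b /\ Q (t ^+ j * m - hbar *: a)].
have [c hc] : exists N, forall j, (N <= j)%N -> I j `<=` I N.
  apply: accB => [j|j b [m [a [<- Qm]]]]; last first.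
    exists m, (t * a); split=> //; rewrite scalerAr exprS -mulrA -mulrBr; exact: QM.
  split; first by exists 0, 0; rewrite rmorph0 mulr0 scaler0 subr0.
    move=> _ _ [m [a [<- Qm]]] [m' [a' [<- Qm']]]; exists (m - m'), (a - a').
    by rewrite rmorphB mulrBr scalerBr subrACA; split=> //; apply: QB.
  move=> b _ [m [a [<- Qm]]]; have [b' <-] := rho_surj b.
  split; last rewrite mulrC; exists (b' * m), (b' * a); rewrite rmorphM; split=> //;
    rewrite scalerAr mulrA ctX -mulrA -mulrBr; exact: QM.
(* Past the index c the chain is constant, so a relation placing t^(n+c) r in Q + hbar A improves to
   one for t^c r, and the factor t^n is left over for the conclusion. *)
pose n' := (n + c)%N.
pose Q' : set A := [set x | exists q m, Q q /\ x = q + t ^+ n' * m].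
have cts' s : s \in ts -> s \in @central A by move=> h; apply: cts; rewrite inE h orbT.
have [|||m hm] := IHts cts' n Q'.
- by exists 0, 0; rewrite mulr0 addr0.
- move=> _ _ [q [m [Qq ->]]] [q' [m' [Qq' ->]]]; exists (q - q'), (m - m').
  by split; [apply: QB | rewrite mulrBr opprD addrACA].
- move=> a _ [q [m [Qq ->]]]; exists (a * q), (a * m); split; first exact: QM.
  by rewrite mulrDr !mulrA ctX.
exists (maxn m n') => a x [d ex] Qax.
pose x' := \sum_(i < size ts) ts`_i ^+ maxn m n' * d i.+1.
have ex' : x = t ^+ maxn m n' * d 0%N + x' by rewrite ex big_ord_recl.
have [||b1 [d1 eb1] [q [r [Qq eq]]]] := hm a x'.
- by apply: (comb_le (leq_maxl m n')); exists (fun i => d i.+1).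
- exists (hbar *: a - x), (t ^+ (maxn m n' - n') * d 0%N); split=> //.
  by rewrite mulrA -exprD subnKC ?leq_maxr // ex' opprD [- _ - x']addrC addrA subrK.
have Qr : Q (t ^+ n' * r - hbar *: (a - b1)).
  by rewrite scalerBr eq opprD addrCA subrr addr0 -sub0r; apply: QB.
have [s0 Qs0] : exists s0, Q (t ^+ c * r - hbar *: s0).
  have [|m1 [s1 [em1 Qs1]]] := hc n' (leq_addl n c) (rho r); first by exists r, (a - b1).
  have [|u eu] := @rho_eq0 (r - m1); first by rewrite rmorphB em1 subrr.
  exists (s1 + t ^+ c * u); rewrite -[r](subrK m1) eu mulrDr scalerDr -scalerAr.
  by rewrite [X in X - _]addrC opprD addrACA subrr addr0.
exists (b1 + t ^+ n * s0).
  exists (fun i => if i is i'.+1 then d1 i' else s0).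
  by rewrite big_ord_recl /= addrC eb1.
have -> : hbar *: a - hbar *: (b1 + t ^+ n * s0) =
    q + t ^+ n * (t ^+ c * r - hbar *: s0).
  by rewrite scalerDr opprD addrA eq mulrBr mulrA -exprD -scalerAr addrA.
exact/QD/QM.
Qed.

Variable zs : seq A.
Hypothesis gen_M : forall b, b \in M -> exists c : nat -> B, b = \sum_(i < size zs) rho zs`_i * c i.
Hypothesis zs_J : forall i, Jset zs`_i.

Lemma Jset_gen a : Jset a -> exists (c : nat -> A) r, a = \sum_(i < size zs) zs`_i * c i + hbar *: r.
Proof.
move=> /gen_M[c e]; have /choice[c' hc'] i := rho_surj (c i).
have [|r er] := @rho_eq0 (a - \sum_(i < size zs) zs`_i * c' i).
  rewrite rmorphB rmorph_sum /= e; apply/eqP; rewrite subr_eq0; apply/eqP.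
  by apply: eq_bigr => i _; rewrite rmorphM hc'.
by exists c', r; rewrite -er addrC subrK.
Qed.

Lemma ideal_pow_gen n a : ideal_pow Jset n.+1 a -> exists (c : nat -> A) r,
  [/\ forall i, ideal_pow Jset n (c i), ideal_pow Jset n r &
      a = \sum_(i < size zs) zs`_i * c i + hbar *: r].
Proof.
have idJ := Jset_ideal.
elim/ideal_pow_ind => [|x y [c [r [hc hr ->]]] [c' [r' [hc' hr' ->]]]|u v /Jset_gen[c [r ->]] Jv].
- exists (fun=> 0), 0; split; [by move=> _; apply: ideal_pow0 | exact: ideal_pow0 |].
  by rewrite scaler0 addr0 big1 // => i _; rewrite mulr0.
- exists (fun i => c i + c' i), (r + r'); split.
  + by move=> i; apply: ideal_powD.
  + exact: ideal_powD.
  by rewrite addrACA -big_split scalerDr; congr (_ + _); apply: eq_bigr => i _; rewrite mulrDr.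
exists (fun i => c i * v), (r * v); split; [by move=> i; apply: ideal_powMl | exact: ideal_powMl |].
by rewrite mulrDl mulr_suml scalerAl; congr (_ + _); apply: eq_bigr => i _; rewrite mulrA.
Qed.

(** As Q contains hbar A, everything commutes modulo Q. By induction a power of J lies in Q + z A,
    and z^q in Q then puts a q times higher power in Q. *)
Lemma ideal_pow_sub (q : nat) (l : seq A) (Q : set A) : two_sided_ideal Q ->
    (forall a, Q (hbar *: a)) -> (forall z, z \in l -> Q (z ^+ q)) ->
    (exists m, forall x, ideal_pow Jset m x ->
       exists c : nat -> A, Q (x - \sum_(i < size l) l`_i * c i)) ->
  exists m, forall x, ideal_pow Jset m x -> Q x.
Proof.
elim: l Q => [|z l IHl] Q idQ Qh Qz [m hm].
  by exists m => x /hm[c]; rewrite big_ord0 subr0.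
have [Q0 QB QM] := idQ.
have QD x y : Q x -> Q y -> Q (x + y).
  by move=> Qx Qy; rewrite -[y]opprK -[- y]sub0r; apply: (QB) => //; apply: (QB).
have cz a : Q (z * a - a * z).
  by have [c e] := commutator_hbar z a; rewrite -/(commutator z a) e.
pose Q' : set A := [set x | exists a, Q (x - z * a)].
have [||||m' hm'] := IHl Q'.
- split; first by exists 0; rewrite mulr0 subr0.
    by move=> x y [a Qa] [b Qb]; exists (a - b); rewrite mulrBr subrACA; apply: QB.
  move=> x y [a Qa]; split; last first.
    by exists (a * x); rewrite mulrA -mulrBl; case: (QM x _ Qa).
  exists (x * a); have -> : x * y - z * (x * a) = x * (y - z * a) - (z * x - x * z) * a.
    by rewrite mulrBr mulrBl !mulrA opprB addrA subrK.
  by apply: QB; [case: (QM x _ Qa) | case: (QM a _ (cz x))].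
- by move=> a; exists 0; rewrite mulr0 subr0.
- by move=> w wl; exists 0; rewrite mulr0 subr0; apply: Qz; rewrite inE wl orbT.
- exists m => x /hm[c Qc]; exists (fun i => c i.+1), (c 0%N).
  by move: Qc; rewrite big_ord_recl opprD addrA addrAC.
exists (q * m')%N; apply: (ideal_pow_nilpotent idQ cz) => //.
by apply: Qz; rewrite mem_head.
Qed.

(** The central elements zeta = z^p - hbar^(p-1) z' agree with z^p modulo hbar, so a high power of J
    lies in the ideal of the zeta^m1 plus hbar^m1 A. If hbar a = y + hbar^m1 r is such a
    decomposition, then hbar (a - hbar^(m1-1) r) = y, and [artin_rees] with Q = 0 puts a -
    hbar^(m1-1) r in the ideal of the zeta^n, which has weight n. *)
Lemma wfilt_artin_rees : acc B ->
  forall n, exists m, forall a, wfilt m (hbar *: a) -> wfilt n a.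
Proof.
move=> accB n; have FQ := wfilt_filtered; have idJ := Jset_ideal.
have /choice[z' hz'] i : exists z', wfilt 1 z' /\ ppow p zs`_i z'.
  by have [b hb hp] := wfilt_restricted (isT : (0 < 1)%N) (WfiltJ (zs_J i)); exists b.
pose zeta i := zs`_i ^+ p - hbar ^+ p.-1 *: z' i.
pose ts := [seq zeta i | i <- iota 0 (size zs)].
have sz : size ts = size zs by rewrite size_map size_iota.
have tsE i : (i < size zs)%N -> ts`_i = zeta i.
  by move=> lt_i; rewrite (nth_map 0%N) ?size_iota // nth_iota.
have p1 : (0 < p.-1)%N by lia.
have rho_zeta i : rho (zeta i) = rho zs`_i ^+ p.
  rewrite rmorphB rmorphXn -(prednK p1) exprS -scalerA rho_hbar subr0 //.
have cts t : t \in ts -> t \in @central A.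
  by case/mapP => i _ ->; case: (hz' i).
have ts1 t : t \in ts -> wfilt 1 t.
  case/mapP => i _ ->; apply: wfiltB.
    by apply: (wfilt_le _ (filtX FQ p (WfiltJ (zs_J i)))); lia.
  by case: (hz' i) => h _; apply: (filtZ FQ).
have [||| m0 hm0] := artin_rees accB cts n (Q := [set x | x = 0]) => //.
- by move=> a b /= -> ->; rewrite subrr.
- by move=> a b /= ->; rewrite mulr0.
(* The bound m0 serves [artin_rees]; n + 1 makes the weight of hbar^(m1-1) r at least n. *)
pose m1 := maxn m0 n.+1.
have combD x y j : comb ts j x -> comb ts j y -> comb ts j (x - y).
  move=> [c ->] [c' ->]; exists (fun i => c i - c' i); rewrite -sumrB.
  by apply: eq_bigr => i _; rewrite mulrBr.
have combM x y j : comb ts j x -> comb ts j (y * x) /\ comb ts j (x * y).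
  move=> [c ->]; split; [exists (fun i => y * c i) | exists (fun i => c i * y)].
    rewrite mulr_sumr; apply: eq_bigr => i _; rewrite !mulrA; congr (_ * _).
    by apply/esym/centralE; apply/centralX/cts/mem_nth.
  by rewrite mulr_suml; apply: eq_bigr => i _; rewrite mulrA.
have comb0 j : comb ts j 0.
  by exists (fun=> 0); rewrite big1 // => i _; rewrite mulr0.
have combi i j : (i < size zs)%N -> comb ts j (zeta i ^+ j).
  move=> lt_i; exists (fun l => (l == i)%:R); rewrite -sz in lt_i.
  rewrite (bigD1 (Ordinal lt_i)) //= eqxx mulr1 tsE -?sz // big1 ?addr0 // => l li.
  by rewrite (_ : (l == i :> nat) = false) ?mulr0 //; apply/negbTE.
pose Qj j : set A := [set x | exists y r, comb ts m1 y /\ x = y + hbar ^+ j *: r].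
have idQ j : two_sided_ideal (Qj j).
  split; first by exists 0, 0; rewrite scaler0 addr0.
    move=> _ _ [y [r [hy ->]]] [y' [r' [hy' ->]]]; exists (y - y'), (r - r').
    by split; [apply: combD | rewrite scalerBr opprD addrACA].
  move=> a _ [y [r [hy ->]]]; have [h1 h2] := combM y a m1 hy; split.
    by exists (a * y), (a * r); rewrite mulrDr scalerAr.
  by exists (y * a), (r * a); rewrite mulrDl scalerAl.
(* Modulo hbar, z^(p m1) equals zeta^m1, whence the exponent. *)
have [||| m2 hm2] := @ideal_pow_sub (p * m1) zs (Qj 1%N) (idQ 1%N).
- by move=> a; exists 0, a; rewrite add0r expr1.
- move=> z /(nthP 0)[i lt_i <-].
  have [|r er] := @rho_eq0 (zs`_i ^+ (p * m1) - zeta i ^+ m1).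
    by rewrite rmorphB !rmorphXn rho_zeta /= exprM subrr.
  by exists (zeta i ^+ m1), r; split; [apply: combi | rewrite expr1 -er addrC subrK].
- exists 1%N => x; elim/ideal_pow_ind => [|a b [c Qc] [d Qd]|u v /Jset_gen[c [r ->]] _].
  + by exists (fun=> 0); rewrite big1 ?subr0 => [|i _]; [case: (idQ 1%N) | rewrite mulr0].
  + exists (fun i => c i + d i); rewrite (eq_bigr (fun i : 'I_(size zs) => zs`_i * c i + zs`_i * d i)); last first.
      by move=> i _; rewrite mulrDr.
    rewrite big_split opprD addrACA; have [Q0 QB _] := idQ 1%N.
    by have := QB _ _ Qc (QB _ _ Q0 Qd); rewrite sub0r opprK.
  exists (fun i => c i * v); rewrite mulrDl mulr_suml (eq_bigr (fun i : 'I_(size zs) => zs`_i * (c i * v))).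
    by rewrite addrC addKr; exists 0, (r * v); rewrite add0r expr1 scalerAl.
  by move=> i _; rewrite mulrA.
(* From modulo hbar to modulo hbar^m1: hbar is nilpotent of order m1 modulo [Qj m1]. *)
have h3 := @ideal_pow_nilpotent _ Jset (Qj m1) (hbar *: 1) m1 m2 (idQ m1).
exists (2 * (m1 * m2))%N => a /wfilt_ideal_pow/h3 [||x /hm2[y [r [hy ->]]]|y [r [hy e]]].
- move=> b; rewrite -scalerAl -scalerAr mul1r mulr1 subrr; by case: (idQ m1).
- by exists 0, 1; split=> //; rewrite add0r exprZn expr1n.
- by exists r; rewrite expr1 -scalerAl mul1r addrK; exists y, 0; rewrite scaler0 addr0.
have m1S : m1 = m1.-1.+1 by rewrite /m1; lia.
have [||b hb /eqP] := hm0 (a - hbar ^+ m1.-1 *: r) y.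
- by apply: (comb_le _ hy); rewrite /m1 leq_maxl.
- by rewrite /= scalerBr scalerA -exprS -m1S e addrK subrr.
rewrite -scalerBr => /eqP/A_tf/eqP; rewrite subr_eq0 => /eqP eb.
rewrite -[a](subrK (hbar ^+ m1.-1 *: r)) eb; apply: WfiltD.
  case: hb => c ->; apply: (filt_sum FQ) => i _; apply: (filtMr FQ).
  have := filtX FQ n (ts1 _ (mem_nth 0 (ltn_ord i))); by rewrite muln1.
apply: (wfilt_le _ (filt_hbarX FQ m1.-1 (WfiltT r))); rewrite /m1; lia.
Qed.

End WeightFiltration.

(** * The completion and its weight filtration *)

Section AdicCompletion.
Variables (K : comNzRingType) (A Ah : algType K) (iota : {lrmorphism A -> Ah}).
Variables (J : set A) (F : nat -> set Ah).
Hypotheses (Fid : forall n, two_sided_ideal (F n) /\ F n.+1 `<=` F n)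
  (Fiota : forall n a, F n (iota a) <-> ideal_pow J n a)
  (Flim : forall a : nat -> A, (forall n, ideal_pow J n (a n.+1 - a n)) ->
          exists! x, forall n, F n (x - iota (a n))).
Implicit Types (n m : nat) (x y z : Ah).

Lemma compl0 n : F n 0. Proof. by have [[]] := Fid n. Qed.

Lemma complB n x y : F n x -> F n y -> F n (x - y).
Proof. by have [[_ h _] _] := Fid n; apply: h. Qed.

Lemma complN n x : F n x -> F n (- x).
Proof. by move=> h; rewrite -sub0r; apply: complB => //; apply: compl0. Qed.

Lemma complD n x y : F n x -> F n y -> F n (x + y).
Proof. by move=> hx hy; rewrite -[y]opprK; apply: complB => //; apply: complN. Qed.

Lemma complMl n x y : F n y -> F n (x * y).
Proof. by have [[_ _ h] _] := Fid n => Fy; case: (h x y Fy). Qed.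

Lemma complMr n x y : F n x -> F n (x * y).
Proof. by have [[_ _ h] _] := Fid n => Fx; case: (h y x Fx). Qed.

Lemma complZ n (c : K) x : F n x -> F n (c *: x).
Proof. by move=> Fx; rewrite -[x]mul1r scalerAl; apply: complMl. Qed.

Lemma complW n m x : (m <= n)%N -> F n x -> F m x.
Proof.
elim: n => [|n IHn]; first by rewrite leqn0 => /eqP->.
by rewrite leq_eqVlt => /predU1P[->//|/IHn h]; have [_ s] := Fid n => /s/h.
Qed.

Lemma compl_trans n x y z : F n (x - y) -> F n (y - z) -> F n (x - z).
Proof. by move=> h1 h2; rewrite -[x](subrK y) -addrA; apply: complD. Qed.

Lemma compl_sym n x y : F n (x - y) -> F n (y - x).
Proof. by move=> h; rewrite -opprB; apply: complN. Qed.

Lemma compl_sep x : (forall n, F n x) -> x = 0.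
Proof.
move=> Fx; have [|y [_ uy]] := Flim (a := fun=> 0).
  by move=> n; rewrite subrr; apply: ideal_pow0.
rewrite -(uy x) => [|n]; last by rewrite rmorph0 subr0.
by apply: uy => n; rewrite rmorph0 subr0; apply: compl0.
Qed.

Lemma compl_iota_diff n x a b : F n (x - iota a) -> F n (x - iota b) ->
  ideal_pow J n (a - b).
Proof.
move=> ha hb; apply/Fiota; rewrite rmorphB.
exact: compl_trans (compl_sym ha) hb.
Qed.

End AdicCompletion.

Section Completion.
Variables (k : fieldType) (p : nat) (B : comAlgType k) (br : B -> B -> B).
Variables (A : algType (fps k)) (rho : {rmorphism A -> B}).
Hypotheses (chark : p \in [pchar k]) (p_gt2 : (2 < p)%N).
Hypotheses (A_quant : quantization br rho) (A_wc : weakly_central p A).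
Variable M : {pred B}.
Hypotheses (idM : idealr_closed M) (resM : forall b, exists c : k, b - c%:A \in M).
Variable zs : seq A.
Hypothesis gen_M : forall b, b \in M -> exists c : nat -> B, b = \sum_(i < size zs) rho zs`_i * c i.
Hypothesis zs_J : forall i, Jset rho M zs`_i.
Hypothesis accB : acc B.
Variables (Ay : algType (fps k)) (iota : {lrmorphism A -> Ay}).
Variable F : nat -> set Ay.
Hypotheses (Fid : forall n, two_sided_ideal (F n) /\ F n.+1 `<=` F n)
  (Fiota : forall n a, F n (iota a) <-> ideal_pow (Jset rho M) n a)
  (Fdense : forall n x, exists a, F n (x - iota a))
  (Flim : forall a : nat -> A, (forall n, ideal_pow (Jset rho M) n (a n.+1 - a n)) ->
          exists! x, forall n, F n (x - iota (a n))).

Local Notation G := (wfilt rho M).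
Let FQ : filtered_quantization G := wfilt_filtered chark p_gt2 A_quant idM.

(** The closure of the image of [wfilt n]. One approximation modulo [F n] is enough because J^n has
    weight n; [cfilt_approx] recovers arbitrary precision. *)
Definition cfilt n : set Ay := [set x | exists2 a, G n a & F n (x - iota a)].

Let iotaZ (c : fps k) a : iota (c *: a) = c *: iota a.
Proof. exact: linearZ. Qed.

Let F0 := compl0 Fid.
Let FB := complB Fid.
Let FD := complD Fid.
Let FMl := complMl Fid.
Let FMr := complMr Fid.
Let FZ := complZ Fid.
Let FW := complW Fid.
Let F_trans := compl_trans Fid.
Let F_sym := compl_sym Fid.
Let F_sep := compl_sep Fid Flim.

Lemma F_cfilt n x : F n x -> cfilt n x.
Proof. by exists 0; [apply: Wfilt0 | rewrite rmorph0 subr0]. Qed.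

Lemma wfilt_F n a : G (2 * n)%N a -> F n (iota a).
Proof. by move=> h; apply/Fiota/(wfilt_ideal_pow chark p_gt2 A_quant idM). Qed.

Lemma cfilt_F n x : cfilt (2 * n)%N x -> F n x.
Proof.
case=> a /wfilt_F h1 h2; rewrite -[x](subrK (iota a)); apply: FD => //.
by apply: FW h2; lia.
Qed.

Lemma iota_wfilt n a : cfilt n (iota a) -> G n a.
Proof.
case=> a' h1; rewrite -rmorphB => /Fiota/(ideal_pow_wfilt idM) h2.
by rewrite -[a](subrK a'); apply: WfiltD.
Qed.

Lemma wfilt_iota n a : G n a -> cfilt n (iota a).
Proof. by exists a => //; rewrite subrr; apply: F0. Qed.

Let F_iota_diff := compl_iota_diff Fid Fiota.

Lemma cfilt_approx i x n : cfilt i x -> exists2 a, G i a & F n (x - iota a).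
Proof.
case=> a' ha' Fa'; have [a Fa] := Fdense (maxn i n) x; exists a; last first.
  by apply: FW Fa; apply: leq_maxr.
rewrite -[a](subrK a'); apply: WfiltD => //; apply: (ideal_pow_wfilt idM).
by apply: F_iota_diff Fa'; apply: FW Fa; apply: leq_maxl.
Qed.

Lemma cfilt_F_add n x y : cfilt n x -> F n (y - x) -> cfilt n y.
Proof.
by case=> a ha Fa Fy; exists a => //; apply: F_trans Fy Fa.
Qed.

Lemma cfilt_lim (x : nat -> Ay) : (forall n, cfilt n (x n.+1 - x n)) ->
  exists X, forall n, cfilt n (X - x n).
Proof.
move=> hx.
have cB n u v : cfilt n u -> cfilt n v -> cfilt n (u + v).
  move=> [a ha Fa] [b hb Fb]; exists (a + b); first exact: WfiltD.
  by rewrite rmorphD opprD addrACA; apply: FD.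
have cS n m u : (m <= n)%N -> cfilt n u -> cfilt m u.
  by move=> le [a ha Fa]; exists a; [apply: (wfilt_le A_quant idM le ha) | apply: FW Fa].
have tele n m : cfilt n (x (n + m)%N - x n).
  elim: m => [|m IHm]; first by rewrite addn0 subrr; apply/F_cfilt/F0.
  rewrite addnS -[x _.+1](subrK (x (n + m)%N)) -addrA; apply: cB => //.
  by apply: cS (hx _); lia.
(* Weight 2n implies membership in [F n], so the terms of even index form a Cauchy sequence for
   [F]. *)
have /choice[a ha] n := Fdense n (x (2 * n)%N).
have [|X [hX _]] := Flim (a := a).
  move=> n; apply: (@F_iota_diff n (x (2 * n.+1)%N)).
    by apply: FW (ha n.+1).
  rewrite -[x _](subrK (x (2 * n)%N)) -addrA; apply: FD => //; apply: cfilt_F.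
  by have -> : (2 * n.+1 = 2 * n + 2)%N by lia; apply: tele.
exists X => n; rewrite -[X](subrK (x (2 * n)%N)) -addrA.
apply: cB; last by have -> : (2 * n = n + n)%N by lia; apply: tele.
by apply/F_cfilt/(F_trans (hX n))/F_sym.
Qed.

Lemma cfilt_AR n : exists m, forall x, cfilt m (hbar *: x) -> cfilt n x.
Proof.
have [m hm] := wfilt_artin_rees chark p_gt2 A_quant A_wc idM resM gen_M zs_J accB n.
exists m => x hx; have [a Fa] := Fdense (maxn n m) x.
have Ga : G m (hbar *: a).
  apply: iota_wfilt; apply: (cfilt_F_add hx); rewrite iotaZ /= -scalerBr.
  by apply/FZ/F_sym; apply: FW Fa; apply: leq_maxr.
apply: (cfilt_F_add (wfilt_iota (hm _ Ga))).
by apply: FW Fa; apply: leq_maxl.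
Qed.

Lemma cfilt_sep x : (forall n, cfilt n x) -> x = 0.
Proof. by move=> h; apply: F_sep => n; apply: cfilt_F. Qed.

(** If hbar x = 0, then hbar x has every weight, hence by [cfilt_AR] so has x. Brackets are limits
    of brackets of approximations in A, and [cfilt_AR] again makes their quotients by hbar
    converge. *)
Lemma cfilt_filtered : filtered_quantization cfilt.
Proof.
have cS n m u : (m <= n)%N -> cfilt n u -> cfilt m u.
  by move=> le [a ha Fa]; exists a; [apply: (wfilt_le A_quant idM le ha) | apply: FW Fa].
have cB n u v : cfilt n u -> cfilt n v -> cfilt n (u - v).
  move=> [a ha Fa] [b hb Fb]; exists (a - b); first exact: (wfiltB idM).
  by rewrite rmorphB subrACA; apply: FB.
have tf (x : Ay) : hbar *: x = 0 -> x = 0.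
  move=> e; apply: cfilt_sep => n; have [m hm] := cfilt_AR n; apply: hm.
  by rewrite e; apply/F_cfilt/F0.
split=> //.
- by move=> x; have [a Fa] := Fdense 0 x; exists a => //; apply: WfiltT.
- by move=> n; apply/F_cfilt/F0.
- by move=> n a; apply: cS.
- move=> i j x y /(cfilt_approx (i + j)%N)[a Ga Fa] /(cfilt_approx (i + j)%N)[b Gb Fb].
  exists (a * b); first exact: (filtM FQ).
  have -> : x * y - iota (a * b) = (x - iota a) * y + iota a * (y - iota b).
    by rewrite mulrBl mulrBr rmorphM addrA subrK.
  by apply: FD; [apply: FMr | apply: FMl].
- move=> n x /(cfilt_approx n.+2)[a Ga Fa]; exists (hbar *: a); first exact: Wfilt_hbar.
  by rewrite iotaZ /= -scalerBr; apply: FZ.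
move=> i j x y hx hy.
have /choice[K hK] := cfilt_AR.
(* The precision of the n-th approximation. It is increasing and at least K n + n, so that the
   differences of hbar c_n have weight K n, and those of c_n weight n. *)
pose L n := (\sum_(l < n.+1) (K l + l))%N.
have LS n : (L n.+1 = L n + (K n.+1 + n.+1))%N by rewrite /L big_ord_recr.
have LK n : (K n + n <= L n)%N by case: n => [|n]; [rewrite /L big_ord1 | rewrite LS leq_addl].
have /choice[a ha] n : exists a, G i a /\ F (L n) (x - iota a).
  by have [a Ga Fa] := cfilt_approx (L n) hx; exists a.
have /choice[b hb] n : exists b, G j b /\ F (L n) (y - iota b).
  by have [b Gb Fb] := cfilt_approx (L n) hy; exists b.
have /choice[c hc] n : exists c, G (i + j - 2)%N c /\ commutator (a n) (b n) = hbar *: c.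
  have [Ga _] := ha n; have [Gb _] := hb n.
  by have [c Gc ec] := filt_comm FQ Ga Gb; exists c.
have near n : F (L n) (commutator x y - hbar *: iota (c n)).
  have [_ Fa] := ha n; have [_ Fb] := hb n; have [_ ec] := hc n.
  have -> : hbar *: iota (c n) = commutator (iota (a n)) (iota (b n)).
    by rewrite -iotaZ /= -ec /commutator rmorphB !rmorphM.
  have -> : commutator x y - commutator (iota (a n)) (iota (b n)) =
      commutator (x - iota (a n)) y + commutator (iota (a n)) (y - iota (b n)).
    have el u v w : commutator (u - v) w = commutator u w - commutator v w :> Ay.
      by rewrite /commutator mulrBl mulrBr subrACA.
    have er u v w : commutator u (v - w) = commutator u v - commutator u w :> Ay.
      by rewrite /commutator mulrBl mulrBr subrACA.
    by rewrite el er addrA subrK.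
  by apply: FD; apply: FB; (exact: FMl || exact: FMr).
have [|C hC] := @cfilt_lim (fun n => iota (c n)).
  move=> n; apply: hK; apply/F_cfilt; rewrite scalerBr.
  apply: F_trans (F_sym _) _; last by apply: FW (near n); have := LK n; lia.
  by apply: FW (near n.+1); rewrite LS; have := LK n; lia.
exists C.
  have cD n u v : cfilt n u -> cfilt n v -> cfilt n (u + v).
    move=> [a' Ga' Fa'] [b' Gb' Fb']; exists (a' + b'); first exact: WfiltD.
    by rewrite rmorphD opprD addrACA; apply: FD.
  rewrite -[C](subrK (iota (c (i + j - 2)%N))); apply: cD => //.
  by apply: wfilt_iota; case: (hc (i + j - 2)%N).
apply/eqP; rewrite -subr_eq0; apply/eqP/F_sep => n.
apply: (@F_trans _ _ (hbar *: iota (c (2 * n)%N))).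
  by apply: FW (near _); have := LK (2 * n)%N; lia.
by rewrite -scalerBr; apply/FZ/F_sym/cfilt_F.
Qed.

Lemma iota_central z : z \in @central A -> iota z \in @central Ay.
Proof.
move=> /centralE cz; apply: centralI => x; apply/eqP; rewrite -subr_eq0; apply/eqP/F_sep => n.
have [a Fa] := Fdense n x.
have -> : iota z * x - x * iota z = iota z * (x - iota a) - (x - iota a) * iota z.
  by rewrite mulrBl mulrBr -!rmorphM cz opprB addrA subrK.
by apply: FB; [apply: FMl | apply: FMr].
Qed.

Lemma iota_ppow a b : ppow p a b -> ppow p (iota a) (iota b).
Proof. by move/iota_central; rewrite rmorphB rmorphXn /= iotaZ. Qed.

Lemma ppow_lim x X (u : nat -> A * A) :
    (forall n, ppow p (u n).1 (u n).2) -> (forall n, F n (x - iota (u n).1)) ->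
    (forall n, cfilt n (X - iota (u n).2)) -> ppow p x X.
Proof.
move=> hu hx hX; have CF := cfilt_filtered.
have FexpB n y z m : F n (y - z) -> F n (y ^+ m - z ^+ m).
  move=> Fyz; elim: m => [|m IHm]; first by rewrite subrr; apply: F0.
  have -> : y ^+ m.+1 - z ^+ m.+1 = (y - z) * y ^+ m + z * (y ^+ m - z ^+ m).
    by rewrite mulrBl mulrBr -!exprS addrA subrK.
  by apply: FD; [apply: FMr | apply: FMl].
apply/centralP => s; apply: F_sep => n.
pose z := iota ((u (2 * n)%N).1 ^+ p - hbar ^+ p.-1 *: (u (2 * n)%N).2).
have cz : commutator s z = 0 by move/centralP: (iota_central (hu (2 * n)%N)); apply.
have -> : commutator s (x ^+ p - hbar ^+ p.-1 *: X) = commutator s (x ^+ p - hbar ^+ p.-1 *: X - z).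
  have e : x ^+ p - hbar ^+ p.-1 *: X = (x ^+ p - hbar ^+ p.-1 *: X - z) + z by rewrite subrK.
  by rewrite {1}e commutatorDr cz addr0.
suff h : F n (x ^+ p - hbar ^+ p.-1 *: X - z) by apply: FB; [apply: FMl | apply: FMr].
rewrite /z rmorphB rmorphXn /= iotaZ /= subrACA; apply: FB.
  by apply: FexpB; apply: FW (hx _); lia.
by rewrite -scalerBr; apply/FZ/cfilt_F.
Qed.

Lemma cfilt_residue x : exists s : k, cfilt 1 (x - fpsC s *: 1).
Proof.
have [a Fa] := Fdense 1 x; have [s Gs] := wfilt_residue A_quant resM a; exists s.
apply: (cfilt_F_add (wfilt_iota Gs)).
by rewrite rmorphB /= iotaZ rmorph1 opprB addrA subrK.
Qed.

(** Refining an approximation by a difference of weight n + j changes its restricted power by that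
    of the difference and a Jacobson term. Only for n at least 2 does this term have weight n + j as
    well, so that the restricted powers converge. *)
Lemma cfilt_restricted_ge2 n x : (1 < n)%N -> cfilt n x ->
  exists2 X, cfilt n X & ppow p x X.
Proof.
move=> n1 hx; have CF := cfilt_filtered.
have restr := wfilt_restricted chark p_gt2 A_quant A_wc idM resM.
pose P j (u : A * A) := [/\ F (n + j)%N (x - iota u.1), G n u.1, G n u.2 & ppow p u.1 u.2].
have [||u [Pu Qu]] := @dependent_choice_seq _ P (fun j u v => G (n + j)%N (v.2 - u.2)).
- have [a Ga Fa] := cfilt_approx n hx; have [b Gb hb] := restr n a (ltnW n1) Ga.
  by exists (a, b); rewrite /P addn0.
- move=> j [a b] [/= Fa Ga Gb hb].
  have [a' Ga' Fa'] := cfilt_approx (n + j.+1)%N hx.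
  have Gd : G (n + j)%N (a' - a).
    apply/(ideal_pow_wfilt idM)/(@F_iota_diff _ x) => //.
    by apply: FW Fa'; rewrite addnS.
  have [d Gd' hd] := restr (n + j)%N _ (ltn_addr _ (ltnW n1)) Gd.
  have GL : G (n + j)%N (jacL p a (a' - a)).
    by apply: (jacL_filt_ge2 FQ chark p_gt2 _ Ga Gd); rewrite n1 leq_addr.
  have GdL : G (n + j)%N (d + jacL p a (a' - a)) by apply: WfiltD.
  exists (a', b + d + jacL p a (a' - a)); split; last by rewrite /= -[b + d + _]addrA addrAC subrr add0r.
  split=> //=.
    by rewrite -addrA; apply: WfiltD => //; apply: (wfilt_le A_quant idM _ GdL); apply: leq_addr.
  by have := ppowD FQ chark p_gt2 hb hd; rewrite addrC subrK.
have [|X hX] := @cfilt_lim (fun j => iota (u j).2).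
  move=> j; rewrite -rmorphB; apply: wfilt_iota.
  by apply: (wfilt_le A_quant idM _ (Qu j)); apply: leq_addl.
exists X.
  rewrite -[X](subrK (iota (u n).2)); apply: (filtD CF) => //.
  by apply: wfilt_iota; case: (Pu n).
apply: (@ppow_lim x X u) => // j; case: (Pu j) => // Fx _ _ _.
by apply: FW Fx; apply: leq_addl.
Qed.

Lemma cfilt_complete : complete_quantization p cfilt.
Proof.
have CF := cfilt_filtered.
split=> //; [|exact: cfilt_lim|exact: cfilt_sep|exact: cfilt_residue].
move=> [|[|n]] // x _ hx; last exact: cfilt_restricted_ge2.
(* In weight 1, x is split into the image of [a], whose restricted power comes from A, and a
   remainder of weight 2. *)
have [a Ga Fa] := cfilt_approx 2 hx.
have [b Gb hb] := wfilt_restricted chark p_gt2 A_quant A_wc idM resM (isT : (0 < 1)%N) Ga.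
have [X GX hX] := cfilt_restricted_ge2 (isT : (1 < 2)%N) (F_cfilt Fa).
have h := ppowD CF chark p_gt2 (iota_ppow hb) hX.
rewrite addrC subrK in h; exact: (ppow_filt1 cfilt_residue h).
Qed.

Lemma cfilt1_proper : ~ cfilt 1 1.
Proof.
move=> h; have /(wfilt_J rho idM) : G 1%N 1 by apply: iota_wfilt; rewrite rmorph1.
by rewrite /Jset /= rmorph1; case: (M_ideal idM) => _ /negP.
Qed.

Lemma cfilt_fin_gen : fin_gen_ker cfilt [::].
Proof.
have CF := cfilt_filtered.
exists (map iota zs); split.
  move=> i; split=> //; have [lt_i|ge_i] := ltnP i (size zs).
    by rewrite (nth_map 0) //; apply/wfilt_iota/WfiltJ.
  by rewrite nth_default ?size_map //; apply/F_cfilt/F0.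
move=> m _ hm.
pose st := (A * ((nat -> A) * A))%type.
(* Approximation modulo [F j.+1], since the next correction lies in J^(j+1) and its coefficients on
   the generators then lie in J^j. *)
pose P j (u : st) := F j.+1 (m - iota u.1) /\
  u.1 = \sum_(i < size zs) zs`_i * u.2.1 i + hbar *: u.2.2.
have gen := ideal_pow_gen A_quant idM gen_M.
have [||u [Pu Qu]] := @dependent_choice_seq st P
    (fun j u v => (forall i, G j (v.2.1 i - u.2.1 i)) /\ G j (v.2.2 - u.2.2)).
- have [a /(wfilt_J rho idM) Ja Fa] := cfilt_approx 1 hm.
  by have [c [r e]] := Jset_gen A_quant gen_M Ja; exists (a, (c, r)).
- move=> j [a [c r]] [/= Fa ea]; have [a' Fa'] := Fdense j.+2 m.
  have [|d [s [hd hs es]]] := gen j (a' - a).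
    by apply: (@F_iota_diff _ m) => //; apply: FW Fa'.
  exists (a', (fun i => c i + d i, r + s)); split; last first.
    split=> /= [i|]; rewrite addrAC subrr add0r.
      exact: (ideal_pow_wfilt idM).
    exact: (ideal_pow_wfilt idM).
  split=> //=; rewrite -[a'](subrK a) es ea addrC addrACA -big_split scalerDr.
  by congr (_ + _); apply: eq_bigr => i _; rewrite mulrDr.
have /choice[c hc] i : exists X, forall j, cfilt j (X - iota ((u j).2.1 i)).
  by apply: cfilt_lim => j; rewrite -rmorphB; apply: wfilt_iota; case: (Qu j).
have [|r hr] := @cfilt_lim (fun j => iota (u j).2.2).
  by move=> j; rewrite -rmorphB; apply: wfilt_iota; case: (Qu j).
exists c, r; split=> //; apply/eqP; rewrite -subr_eq0; apply/eqP/F_sep => n.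
apply: (@F_trans _ _ (iota (u (2 * n)%N).1)).
  by have [Fu _] := Pu (2 * n)%N; apply: FW Fu; lia.
have [_ ->] := Pu (2 * n)%N; rewrite size_map rmorphD rmorph_sum /= iotaZ /= opprD addrACA.
rewrite -scalerBr -sumrB; apply: FD; last by apply/FZ/F_sym/cfilt_F.
apply: big_ind => [|y z|i _]; [exact: F0 | exact: FD |].
by rewrite (nth_map 0) // rmorphM -mulrBr; apply/FMl/F_sym/cfilt_F.
Qed.

Lemma om_iota a b (s : k) : Jset rho M a -> Jset rho M b ->
  br (rho a) (rho b) - s%:A \in M -> om cfilt (iota a) (iota b) = s.
Proof.
move=> Ja Jb hs; have CF := cfilt_filtered.
apply: (om_eq cfilt_complete cfilt1_proper).
have [c _ ec] := filt_comm FQ (WfiltT rho M a) (WfiltT rho M b).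
have -> : dl (iota a) (iota b) = iota c.
  by apply: (dl_eq CF); rewrite /commutator -!rmorphM -rmorphB -iotaZ -ec.
rewrite -(rmorph1 iota) -iotaZ -rmorphB; apply/wfilt_iota/WfiltJ.
have [_ _ _ _ hbr] := A_quant; rewrite (hbr a b c ec) in hs.
by rewrite /Jset /= rmorphB (rhoZ A_quant) rmorph1.
Qed.

Lemma cfilt_symplectic N (e : 'I_N -> B) (s : 'M[k]_N) :
    (forall i, e i \in M) -> (forall i j, br (e i) (e j) - (s i j)%:A \in M) -> s \in unitmx ->
    (forall f, f \in M -> exists c : 'I_N -> k, forall g, g \in M ->
       br (f - \sum_i c i *: e i) g \in M) ->
  symplectic_rank cfilt N.
Proof.
move=> Me es sU rad; have CF := cfilt_filtered; have CQ := cfilt_complete.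
have /choice[e' he'] i := rho_surj A_quant (e i).
have Je i : Jset rho M (e' i) by rewrite /Jset /= he'.
exists (fun i => iota (e' i)); split.
- by move=> i; apply/wfilt_iota/WfiltJ.
- suff -> : \matrix_(i, j) om cfilt (iota (e' i)) (iota (e' j)) = s by [].
  by apply/matrixP => i j; rewrite !mxE; apply: om_iota => //; rewrite !he'.
move=> a ha; have [a' Ga' Fa'] := cfilt_approx 2 ha.
have [c hc] := rad (rho a') ((wfilt_J rho idM a').1 Ga'); exists c => b hb.
have [b' Gb' Fb'] := cfilt_approx 2 hb.
pose f := a' - \sum_i fpsC (c i) *: e' i.
have Gf : G 1%N f.
  apply: (wfiltB idM) => //; apply: (filt_sum FQ) => i _; apply: (filtZ FQ); exact: WfiltJ.
have Gif : cfilt 1 (iota f) := wfilt_iota Gf.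
rewrite -[a](subrK (iota a')) -addrA.
have -> : iota a' - \sum_i fpsC (c i) *: iota (e' i) = iota f.
  by rewrite rmorphB rmorph_sum; congr (_ - _); apply: eq_bigr => i _; rewrite /= iotaZ.
rewrite (omDl CQ cfilt1_proper) (om_filt2 CQ cfilt1_proper (F_cfilt Fa') hb) add0r.
rewrite -[b](subrK (iota b')) (omDr CQ cfilt1_proper) (omC CQ cfilt1_proper).
rewrite (om_filt2 CQ cfilt1_proper (F_cfilt Fb') Gif) oppr0 add0r.
apply: om_iota; [exact/(wfilt_J rho idM) | exact/(wfilt_J rho idM) |].
have -> : rho f = rho a' - \sum_i c i *: e i.
  rewrite rmorphB rmorph_sum; congr (_ - _); apply: eq_bigr => i _.
  by rewrite (rhoZ A_quant) he'.
by rewrite scale0r subr0; apply/hc/(wfilt_J rho idM).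
Qed.

End Completion.

(** * Points of finitely generated algebras *)

Section HilbertBasis.
Variable R : comNzRingType.

Lemma acc_mono (B : nzRingType) (I : nat -> set B) (m n : nat) :
  (forall i, I i `<=` I i.+1) -> (m <= n)%N -> I m `<=` I n.
Proof.
move=> IS; elim: n => [|n IHn]; first by rewrite leqn0 => /eqP->.
by rewrite leq_eqVlt => /predU1P[->//|/IHn h x /h/IS].
Qed.

(** The ideals [L n d] of leading coefficients increase in both indices. Stabilisation of the
    diagonal settles all degrees d from N0 on, and finitely many chains remain. *)
Lemma hilbert_basis : acc R -> acc {poly R}.
Proof.
move=> accR I idI IS.
have I0 n : I n 0 by case: (idI n).
have IB n f g : I n f -> I n g -> I n (f - g) by case: (idI n) => _ h _; apply: h.
have IM n f g : I n g -> I n (f * g) by case: (idI n) => _ _ h Ig; case: (h f g Ig).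
pose L n d : set R := [set c | exists f, [/\ I n f, (size f <= d.+1)%N & f`_d = c]].
have idL n d : two_sided_ideal (L n d).
  split; first by exists 0; rewrite size_poly0 coef0.
    move=> _ _ [f [If sf <-]] [g [Ig sg <-]]; exists (f - g).
    rewrite coefB; split=> //; first exact: IB.
    by rewrite (leq_trans (size_polyD _ _)) // size_polyN geq_max sf.
  move=> a _ [f [If sf <-]]; rewrite mulrC.
  have h : L n d (f`_d * a).
    exists (a%:P * f); split; [exact: IM | | by rewrite coefCM mulrC].
    by rewrite mul_polyC (leq_trans (size_scale_leq _ _)).
  by split=> //; rewrite mulrC.
have Ln n m d : (n <= m)%N -> L n d `<=` L m d.
  by move=> le c [f [If sf e]]; exists f; split=> //; apply: acc_mono le _ If.
have Ld n d d' : (d <= d')%N -> L n d `<=` L n d'.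
  apply: acc_mono => {}d c [f [If sf e]]; exists ('X * f); split; first exact: IM.
    by have [->|f0] := eqVneq f 0; rewrite ?mulr0 ?size_poly0 // mulrC size_mulX.
  by rewrite coefXM.
have [N0 hN0] : exists N, forall n, (N <= n)%N -> L n n `<=` L N N.
  apply: (accR (fun n => L n n)) => // n; apply: subset_trans (Ln n n.+1 n _) (Ld n.+1 n n.+1 _) => //.
have /choice[Nd hNd] d : exists N, forall n, (N <= n)%N -> L n d `<=` L N d.
  by apply: (accR (fun n => L n d)) => // n; apply: Ln.
pose N := (N0 + \sum_(d < N0) Nd d)%N; exists N => n le_Nn.
have LN d : L n d `<=` L N d.
  have [lt_d|ge_d] := ltnP d N0.
    have le : (Nd d <= N)%N.
      by rewrite /N (bigD1 (Ordinal lt_d)) //= addnCA leq_addr.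
    by apply: subset_trans (hNd d n (leq_trans le le_Nn)) (Ln _ _ _ le).
  have le0 : (N0 <= N)%N by apply: leq_addr.
  apply: subset_trans (Ln _ _ _ (leq_maxl n d)) _.
  apply: subset_trans (Ld _ _ _ (leq_maxr n d)) _.
  apply: subset_trans (hN0 _ _) _; first by rewrite leq_max ge_d orbT.
  exact: subset_trans (Ln _ _ _ le0) (Ld _ _ _ ge_d).
suff claim s : forall f : {poly R}, (size f <= s)%N -> I n f -> I N f.
  by move=> f If; apply: (claim (size f)).
elim: s => [|s IHs] f sf If; first by move: sf; rewrite leqn0 size_poly_eq0 => /eqP->.
have [g [Ig sg eg]] : L N s f`_s by apply: LN; exists f.
have INn : I N `<=` I n := acc_mono IS le_Nn.
have Ifg : I N (f - g).
  apply: IHs; last by apply: IB => //; apply: INn.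
  apply/leq_sizeP => j; rewrite leq_eqVlt coefB => /predU1P[<-|lt_sj]; first by rewrite eg subrr.
  by rewrite !nth_default ?subrr // (leq_trans sf, leq_trans sg).
have ID x y : I N x -> I N y -> I N (x + y).
  by move=> Ix Iy; rewrite -[y]opprK -[- y]sub0r; apply: (IB) => //; apply: (IB).
by rewrite -[f](subrK g); apply: ID.
Qed.

End HilbertBasis.

Lemma acc_surj (R S : comNzRingType) (f : {rmorphism R -> S}) :
  (forall b, exists r, f r = b) -> acc R -> acc S.
Proof.
move=> surj accR I idI IS.
have [|n x Ix|N hN] := accR (fun n => f @^-1` I n).
- move=> n; have [I0 IB IM] := idI n; split=> /=; first by rewrite rmorph0.
    by move=> a b Ia Ib; rewrite rmorphB; apply: IB.
  by move=> a b Ib; rewrite !rmorphM; apply: IM.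
- exact: IS.
exists N => n le_Nn b Ib; have [r e] := surj b; rewrite -e in Ib *; exact: (hN n le_Nn r).
Qed.

Lemma acc_field (k : fieldType) : acc k.
Proof.
move=> I idI IS.
have [[N [x [Ix /eqP x0]]]|none] := pselect (exists n x, I n x /\ x <> 0).
  exists N => n _ y _; have [_ _ IM] := idI N.
  by have [+ _] := IM (y / x) x Ix; rewrite mulfVK.
exists 0%N => n _ y Iy; have [->|/eqP y0] := eqVneq y 0; first by case: (idI 0%N).
by exfalso; apply: none; exists n, y.
Qed.

Definition prime_set (R : comNzRingType) (Q : set R) : Prop :=
  [/\ two_sided_ideal Q, ~ Q 1 & forall a b, Q (a * b) -> Q a \/ Q b].

(* Over k, the points of V(Q) are dense in V(Q). *)
Definition jacobson_over (k : fieldType) (R : comNzRingType) (i : {rmorphism k -> R}) : Prop :=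
  forall (Q : set R) (f : R), prime_set Q -> ~ Q f ->
    exists x : {rmorphism R -> k}, [/\ forall c, x (i c) = c, forall r, Q r -> x r = 0 & x f != 0].

Lemma coef_mul_top (R : nzRingType) (a b : {poly R}) :
  (a * b)`_((size a).-1 + (size b).-1) = lead_coef a * lead_coef b.
Proof.
have lt : ((size a).-1 < ((size a).-1 + (size b).-1).+1)%N by rewrite ltnS leq_addr.
rewrite coefM (bigD1 (Ordinal lt)) //= addKn big1 ?addr0 // => j /eqP nj.
case: (ltngtP j (size a).-1) => [lt_j|gt_j|e]; last by case: nj; apply: val_inj.
  rewrite [b`__]nth_default ?mulr0 //; move: lt_j; clear.
  move: (size a) (size b) (nat_of_ord j) => m l n; lia.
rewrite nth_default ?mul0r //; move: gt_j; clear.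
move: (size a) (nat_of_ord j) => m n; lia.
Qed.

(** * The Nullstellensatz, one variable at a time *)

Section Nullstellensatz.
Variables (k : closedFieldType) (R : comNzRingType) (i : {rmorphism k -> R}).
Hypothesis jac : jacobson_over i.

Section PrimeOfPoly.
Variables (Q : set {poly R}) (Qp : prime_set Q).

Definition base_prime : set R := [set a | Q a%:P].
(** The extension to the polynomial ring of the contraction of Q to R. *)
Definition base_ext : set {poly R} := [set h | forall j, base_prime h`_j].

Lemma QB a b : Q a -> Q b -> Q (a - b). Proof. by case: Qp => -[_ h _] _ _; apply: h. Qed.
Lemma QM a b : Q b -> Q (a * b). Proof. by case: Qp => -[_ _ h] _ _ Qb; case: (h a b Qb). Qed.
Lemma Q0 : Q 0. Proof. by case: Qp => -[]. Qed.
Lemma QD a b : Q a -> Q b -> Q (a + b).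
Proof. by move=> Qa Qb; rewrite -[b]opprK -[- b]sub0r; apply: QB => //; apply: QB => //; apply: Q0. Qed.

Lemma base_prime_prime : prime_set base_prime.
Proof.
split; first split.
- by rewrite /base_prime /= polyC0; apply: Q0.
- by move=> a b Qa Qb; rewrite /base_prime /= polyCB; apply: QB.
- by move=> a b Qb; rewrite /base_prime /= !polyCM [b%:P * _]mulrC; split; apply: QM.
- by case: Qp.
by move=> a b; rewrite /base_prime /= polyCM; case: Qp => _ _; apply.
Qed.

Lemma base_ext_sub h : base_ext h -> Q h.
Proof.
move=> hh; rewrite -[h]coefK poly_def; apply: big_ind => [|a b|j _]; [exact: Q0 | exact: QD |].
by rewrite -mul_polyC mulrC; apply/QM/hh.
Qed.

Lemma base_extB a b : base_ext a -> base_ext b -> base_ext (a - b).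
Proof. by move=> ha hb j; rewrite coefB /base_prime /= polyCB; apply: QB; [apply: ha|apply: hb]. Qed.

Lemma base_extM a b : base_ext a -> base_ext (b * a).
Proof.
move=> ha j; rewrite coefM /base_prime /= rmorph_sum /=.
apply: big_ind => [|x y|l _]; [exact: Q0 | exact: QD |].
by rewrite polyCM; apply/QM/ha.
Qed.

Lemma base_ext0 : base_ext 0.
Proof. by move=> j; rewrite coef0 /base_prime /= polyC0; apply: Q0. Qed.

Lemma base_extD a b : base_ext a -> base_ext b -> base_ext (a + b).
Proof.
move=> ha hb; rewrite -[b]opprK -[- b]sub0r.
by apply: base_extB => //; apply: base_extB => //; apply: base_ext0.
Qed.

(** Leading terms with coefficient in the contracted prime are removed one by one; [size g] then
    measures the degree of [h] over the quotient of R by this prime. *)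
Lemma strip_lead h : ~ base_ext h -> exists g,
  [/\ ~ base_prime (lead_coef g), base_ext (h - g) & (size g <= size h)%N].
Proof.
move: {2}(size h) (leqnn (size h)) => s; elim: s h => [|s IHs] h sh nh.
  exfalso; apply: nh; move: sh; rewrite leqn0 size_poly_eq0 => /eqP->; exact: base_ext0.
have h0 : h != 0 by apply/eqP => e; apply: nh; rewrite e; apply: base_ext0.
case: (pselect (base_prime (lead_coef h))) => [hl|nl]; last first.
  by exists h; split=> //; rewrite subrr; apply: base_ext0.
pose t := lead_coef h *: 'X^((size h).-1).
have ht : base_ext t.
  move=> j; rewrite coefZ coefXn /base_prime /= mulrC polyCM; exact: QM.
have st : (size t <= size h)%N.
  by rewrite (leq_trans (size_scale_leq _ _)) // size_polyXn prednK // size_poly_gt0.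
have [|nht|g [ng eg sg]] := IHs (h - t).
- apply/leq_sizeP => j le_sj; rewrite coefB coefZ coefXn.
  case: eqP => [->|/eqP nj]; first by rewrite mulr1 subrr.
  rewrite mulr0 subr0 nth_default //; move: h0 sh le_sj nj; rewrite -size_poly_gt0.
  by case: (size h) => //= m _; lia.
- by apply: nh; rewrite -[h](subrK t); apply: base_extD.
exists g; split=> //; first by rewrite -[h](subrK t) addrAC; apply: base_extD.
rewrite (leq_trans sg) // (leq_trans (size_polyD _ _)) // size_polyN geq_max leqnn /=.
exact: st.
Qed.

Lemma min_lead (I : set {poly R}) : (exists2 h, I h & ~ base_prime (lead_coef h)) ->
  exists h, [/\ I h, ~ base_prime (lead_coef h) &
    forall g, I g -> ~ base_prime (lead_coef g) -> (size h <= size g)%N].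
Proof.
move=> [h0 Ih0 nh0].
have ex : exists n, `[< exists h, [/\ I h, ~ base_prime (lead_coef h) & size h = n] >].
  by exists (size h0); apply/asboolP; exists h0.
case: (ex_minnP ex) => n /asboolP[h [Ih nh sh]] minn; exists h; split=> // g Ig ng.
by rewrite sh; apply: minn; apply/asboolP; exists g.
Qed.

Lemma base_ext_min (I : set {poly R}) (h r : {poly R}) : (forall a b, I a -> base_ext b -> I (a - b)) ->
    (forall g, I g -> ~ base_prime (lead_coef g) -> (size h <= size g)%N) ->
  I r -> (size r < size h)%N -> base_ext r.
Proof.
move=> IB hmin Ir lt_rh; case: (pselect (base_ext r)) => // /strip_lead[g [ng eg sg]].
have Ig : I g by rewrite -(subKr r g); apply: IB.
by have := leq_ltn_trans (hmin g Ig ng) (leq_ltn_trans sg lt_rh); rewrite ltnn.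
Qed.

Import Pdiv.Ring.

(** V(Q) is a full line over the variety of the contracted prime. A base point is taken where some
    coefficient of f does not vanish, then a value of the variable that is not a root of the
    specialised f. *)
Lemma jacobson_poly_transcendental f : (forall h, Q h -> base_ext h) -> ~ Q f ->
  exists x : {rmorphism {poly R} -> k},
    [/\ forall c, x (i c)%:P = c, forall r, Q r -> x r = 0 & x f != 0].
Proof.
move=> QQ nf.
have [j nj] : exists j, ~ base_prime f`_j.
  by apply/not_existsP => h; apply: nf; apply: base_ext_sub => j; apply: contrapT; apply: h.
have [x0 [x0i x0Q x0f]] := jac base_prime_prime nj.
have fx0 : map_poly x0 f != 0.
  by apply/eqP => /(congr1 (fun q : {poly k} => q`_j)) /eqP; rewrite coef_map coef0 (negPf x0f).
have /closed_nonrootP[c nc] := fx0.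
exists (horner_morph (fun r => mulrC c (x0 r))); split=> [a|r Qr|] /=.
- by rewrite horner_morphC x0i.
- rewrite /horner_morph; have -> : map_poly x0 r = 0; last by rewrite horner0.
  by apply/polyP => l; rewrite coef_map coef0 /= x0Q //; apply: QQ.
exact: nc.
Qed.

(** Let g have least degree in Q and h in Q + (f), degrees being taken modulo the contracted prime.
    Pseudo-division shows that h is a constant, so [lead_coef h] is f v modulo Q. At a base point
    where both leading coefficients survive, a root of g gives a character that kills Q, by
    pseudo-division by g, but not f. *)
Lemma jacobson_poly_algebraic f : (exists2 h, Q h & ~ base_ext h) -> ~ Q f ->
  exists x : {rmorphism {poly R} -> k},
    [/\ forall c, x (i c)%:P = c, forall r, Q r -> x r = 0 & x f != 0].
Proof.
move=> [g0 Qg0 ng0] nf.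
have QC a : Q a%:P -> base_prime a by [].
have Qprime a b : Q (a * b) -> Q a \/ Q b by case: Qp => _ _; apply.
have [g [Qg ng gmin]] : exists h, [/\ Q h, ~ base_prime (lead_coef h) &
    forall g, Q g -> ~ base_prime (lead_coef g) -> (size h <= size g)%N].
  have [g1 [ng1 eg1 _]] := strip_lead ng0; apply: min_lead; exists g1 => //.
  by rewrite -(subKr g0 g1); apply: QB => //; apply: base_ext_sub.
pose I : set {poly R} := [set u | exists q v, Q q /\ u = q + v * f].
have IB a b : I a -> I b -> I (a - b).
  move=> [q [v [Qq ->]]] [q' [v' [Qq' ->]]]; exists (q - q'), (v - v').
  by split; [apply: QB | rewrite mulrBl opprD addrACA].
have IM a b : I b -> I (a * b).
  move=> [q [v [Qq ->]]]; exists (a * q), (a * v).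
  by split; [apply: QM | rewrite mulrDr mulrA].
have IQ a : Q a -> I a by move=> Qa; exists a, 0; rewrite mul0r addr0.
have If : I f by exists 0, 1; rewrite mul1r add0r; split=> //; apply: Q0.
have [h [Ih nh hmin]] : exists h, [/\ I h, ~ base_prime (lead_coef h) &
    forall g, I g -> ~ base_prime (lead_coef g) -> (size h <= size g)%N].
  by apply: min_lead; exists g => //; apply: IQ.
have nz u : ~ base_prime (lead_coef u) -> u != 0.
  by move=> nu; apply/eqP => u0; apply: nu; rewrite u0 lead_coef0; have := base_ext0 0%N; rewrite coef0.
have leadX u e : ~ base_prime (lead_coef u) -> ~ Q (lead_coef u ^+ e)%:P.
  move=> nu; elim: e => [|e IHe]; first by rewrite expr0; case: Qp.
  by rewrite exprS polyCM => /Qprime[].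
have remI u : I u -> base_ext (rmodp u h).
  move=> Iu; apply: (@base_ext_min I h) => //; last by apply: ltn_rmodpN0; apply: nz.
    by move=> a b Ia /base_ext_sub/IQ; apply: IB.
  have -> : rmodp u h = (lead_coef h ^+ rscalp u h)%:P * u - rdivp u h * h.
    by rewrite mul_polyC Pdiv.ComRing.rdivp_eq addrC addKr.
  by apply: IB; apply: IM.
have remQ u : Q u -> base_ext (rmodp u g).
  move=> Qu; apply: (@base_ext_min Q g) => //; last by apply: ltn_rmodpN0; apply: nz.
    by move=> a b Qa /base_ext_sub; apply: QB.
  have -> : rmodp u g = (lead_coef g ^+ rscalp u g)%:P * u - rdivp u g * g.
    by rewrite mul_polyC Pdiv.ComRing.rdivp_eq addrC addKr.
  by apply: QB; apply: QM.
have nQh : ~ Q h.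
  move=> Qh; have : Q ((lead_coef h ^+ rscalp f h)%:P * f).
    rewrite mul_polyC Pdiv.ComRing.rdivp_eq; apply: QD; first exact: QM.
    exact/base_ext_sub/remI.
  by move=> /Qprime[/leadX|].
pose e := rscalp g h; pose q := rdivp g h; pose r := rmodp g h.
have egh : (lead_coef h ^+ e)%:P * g = q * h + r.
  by rewrite mul_polyC Pdiv.ComRing.rdivp_eq.
have hr : base_ext r by apply/remI/IQ.
have Qq : Q q.
  have /Qprime[] // : Q (q * h).
  rewrite -[q * h](addrK r) -egh; apply: QB; [exact: QM | exact: base_ext_sub].
have nq : ~ base_ext q.
  move=> hq; have := base_extD (base_extM h hq) hr; rewrite [h * q]mulrC -egh => /(_ (size g).-1).
  by rewrite coefCM /base_prime /= polyCM => /Qprime[/leadX|].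
have [q1 [nq1 eq1 sq1]] := strip_lead nq.
have Qq1 : Q q1 by rewrite -(subKr q q1); apply: QB => //; apply: base_ext_sub.
(* The quotient [q] lies in Q, so modulo the contracted prime its degree is at least that of [g];
   but [q * h] has the degree of a multiple of [g] by a constant. Hence [h] has degree 0. *)
have h1 : size h = 1%N.
  apply/eqP; rewrite eqn_leq size_poly_gt0 nz // andbT leqNgt; apply/negP => h2.
  have sgq := gmin q1 Qq1 nq1.
  have hext : base_ext ((lead_coef h ^+ e)%:P * g - q1 * h).
    have -> : (lead_coef h ^+ e)%:P * g - q1 * h = h * (q - q1) + r.
      by rewrite egh mulrBr ![h * _]mulrC addrAC.
    by apply: base_extD => //; apply: base_extM.
  have := hext ((size q1).-1 + (size h).-1)%N.
  rewrite /base_prime /= coefB coefCM nth_default ?mulr0 ?sub0r; last first.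
    have := nz _ nq1; rewrite -size_poly_gt0; move: sgq h2; clear.
    move: (size g) (size q1) (size h) => l m n; lia.
  rewrite coef_mul_top polyCN -sub0r => /(QB Q0); rewrite sub0r sub0r opprK polyCM.
  by move=> /Qprime[/nq1|/nh].
have [q0 [v [Qq0 ev]]] := Ih.
have hC : h = (lead_coef h)%:P.
  by rewrite {1}(size1_polyC (eq_leq h1)) lead_coefE h1.
have nab : ~ base_prime (lead_coef g * lead_coef h).
  by rewrite /base_prime /= polyCM => /Qprime[].
have [x0 [x0i x0Q x0ab]] := jac base_prime_prime nab.
have /negP x0a : ~ x0 (lead_coef g) == 0.
  by move=> /eqP z; move: x0ab; rewrite rmorphM z mul0r eqxx.
have /negP x0b : ~ x0 (lead_coef h) == 0.
  by move=> /eqP z; move: x0ab; rewrite rmorphM z mulr0 eqxx.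
(* [g] keeps its degree at [x0], and it is not constant, since a constant of Q would lie in the
   contracted prime. *)
have szg : size (map_poly x0 g) != 1%N.
  rewrite size_map_poly_id0 //; apply/eqP => g1; apply: ng; apply: QC.
  by have := Qg; rewrite {1}(size1_polyC (eq_leq g1)) lead_coefE g1.
have /closed_rootP[c rc] := szg.
have [x [xC xE]] : exists x : {rmorphism {poly R} -> k},
    (forall a, x a%:P = x0 a) /\ forall u, x u = (map_poly x0 u).[c].
  exists (horner_morph (fun r => mulrC c (x0 r))); split=> // a.
  by rewrite /= horner_morphC.
have xext u : base_ext u -> x u = 0.
  move=> hu; rewrite xE; have -> : map_poly x0 u = 0; last by rewrite horner0.
  by apply/polyP => l; rewrite coef_map coef0 /= x0Q.
have xg : x g = 0 by rewrite xE; apply/eqP.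
have xQ u : Q u -> x u = 0.
  move=> /remQ/xext xr; have := Pdiv.ComRing.rdivp_eq g u.
  rewrite -mul_polyC => /(congr1 x); rewrite rmorphM rmorphD rmorphM /= xr xg mulr0 addr0.
  by rewrite xC rmorphXn => /eqP; rewrite mulf_eq0 expf_eq0 (negPf x0a) andbF => /eqP.
exists x; split=> [a|//|]; first by rewrite xC x0i.
apply/eqP => xf; have := congr1 x ev; rewrite {1}hC xC rmorphD rmorphM /=.
by rewrite xf mulr0 addr0 xQ // => /eqP; rewrite (negPf x0b).
Qed.

End PrimeOfPoly.

Lemma jacobson_poly : jacobson_over (polyC \o i).
Proof.
move=> Q f Qp nf; case: (pselect (forall h, Q h -> base_ext Q h)) => [QQ|nQQ].
  exact: jacobson_poly_transcendental.
apply: jacobson_poly_algebraic => //.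
by have /existsNP[h /not_implyP[Qh nh]] := nQQ; exists h.
Qed.

End Nullstellensatz.

Section Points.
Variables (k : closedFieldType) (B : comAlgType k).
Hypothesis B_fg : finitely_generated_algebra B.

(** R is an iterated polynomial ring over k, with one variable for each generator of B. *)
Lemma finitely_generated_presentation :
  exists (R : comNzRingType) (i : {rmorphism k -> R}) (f : {rmorphism R -> B}),
    [/\ forall c, f (i c) = c%:A, forall b, exists r, f r = b, acc R & jacobson_over i].
Proof.
have [s hs] := B_fg.
suff [R [i [f [fi fs aR jR]]]] : exists (R : comNzRingType) (i : {rmorphism k -> R})
    (f : {rmorphism R -> B}), [/\ forall c, f (i c) = c%:A,
    forall b, b \in s -> exists r, f r = b, acc R & jacobson_over i].
  exists R, i, f; split=> // b; apply/asboolP.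
  apply: (hs [pred b | `[< exists r, f r = b >]]) => [|x /fs h]; last exact/asboolP.
  split; first by apply/asboolP; exists 1; rewrite rmorph1.
    move=> c u v /asboolP[r <-] /asboolP[r' <-]; apply/asboolP; exists (i c * r + r').
    by rewrite rmorphD rmorphM fi -scalerAl mul1r.
  by move=> u v /asboolP[r <-] /asboolP[r' <-]; apply/asboolP; exists (r * r'); rewrite rmorphM.
elim: s {hs} => [|x s [R [i [f [fi fs aR jR]]]]].
  exists k, idfun, (in_alg B); split=> //; first exact: acc_field.
  move=> Q r [[Q0 QB QM] Q1 _] nr; exists idfun; split=> // [a Qa|].
    apply/eqP/negPn/negP => a0; apply: Q1; have [h _] := QM a^-1 a Qa.
    by rewrite mulVf in h.
  by apply/eqP => r0; apply: nr; rewrite /= in r0; rewrite r0.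
pose fx : {rmorphism {poly R} -> B} := horner_morph (fun r => mulrC x (f r)).
exists {poly R}, (polyC \o i), fx; split.
- by move=> c; rewrite /fx /= horner_morphC fi.
- move=> b; rewrite inE => /predU1P[->|/fs[r <-]].
    by exists 'X; rewrite /fx /= horner_morphX.
  by exists r%:P; rewrite /fx /= horner_morphC.
- exact: hilbert_basis.
exact: jacobson_poly.
Qed.

Lemma fg_acc : acc B.
Proof.
by have [R [i [f [_ fs aR _]]]] := finitely_generated_presentation; apply: (acc_surj fs).
Qed.

Lemma spec_ext (P Q : spec B) : P =i Q -> P = Q.
Proof.
case: P Q => [P iP pP] [Q iQ pQ] /= e.
have {e} e : P = Q by apply/funext => b; apply: e.
case: _ / e iQ pQ => iQ pQ; congr Spec; exact: Prop_irrelevance.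
Qed.

Lemma spec_ideal (P : spec B) : two_sided_ideal [set` P].
Proof.
have [P0 P1 PM] := prime_of_ideal P.
have M a b : b \in prime_of P -> a * b \in prime_of P.
  by move=> Pb; rewrite -[_ * _]addr0 PM.
split=> //= a b; last by move=> Pb; rewrite [b * a]mulrC M.
by move=> Pa Pb; rewrite -mulN1r addrC PM.
Qed.

Lemma specB (P : spec B) a b : a \in prime_of P -> b \in prime_of P -> a - b \in prime_of P.
Proof. by case: (spec_ideal P) => _ h _; apply: h. Qed.

Lemma specM (P : spec B) a b : b \in prime_of P -> a * b \in prime_of P.
Proof. by case: (spec_ideal P) => _ _ h /h -/(_ a)[]. Qed.

Lemma spec0 (P : spec B) : 0 \in prime_of P.
Proof. by case: (spec_ideal P). Qed.

Lemma spec1 (P : spec B) : 1 \notin prime_of P.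
Proof. by case: (prime_of_ideal P). Qed.

Lemma specD (P : spec B) a b : a \in prime_of P -> b \in prime_of P -> a + b \in prime_of P.
Proof. by move=> Pa Pb; rewrite -[b]opprK -[- b]sub0r; apply: specB => //; apply: specB => //; apply: spec0. Qed.

Lemma specN (P : spec B) a : a \in prime_of P -> - a \in prime_of P.
Proof. by move=> Pa; rewrite -sub0r; apply: specB => //; apply: spec0. Qed.

Lemma specZ (P : spec B) (c : k) a : a \in prime_of P -> c *: a \in prime_of P.
Proof. by move=> Pa; rewrite -[a]mul1r scalerAl; apply: specM. Qed.

Definition char_at (P : spec B) (x : {rmorphism B -> k}) : Prop :=
  (forall c : k, x c%:A = c) /\ forall b, (b \in prime_of P) = (x b == 0).

Lemma char_scale P x (c : k) b : char_at P x -> x (c *: b) = c * x b.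
Proof. by case=> xc _; rewrite -[b in LHS]mul1r scalerAl rmorphM xc. Qed.

Lemma char_sub P x b : char_at P x -> b - (x b)%:A \in prime_of P.
Proof. by move=> [xc ->]; rewrite rmorphB xc subrr. Qed.

Lemma residue_char (P : spec B) : (forall b, exists c : k, b - c%:A \in prime_of P) ->
  exists x, char_at P x.
Proof.
move=> /choice[x hx].
have ux b (c : k) : b - c%:A \in prime_of P -> x b = c.
  move=> hc; apply/eqP; rewrite -subr_eq0; apply/negPn/negP => nz.
  have := specB hc (hx b); rewrite opprB addrC subrKA -scalerBl => /(specZ (x b - c)^-1).
  by rewrite scalerA mulVf // scale1r; apply/negP/spec1.
have xB : zmod_morphism x.
  move=> a b; apply: ux; rewrite scalerBl.
  by rewrite subrACA; apply: specB.
have xM : monoid_morphism x.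
  split; first by apply: ux; rewrite scale1r subrr; apply: spec0.
  move=> a b; apply: ux.
  have -> : a * b - (x a * x b)%:A = a * (b - (x b)%:A) + (x b)%:A * (a - (x a)%:A).
    rewrite !mulrBr -!scalerAl !mul1r -scalerAr mulr1 scalerA [x b * _]mulrC.
    by rewrite addrA subrK.
  by apply: specD; apply: specM.
pose X : {rmorphism B -> k} := HB.pack_for {rmorphism B -> k} x
  (GRing.isZmodMorphism.Build B k x xB) (GRing.isMonoidMorphism.Build B k x xM).
exists X; split; first by move=> c; apply: ux; rewrite subrr; apply: spec0.
move=> b; apply/idP/eqP => [Pb|xb]; first by apply: ux; rewrite scale0r subr0.
by have := hx b; rewrite [x b]xb scale0r subr0.
Qed.

Lemma char_max (P Q : spec B) x : char_at P x -> {subset P <= Q} -> Q = P.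
Proof.
move=> cx sPQ; apply: spec_ext => b; apply/idP/idP; last exact: sPQ.
move=> Qb; case: (cx) => xc ->; apply/negPn/negP => nz.
have := specB Qb (sPQ _ (char_sub b cx)); rewrite opprB addrCA subrr addr0.
move=> /(specZ (x b)^-1); rewrite scalerA mulVf // scale1r; exact/negP/spec1.
Qed.

Lemma nullstellensatz (P : spec B) f : f \notin prime_of P ->
  exists Q x, [/\ char_at Q x, {subset P <= Q} & f \notin prime_of Q].
Proof.
move=> nf; have [R [i [g [gi gs aR jR]]]] := finitely_generated_presentation.
have [rf erf] := gs f.
have prP : prime_set [set r | g r \in prime_of P].
  split; [split | by rewrite /= rmorph1; apply/negP/spec1 |].
  - by rewrite /= rmorph0; apply: spec0.
  - by move=> a b /= Pa Pb; rewrite rmorphB; apply: specB.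
  - by move=> a b /= Pb; rewrite !rmorphM [g b * _]mulrC; split; apply: specM.
  by move=> a b /=; rewrite rmorphM => /prime_of_prime/orP.
have [|x0 [x0i x0P x0f]] := jR _ rf prP; first by rewrite /= erf; apply/negP.
have x0g r r' : g r = g r' -> x0 r = x0 r'.
  move=> e; apply/eqP; rewrite -subr_eq0 -rmorphB; apply/eqP/x0P.
  by rewrite /= rmorphB e subrr; apply: spec0.
pose q : {pred B} := fun b => `[< exists r, g r = b /\ x0 r = 0 >].
have qE r : (g r \in q) = (x0 r == 0).
  apply/asboolP/eqP => [[r' [/x0g e e0]]|e]; first by rewrite -e e0.
  by exists r.
have iq : idealr_closed q.
  split; first by rewrite -(rmorph0 g) qE rmorph0.
    by rewrite -(rmorph1 g) qE rmorph1 oner_eq0.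
  move=> a u v; have [ra <-] := gs a; have [ru <-] := gs u; have [rv <-] := gs v.
  rewrite -rmorphM -rmorphD !qE rmorphD rmorphM => /eqP-> /eqP->.
  by rewrite mulr0 addr0.
have pq : prime_idealr_closed q.
  move=> u v; have [ru <-] := gs u; have [rv <-] := gs v.
  by rewrite -rmorphM !qE rmorphM mulf_eq0.
pose Q : spec B := Spec iq pq.
have [|x cx] := @residue_char Q.
  move=> b; have [r <-] := gs b; exists (x0 r).
  by rewrite -gi -rmorphB /= qE rmorphB x0i subrr.
exists Q, x; split=> //.
  by move=> b; have [r <-] := gs b => Pr; rewrite /= qE; apply/eqP/x0P.
by rewrite -erf /= qE.
Qed.

Lemma closed_point_max (P Q : spec B) : closed [set P] -> {subset P <= Q} -> Q = P.
Proof.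
move=> clP sPQ; have : open (~` [set P]) by rewrite openC.
move=> [S eS]; apply: contrapT => nQP.
have : (~` [set P]) Q by [].
rewrite eS => -[f Sf nf].
have : (~` [set P]) P; last by move=> /(_ erefl).
by rewrite eS; exists f => //; apply: contra nf; apply: sPQ.
Qed.

Lemma closed_point_char (P : spec B) : closed [set P] -> exists x, char_at P x.
Proof.
move=> clP; have [Q [x [cx sPQ _]]] := nullstellensatz (spec1 P).
by have <- := closed_point_max clP sPQ; exists x.
Qed.

Lemma char_closed_point (P : spec B) x : char_at P x -> closed [set P].
Proof.
move=> cx; rewrite -openC; exists [set` P]; apply/seteqP; split=> Q /=.
  move=> nQ; apply: contrapT => h; apply: nQ; apply: (char_max cx) => b Pb.
  by apply/negPn/negP => nb; apply: h; exists b.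
by move=> [f Pf nf] e; move: nf; rewrite e Pf.
Qed.

(** The Nullstellensatz is applied to [b * g], with [g] defining a basic neighbourhood of Q inside
    the open part of Y; the closed part is stable under specialisation. *)
Lemma locally_closed_point (Y : set (spec B)) (Q : spec B) b : locally_closed Y -> Y Q ->
  b \notin prime_of Q -> exists P x, [/\ char_at P x, Y P, {subset Q <= P} & b \notin prime_of P].
Proof.
move=> [U [F [[S eU] clF ->]]] [UQ FQ] nb.
move: UQ; rewrite eU => -[g Sg ng].
have [|P [x [cx sQP nbg]]] := @nullstellensatz Q (b * g).
  by apply/negP => /prime_of_prime/orP[]; apply/negP.
have nbP : b \notin prime_of P by apply: contra nbg => Pb; rewrite mulrC; apply: specM.
exists P, x; split=> //; split; first by exists g => //; apply: contra nbg; apply: specM.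
have : open (~` F) by rewrite openC.
move=> [S' eF]; apply: contrapT => nF.
have : (~` F) P by [].
rewrite eF => -[h Sh nh]; have : (~` F) Q; last by [].
by rewrite eF; exists h => //; apply: contra nh; apply: sQP.
Qed.

End Points.

(** * Cotangent spaces along a symplectic leaf *)

Section CotangentDimension.
Variables (k : closedFieldType) (B : comAlgType k).
Hypothesis B_fg : finitely_generated_algebra B.
Variables (br : B -> B -> B) (br_poisson : poisson_bracket br).
Variables (Y : set (spec B)).
Hypotheses (Y_lc : locally_closed Y) (Y_conn : connected Y).
Hypotheses (Y_poisson : poisson_ideal br (vanishing_ideal (closure Y))).
Hypotheses (Y_smooth : smooth_subvariety Y) (Y_sympl : symplectic_subvariety br Y).

Local Notation N P := (cotangent_kernel Y P).

Lemma brDr f g h : br f (g + h) = br f g + br f h.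
Proof.
by case: br_poisson => -[h1 _] _ _ _; have := h1 f 1 g h; rewrite !scale1r.
Qed.

Lemma brZr (c : k) f g : br f (c *: g) = c *: br f g.
Proof.
case: br_poisson => -[h1 _] _ _ _.
have b0 : br f 0 = 0 by have := h1 f (-1) 0 0; rewrite !scaleN1r !addNr.
by have := h1 f c g 0; rewrite addr0 b0 addr0.
Qed.

Lemma br_anti f g : br f g = - br g f.
Proof.
have [[h1 h2] h3 _ _] := br_poisson.
have := h3 (f + g); rewrite brDr.
have e a : br (f + g) a = br f a + br g a.
  by have := h2 a 1 f g; rewrite !scale1r.
by rewrite !e !h3 add0r addr0 addrC => /eqP; rewrite addr_eq0 => /eqP.
Qed.

Lemma brDl f g h : br (f + g) h = br f h + br g h.
Proof. by rewrite br_anti brDr opprD -!br_anti. Qed.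

Lemma brZl (c : k) f g : br (c *: f) g = c *: br f g.
Proof. by rewrite br_anti brZr -scalerN -br_anti. Qed.

Lemma brMr f g h : br f (g * h) = br f g * h + g * br f h.
Proof. by case: br_poisson. Qed.

Lemma br1r f : br f 1 = 0.
Proof.
have := brMr f 1 1; rewrite !mulr1 mul1r => /eqP.
by rewrite -subr_eq0 opprD addrA subrr sub0r oppr_eq0 => /eqP.
Qed.

Lemma br_suml (I : Type) (r : seq I) (F : I -> B) g :
  br (\sum_(i <- r) F i) g = \sum_(i <- r) br (F i) g.
Proof.
have b0 : br 0 g = 0 by have := brZl 0 0 g; rewrite !scale0r.
by apply: (big_morph (br^~ g)) => // a b; rewrite brDl.
Qed.

Lemma vanishing_sub P f : Y P -> vanishing_ideal (closure Y) f -> f \in prime_of P.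
Proof. by move=> YP Vf; exact: (Vf P (@subset_closure _ Y P YP)). Qed.

Lemma cotangent_ideal P : two_sided_ideal (N P).
Proof.
have [_ [V0 VB VM]] : True /\ two_sided_ideal (vanishing_ideal (closure Y)).
  by case: Y_poisson.
split.
- by exists 0; [exists [::]; rewrite big_nil | exists 0; rewrite ?addr0].
- move=> _ _ [f [s [hs ->]] [g Vg <-]] [f' [s' [hs' ->]] [g' Vg' <-]].
  exists (\sum_(u <- s ++ [seq (- u.1, u.2) | u <- s']) u.1 * u.2).
    exists (s ++ [seq (- u.1, u.2) | u <- s']); split=> // u.
    rewrite mem_cat => /orP[/hs//|/mapP[v /hs'[h1 h2] ->]] /=; split=> //.
    by rewrite -sub0r; apply: specB => //; apply: spec0.
  exists (g - g'); first exact: VB.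
  rewrite big_cat /= big_map opprD [RHS]addrACA; congr (_ + _); congr (_ + _).
  by rewrite -sumrN; apply: eq_bigr => u _; rewrite mulNr.
move=> a _ [f [s [hs ->]] [g Vg <-]]; rewrite [_ * a]mulrC.
suff h : N P (a * (\sum_(u <- s) u.1 * u.2 + g)) by [].
exists (\sum_(u <- [seq (a * u.1, u.2) | u <- s]) u.1 * u.2).
  exists [seq (a * u.1, u.2) | u <- s]; split=> // u /mapP[v /hs[h1 h2] ->] /=.
  by split=> //; apply: specM.
exists (a * g); first by case: (VM a g Vg).
by rewrite mulrDr mulr_sumr big_map; congr (_ + _); apply: eq_bigr => u _; rewrite mulrA.
Qed.

Lemma N0 P : N P 0. Proof. by case: (cotangent_ideal P). Qed.

Lemma NB P a b : N P a -> N P b -> N P (a - b).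
Proof. by case: (cotangent_ideal P) => _ h _; apply: h. Qed.

Lemma NM P a b : N P b -> N P (a * b).
Proof. by case: (cotangent_ideal P) => _ _ h /h -/(_ a)[]. Qed.

Lemma ND P a b : N P a -> N P b -> N P (a + b).
Proof. by move=> ha hb; rewrite -[b]opprK -[- b]sub0r; apply: NB => //; apply: NB => //; apply: N0. Qed.

Lemma NZ P (c : k) a : N P a -> N P (c *: a).
Proof. by move=> ha; rewrite -[a]mul1r scalerAl; apply: NM. Qed.

Lemma N_sum P (I : Type) (r : seq I) (F : I -> B) :
  (forall i, N P (F i)) -> N P (\sum_(i <- r) F i).
Proof. by move=> h; apply: big_ind => //; [apply: N0 | move=> *; apply: ND]. Qed.

Lemma N_mul P a b : a \in prime_of P -> b \in prime_of P -> N P (a * b).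
Proof.
move=> Pa Pb; exists (a * b); last first.
  by exists 0; rewrite ?addr0 //; case: Y_poisson => -[].
by exists [:: (a, b)]; rewrite big_seq1; split=> // u; rewrite inE => /eqP->.
Qed.

Lemma N_vanishing P g : vanishing_ideal (closure Y) g -> N P g.
Proof.
by move=> Vg; exists 0; [exists [::]; rewrite big_nil | exists g; rewrite ?add0r].
Qed.

Lemma br_N P f g : Y P -> N P f -> g \in prime_of P -> br f g \in prime_of P.
Proof.
move=> YP [_ [s [hs ->]] [h Vh <-]] Pg; rewrite brDl; apply: specD; last first.
  rewrite br_anti; apply: specN.
  by apply: vanishing_sub => //; case: Y_poisson => _; apply.
rewrite br_suml big_seq; apply: (big_ind (fun x => x \in prime_of P)) => [|a b|u us]; [exact: spec0 | exact: specD |].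
have [h1 h2] := hs u us; rewrite br_anti brMr; apply: specN.
by apply: specD; [apply: specM | rewrite mulrC; apply: specM].
Qed.

Definition cotangent_dim (P : spec B) d : Prop := exists e : 'I_d -> B,
  (forall i, e i \in prime_of P) /\
  (forall f, f \in prime_of P -> exists! c : {ffun 'I_d -> k}, N P (f - \sum_i c i *: e i)).

(** A vector in the kernel of the Gram matrix gives an f whose brackets with the maximal ideal
    vanish at P; nondegeneracy puts f in the cotangent kernel, and its coordinates are 0. *)
Lemma gram_unit P x d (e : 'I_d -> B) : char_at P x -> Y P ->
    (forall i, e i \in prime_of P) ->
    (forall f, f \in prime_of P -> exists! c : {ffun 'I_d -> k}, N P (f - \sum_i c i *: e i)) ->
  \matrix_(i, j) x (br (e i) (e j)) \in unitmx.
Proof.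
move=> cx YP Pe coor; rewrite -row_free_unit -kermx_eq0; apply/rowV0P => v /sub_kermxP v0.
pose f := \sum_i v 0 i *: e i.
have Pf : f \in prime_of P.
  by apply: (big_ind (fun x => x \in prime_of P)) => [|a b|i _]; [exact: spec0 | exact: specD | exact: specZ].
have Nf : N P f.
  apply: (Y_sympl YP (char_closed_point cx) Pf) => g Pg.
  have [c [hc _]] := coor g Pg; rewrite -[g](subrK (\sum_i c i *: e i)) brDr.
  apply: specD.
    by rewrite br_anti; apply/specN/br_N.
  case: (cx) => _ ->; rewrite br_anti br_suml rmorphN rmorph_sum oppr_eq0 big1 // => j _ /=.
  rewrite brZl (char_scale _ _ cx) br_anti br_suml rmorphN rmorph_sum /=.
  have /rowP/(_ j) := v0; rewrite !mxE => e0.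
  rewrite (eq_bigr (fun i => v 0 i * (\matrix_(i, j) x (br (e i) (e j))) i j)).
    by rewrite e0 oppr0 mulr0.
  by move=> i _; rewrite mxE brZl (char_scale _ _ cx).
have [c [_ uc]] := coor f Pf.
have e1 : c = [ffun i => v 0 i].
  apply: uc; rewrite [X in f - X](_ : _ = f) ?subrr; first exact: N0.
  by apply: eq_bigr => i _; rewrite ffunE.
have e2 : c = [ffun=> 0].
  apply: uc; rewrite big1 ?subr0 // => i _; by rewrite ffunE scale0r.
by apply/rowP => i; have := congr1 (fun c : {ffun 'I_d -> k} => c i) e1; rewrite e2 !ffunE mxE.
Qed.

(* The functions [be j] are the partial derivatives of b with respect to zs. *)
Definition partials (zs : seq B) (b : B) (be : 'I_(size zs) -> B) : Prop :=
  forall P x, char_at P x ->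
    N P (b - (x b)%:A - \sum_j x (be j) *: (zs`_j - (x zs`_j)%:A)).

Lemma leibniz_shift (a b : k) (u v S T : B) :
  u * v - (a * b)%:A - (b *: S + a *: T) =
  (u - a%:A) * (v - b%:A) + (b *: (u - a%:A - S) + a *: (v - b%:A - T)).
Proof.
have := subrK a%:A u; have := subrK b%:A v.
move: (u - a%:A) (v - b%:A) => U V <- <-.
rewrite !scalerBr addrACA -opprD addrA; congr (_ - _).
rewrite mulrDl !mulrDr -!scalerAl -!scalerAr !mul1r !mulr1 !scalerA !addrA addrK.
by [].
Qed.

Section Partials.
Variable zs : seq B.
Local Notation dz x j := (zs`_j - (x zs`_j)%:A).

Lemma partialsM u v bu bv : @partials zs u bu -> @partials zs v bv ->
  @partials zs (u * v) (fun j => v * bu j + u * bv j).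
Proof.
move=> hu hv P x cx; have [xc _] := cx.
rewrite (eq_bigr (fun j => x v *: (x (bu j) *: dz x j) + x u *: (x (bv j) *: dz x j))).
  rewrite big_split -!scaler_sumr rmorphM leibniz_shift; apply: ND.
    by apply: N_mul; apply: char_sub.
  by apply: ND; apply: NZ; [apply: hu | apply: hv].
by move=> j _; rewrite rmorphD !rmorphM scalerDl !scalerA.
Qed.

Lemma partialsD (c : k) u v bu bv : @partials zs u bu -> @partials zs v bv ->
  @partials zs (c *: u + v) (fun j => c *: bu j + bv j).
Proof.
move=> hu hv P x cx; have [xc _] := cx.
rewrite (eq_bigr (fun j => c *: (x (bu j) *: dz x j) + x (bv j) *: dz x j)).
  rewrite big_split -scaler_sumr rmorphD (char_scale _ _ cx) scalerDl -scalerA /=.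
  rewrite opprD addrACA -scalerBr opprD addrACA -scalerBr.
  by apply: ND; [apply: NZ; apply: hu | apply: hv].
by move=> j _; rewrite rmorphD (char_scale _ _ cx) scalerDl scalerA.
Qed.

Lemma partials0 : @partials zs 0 (fun=> 0).
Proof.
move=> P x cx; rewrite rmorph0 scale0r subrr big1 ?subrr => [|j _]; first exact: N0.
by rewrite scale0r.
Qed.

Lemma partials_sum (pa : B -> 'I_(size zs) -> B) (s : seq (B * B)) :
    (forall b, @partials zs b (pa b)) ->
  @partials zs (\sum_(u <- s) u.1 * u.2)
    (fun j => \sum_(u <- s) (u.2 * pa u.1 j + u.1 * pa u.2 j)).
Proof.
move=> hpa; elim: s => [|u s IHs].
  rewrite big_nil; have -> : (fun j => \sum_(u <- [::]) (u.2 * pa u.1 j + u.1 * pa u.2 j)) = fun=> 0.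
    by apply/funext => j; rewrite big_nil.
  exact: partials0.
have := partialsD 1 (partialsM (hpa u.1) (hpa u.2)) IHs; rewrite scale1r big_cons.
by congr partials; apply/funext => j; rewrite big_cons scale1r.
Qed.

End Partials.

(** The elements with partial derivatives form a subalgebra containing the generators. The
    derivatives are functions, chosen once for all points, so that conditions at P spread to a
    neighbourhood. *)
Lemma partials_exist : exists (zs : seq B) (pa : B -> 'I_(size zs) -> B),
  forall b, partials b (pa b).
Proof.
have [zs gen] := B_fg; exists zs.
suff /choice[pa hpa] : forall b, exists be, @partials zs b be by exists pa.
move=> b; apply/asboolP.
apply: (gen [pred b | `[< exists be, @partials zs b be >]]) => [|z zz]; last first.
  apply/asboolP; have lt_z : (index z zs < size zs)%N by rewrite index_mem.
  exists (fun j => (j == Ordinal lt_z)%:R) => P x cx.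
  rewrite (bigD1 (Ordinal lt_z)) //= eqxx rmorph1 scale1r nth_index // big1 ?addr0 ?subrr.
    exact: N0.
  by move=> j /negPf->; rewrite mulr0n rmorph0 scale0r.
split.
- apply/asboolP; exists (fun=> 0) => P x cx.
  rewrite big1 => [|j _]; last by rewrite /= rmorph0 scale0r.
  by rewrite rmorph1 scale1r subrr subr0; apply: N0.
- move=> c u v /asboolP[bu hu] /asboolP[bv hv]; apply/asboolP.
  by exists (fun j => c *: bu j + bv j); apply: partialsD.
move=> u v /asboolP[bu hu] /asboolP[bv hv]; apply/asboolP.
by exists (fun j => v * bu j + u * bv j); apply: partialsM.
Qed.

(** A spanning family of d elements gives d' <= d. The Gram matrix has rank d and factors through a
    basis of d' elements, which gives d <= d'. *)
Lemma cotangent_dim_eq P x d (e : 'I_d -> B) d' : char_at P x -> Y P ->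
    (forall i, e i \in prime_of P) ->
    (forall f, f \in prime_of P -> exists a : 'I_d -> k, N P (f - \sum_i a i *: e i)) ->
    \matrix_(i, j) x (br (e i) (e j)) \in unitmx ->
  cotangent_dim P d' -> d' = d.
Proof.
move=> cx YP Pe span gU [e' [Pe' coor]].
have /choice[A hA] j := span _ (Pe' j).
have /choice[C hC] i : exists c : {ffun 'I_d' -> k}, N P (e i - \sum_l c l *: e' l).
  by have [c [hc _]] := coor _ (Pe i); exists c.
pose Am := \matrix_(j < d', i < d) A j i; pose Cm := \matrix_(i < d, l < d') C i l.
have AC : Am *m Cm = 1%:M.
  apply/matrixP => j l; have [c [_ uc]] := coor _ (Pe' j).
  have e1 : c = [ffun l => (j == l)%:R].
    apply: uc; rewrite (bigD1 j) //= ffunE eqxx scale1r big1 ?addr0 ?subrr; first exact: N0.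
    by move=> i ij; rewrite ffunE eq_sym (negPf ij) scale0r.
  have e2 : c = [ffun l => (Am *m Cm) j l].
    apply: uc.
    have -> : e' j - \sum_l [ffun l => (Am *m Cm) j l] l *: e' l =
        (e' j - \sum_i A j i *: e i) + \sum_i A j i *: (e i - \sum_l C i l *: e' l).
      rewrite [X in _ = _ + X](eq_bigr (fun i => A j i *: e i - \sum_l (A j i * C i l) *: e' l)).
        rewrite sumrB addrA subrK exchange_big; congr (_ - _); apply: eq_bigr => m _.
        by rewrite ffunE mxE scaler_suml; apply: eq_bigr => i _; rewrite !mxE.
      by move=> i _; rewrite scalerBr scaler_sumr; congr (_ - _); apply: eq_bigr => m _; rewrite scalerA.
    by apply: ND => //; apply: N_sum => i; apply: NZ.
  by have := congr1 (fun c : {ffun 'I_d' -> k} => c l) e1; rewrite e2 !ffunE => ->; rewrite [RHS]mxE.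
apply/eqP; rewrite eqn_leq; apply/andP; split.
  by rewrite -(mxrank1 k d') -AC (leq_trans (mxrankM_maxl _ _)) // rank_leq_col.
pose G' := \matrix_(l < d', j < d) x (br (e' l) (e j)).
have eG : \matrix_(i, j) x (br (e i) (e j)) = Cm *m G'.
  apply/matrixP => i j; rewrite !mxE.
  rewrite -[e i in LHS](subrK (\sum_l C i l *: e' l)) brDl rmorphD.
  have -> : x (br (e i - \sum_l C i l *: e' l) (e j)) = 0.
    by apply/eqP; case: (cx) => _ <-; apply: br_N.
  rewrite add0r br_suml rmorph_sum; apply: eq_bigr => l _.
  by rewrite !mxE brZl (char_scale _ _ cx).
by rewrite -(mxrank_unit gU) eG (leq_trans (mxrankM_maxl _ _)) // rank_leq_col.
Qed.

Lemma br_const f (c : k) : br f c%:A = 0.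
Proof. by rewrite brZr br1r scaler0. Qed.

Lemma br_shift f g (a b : k) : br (f - a%:A) (g - b%:A) = br f g.
Proof.
have brBr u v w : br u (v - w) = br u v - br u w.
  by rewrite brDr -scaleN1r brZr scaleN1r.
by rewrite brBr br_const subr0 br_anti brBr br_const subr0 -br_anti.
Qed.

(* The rank of the bracket is lower semicontinuous and, by the Jacobian criterion,
   the dimension of the cotangent space is upper semicontinuous. *)
Lemma cotangent_dim_locally_constant P x d : char_at P x -> Y P -> cotangent_dim P d ->
  exists2 b, b \notin prime_of P &
    forall Q xq d', char_at Q xq -> Y Q -> b \notin prime_of Q -> cotangent_dim Q d' -> d' = d.
Proof.
move=> cx YP [e [Pe coor]]; have [zs [pa hpa]] := partials_exist.
set m := size zs in pa hpa.
have /choice[c hc] (j : 'I_m) : exists c : {ffun 'I_d -> k},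
    N P (zs`_j - (x zs`_j)%:A - \sum_i c i *: e i).
  by have [c [hc _]] := coor _ (char_sub zs`_j cx); exists c.
have /choice[sh hsh] (j : 'I_m) : exists sh : seq (B * B) * B,
    [/\ forall u, u \in sh.1 -> u.1 \in prime_of P /\ u.2 \in prime_of P,
     vanishing_ideal (closure Y) sh.2 &
     zs`_j - (x zs`_j)%:A - \sum_i c j i *: e i = \sum_(u <- sh.1) u.1 * u.2 + sh.2].
  by have [_ [s [hs ->]] [h Vh <-]] := hc j; exists (s, h).
(* The partial derivatives of the quadratic part of the expansion of z_j at P; by the Leibniz rule
   they vanish at P. *)
pose ga (j l : 'I_m) := \sum_(u <- (sh j).1) (u.2 * pa u.1 l + u.1 * pa u.2 l).
have xga j l : x (ga j l) = 0.
  have [hs _ _] := hsh j; rewrite /ga rmorph_sum big_seq big1 // => u /hs[h1 h2] /=.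
  rewrite rmorphD !rmorphM; move: h1 h2; case: (cx) => _ h; rewrite !h => /eqP-> /eqP->.
  by rewrite !mul0r addr0.
pose Ga := \matrix_(j, l) ((j == l)%:R - ga j l).
pose Gm := \matrix_(i, j) br (e i) (e j).
(* Where [\det Ga] is nonzero, the relations [key] below can be solved for the differentials of the
   generators, so the translated [e i] span; where [\det Gm] is nonzero, they are independent. At P,
   [Ga] is the identity and [Gm] the Gram matrix. *)
exists (\det Ga * \det Gm).
  case: (cx) => _ ->; rewrite rmorphM -!det_map_mx mulf_neq0 //.
    have -> : map_mx x Ga = 1%:M; last by rewrite det1 oner_neq0.
    by apply/matrixP => j l; rewrite !mxE rmorphB xga subr0 rmorph_nat.
  have := gram_unit cx YP Pe coor; rewrite unitmxE unitfE.
  suff -> : map_mx x Gm = \matrix_(i, j) x (br (e i) (e j)) by [].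
  by apply/matrixP => i j; rewrite !mxE.
move=> Q y d' cy YQ; case: (cy) => yc ->.
rewrite rmorphM -!det_map_mx mulf_eq0 negb_or => /andP[uGa uGm].
pose ep i := e i - (y (e i))%:A; pose ze (j : 'I_m) := zs`_j - (y zs`_j)%:A.
pose X := map_mx y Ga.
have key j : N Q (\sum_l X j l *: ze l - \sum_i c j i *: ep i).
  have [_ Vh eq] := hsh j; pose q := \sum_(u <- (sh j).1) u.1 * u.2; rewrite -/q in eq.
  have yh : y (sh j).2 = 0.
    by apply/eqP; case: (cy) => _ <-; apply: vanishing_sub.
  have pq := partials_sum (sh j).1 hpa cy; rewrite -/q in pq.
  have eX : \sum_l X j l *: ze l = ze j - \sum_l y (ga j l) *: ze l.
    rewrite (eq_bigr (fun l => (j == l)%:R *: ze l - y (ga j l) *: ze l)).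
      rewrite sumrB (bigD1 j) //= eqxx scale1r big1 ?addr0 // => l lj.
      by rewrite eq_sym (negPf lj) scale0r.
    by move=> l _; rewrite !mxE rmorphB rmorph_nat scalerBl.
  have eD : ze j - \sum_i c j i *: ep i = (q - (y q)%:A) + (sh j).2.
    transitivity ((q + (sh j).2) - (y (q + (sh j).2))%:A); last first.
      by rewrite rmorphD yh addr0 addrAC.
    rewrite -eq !rmorphB yc rmorph_sum /= /ze /ep.
    rewrite (eq_bigr (fun i => c j i *: e i - (y (c j i *: e i))%:A)) => [|i _]; last first.
      by rewrite scalerBr (char_scale _ _ cy) scalerA.
    rewrite sumrB -scaler_suml subrACA -scalerBl.
    rewrite [zs`_j - _ - _ in RHS]addrAC [y zs`_j - _ - _ in RHS]addrAC.
    by rewrite [(_ - x zs`_j)%:A]scalerBl subrACA subrr subr0.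
  have -> : \sum_l X j l *: ze l - \sum_i c j i *: ep i =
      (q - (y q)%:A - \sum_l y (ga j l) *: ze l) + (sh j).2.
    by rewrite eX addrAC eD addrAC.
  by apply: ND => //; apply: N_vanishing.
have XU : X \in unitmx by rewrite unitmxE unitfE.
have zspan l : exists a : 'I_d -> k, N Q (ze l - \sum_i a i *: ep i).
  exists (fun i => \sum_j invmx X l j * c j i).
  have -> : ze l - \sum_i (\sum_j invmx X l j * c j i) *: ep i =
      \sum_j invmx X l j *: (\sum_l' X j l' *: ze l' - \sum_i c j i *: ep i).
    rewrite [RHS](eq_bigr (fun j => (\sum_l' (invmx X l j * X j l') *: ze l') -
        \sum_i (invmx X l j * c j i) *: ep i)); last first.
      by move=> j _; rewrite scalerBr !scaler_sumr; congr (_ - _); apply: eq_bigr => i _; rewrite scalerA.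
    rewrite sumrB; congr (_ - _); rewrite exchange_big /=; last first.
      by apply: eq_bigr => i _; rewrite scaler_suml.
    rewrite (eq_bigr (fun l' => (l == l')%:R *: ze l')).
      by rewrite (bigD1 l) //= eqxx scale1r big1 ?addr0 // => i il; rewrite eq_sym (negPf il) scale0r.
    move=> l' _; rewrite -scaler_suml; congr (_ *: _).
    by have := mulVmx XU => /matrixP/(_ l l'); rewrite !mxE.
  by apply: N_sum => j; apply: NZ.
have /choice[a ha] := zspan.
apply: (@cotangent_dim_eq Q y d ep d' cy YQ).
- by move=> i; apply: char_sub.
- move=> f Qf; exists (fun i => \sum_l y (pa f l) * a l i).
  have yf : y f = 0 by apply/eqP; case: (cy) => _ <-.
  have := hpa f Q y cy; rewrite yf scale0r subr0 => h1.
  have -> : f - \sum_i (\sum_l y (pa f l) * a l i) *: ep i =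
      (f - \sum_l y (pa f l) *: ze l) + \sum_l y (pa f l) *: (ze l - \sum_i a l i *: ep i).
    rewrite [X in _ = _ + X](eq_bigr (fun l => y (pa f l) *: ze l - \sum_i (y (pa f l) * a l i) *: ep i)).
      rewrite sumrB addrA subrK exchange_big; congr (_ - _); apply: eq_bigr => i _.
      by rewrite scaler_suml.
    by move=> l _; rewrite scalerBr scaler_sumr; congr (_ - _); apply: eq_bigr => i _; rewrite scalerA.
  by apply: ND => //; apply: N_sum => l; apply: NZ.
suff -> : \matrix_(i, j) y (br (ep i) (ep j)) = map_mx y Gm by rewrite unitmxE unitfE.
by apply/matrixP => i j; rewrite !mxE br_shift.
Qed.

Lemma smooth_cotangent_dim P : Y P -> closed [set P] ->
  exists2 d, local_dim Y P d & cotangent_dim P d.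
Proof. by move=> YP clP; have [d [h [e he]]] := Y_smooth YP clP; exists d => //; exists e. Qed.

(** A chain of length d ends in a closed point, where the local dimension and, by smoothness, the
    cotangent dimension are d. The value reaches y by connectedness: the loci of Y where the
    cotangent dimension is d and where it is not are both open. *)
Lemma cotangent_dim_leaf d y : krull_dim Y d -> Y y -> closed [set y] -> cotangent_dim y d.
Proof.
move=> [[c [cY cS]] maxd] Yy cly.
have [M [xM [cM YM sM _]]] := locally_closed_point B_fg Y_lc (cY d (leqnn d)) (spec1 (c d)).
have clM := char_closed_point cM.
(* Otherwise M would prolong a chain of maximal length. *)
have eM : c d = M.
  apply: contrapT => ne; pose c' i := if (i <= d)%N then c i else M.
  have : (d.+1 <= d)%N; last by rewrite ltnn.
  apply: (maxd _ c'); split=> i; first by rewrite /c'; case: ifP => // /cY.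
  rewrite ltnS leq_eqVlt /c' => /predU1P[->|lt_i]; last by rewrite (ltnW lt_i) lt_i; apply: cS.
  rewrite leqnn ltnn; split=> // sc; apply: ne; apply: spec_ext => b.
  by apply/idP/idP; [apply: sM | apply: sc].
have [d1 [[c1 hc1 _] maxl] dimM] := smooth_cotangent_dim YM clM.
have e1 : d1 = d.
  apply/eqP; rewrite eqn_leq (maxd _ _ hc1) /=; exact: (maxl d c).
rewrite e1 in dimM; clear maxl hc1 e1 c1 d1.
have [dy _ dimy] := smooth_cotangent_dim Yy cly.
have [xy cy] := closed_point_char B_fg cly.
(* The boolean r sorts the functions b of [cotangent_dim_locally_constant] by whether the dimension
   on their nonvanishing locus is d. *)
pose good (b : B) r := exists P x d', [/\ char_at P x, Y P, cotangent_dim P d', (d' == d) = r &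
  forall Q xq d'', char_at Q xq -> Y Q -> b \notin prime_of Q -> cotangent_dim Q d'' -> d'' = d'].
pose O r : set (spec B) := [set Q | exists2 b, good b r & b \notin prime_of Q].
have Oopen r : open (O r) by exists [set b | good b r].
have cover P x d' : char_at P x -> Y P -> cotangent_dim P d' -> O (d' == d) P.
  move=> cx YP dP; have [b nb hb] := cotangent_dim_locally_constant cx YP dP.
  by exists b => //; exists P, x, d'.
have coverY Q : Y Q -> O true Q \/ O false Q.
  move=> YQ; have [P [x [cP YP sP _]]] := locally_closed_point B_fg Y_lc YQ (spec1 Q).
  have [d' _ dP] := smooth_cotangent_dim YP (char_closed_point cP).
  have := cover P x d' cP YP dP; case: (d' == d) => -[b gb nb]; [left|right];
  by exists b => //; apply: contra nb; apply: sP.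
(* A point in both sets specialises to a closed point of Y in both, where the cotangent dimension
   would have two values. *)
have disj Q : Y Q -> O true Q -> O false Q -> False.
  move=> YQ [b [P [x [d1 [_ _ _ /eqP e1 h1]]]] nb] [b' [P' [x' [d2 [_ _ _ e2 h2]]]] nb'].
  have nbb : b * b' \notin prime_of Q.
    by apply/negP => /prime_of_prime/orP[]; apply/negP.
  have [P0 [x0 [c0 Y0 _ n0]]] := locally_closed_point B_fg Y_lc YQ nbb.
  have [d0 _ dim0] := smooth_cotangent_dim Y0 (char_closed_point c0).
  have nb0 : b \notin prime_of P0 by apply: contra n0; rewrite mulrC; apply: specM.
  have nb0' : b' \notin prime_of P0 by apply: contra n0; apply: specM.
  by move: e2; rewrite -(h2 _ _ _ c0 Y0 nb0' dim0) (h1 _ _ _ c0 Y0 nb0 dim0) e1 eqxx.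
have YE : Y `&` O true = Y.
  apply: Y_conn.
  - by exists M; split=> //; have := cover M xM d cM YM dimM; rewrite eqxx.
  - by exists (O true).
  exists (~` O false); first by rewrite closedC.
  apply/seteqP; split=> Q [YQ h]; split=> //; first by move=> /(disj Q YQ h).
  by case: (coverY Q YQ).
have [_ [b [P [x [d' [_ _ _ /eqP ed' h]]]] nb]] : (Y `&` O true) y by rewrite YE.
by rewrite -ed' -(h y xy dy cy Yy nb dimy).
Qed.

Lemma symplectic_data d y : krull_dim Y d -> Y y -> closed [set y] ->
  exists (e : 'I_d -> B) (s : 'M[k]_d),
    [/\ forall i, e i \in prime_of y, forall i j, br (e i) (e j) - (s i j)%:A \in prime_of y,
        s \in unitmx & forall f, f \in prime_of y -> exists c : 'I_d -> k,
          forall g, g \in prime_of y -> br (f - \sum_i c i *: e i) g \in prime_of y].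
Proof.
move=> dY Yy cly; have [e [ye coor]] := cotangent_dim_leaf dY Yy cly.
have [x cx] := closed_point_char B_fg cly.
exists e, (\matrix_(i, j) x (br (e i) (e j))); split=> //.
- by move=> i j; rewrite mxE; apply: char_sub.
- exact: (gram_unit cx Yy ye coor).
move=> f yf; have [c [hc _]] := coor f yf; exists c => g yg.
exact: br_N.
Qed.

End CotangentDimension.

(** * The Weyl algebra and tensor decomposition *)

Section Subalgebra.
Variables (K : comNzRingType) (A : algType K).

Record subalg (P : {pred A}) (cP : GRing.subsemialg_closed P) :=
  Subalg { subalg_val : A; _ : P subalg_val }.

Section Instances.
Variables (P : {pred A}) (cP : GRing.subsemialg_closed P).
HB.instance Definition _ := [isSub for @subalg_val P cP].
HB.instance Definition _ := [Choice of subalg cP by <:].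
HB.instance Definition _ :=
  GRing.SubChoice_isSubAlgebra.Build K A P (subalg cP) cP.

Definition subalg_incl : subalg cP -> A := val.
HB.instance Definition _ := GRing.RMorphism.on subalg_incl.
HB.instance Definition _ := GRing.Linear.on subalg_incl.
End Instances.

Lemma subalg_closed_of (P : A -> Prop) : P 1 -> (forall a b, P a -> P b -> P (a - b)) ->
    (forall a b, P a -> P b -> P (a * b)) -> (forall (c : K) a, P a -> P (c *: a)) ->
  GRing.subsemialg_closed (fun a => `[< P a >]).
Proof.
move=> P1 PB PM PZ; have P0 : P 0 by rewrite -(subrr 1); apply: PB.
split; first exact/asboolP.
- split; first exact/asboolP.
  move=> a b /asboolP Pa /asboolP Pb; apply/asboolP.
  by rewrite -[b]opprK -[- b]sub0r; apply: (PB) => //; apply: PB.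
- by move=> c a /asboolP Pa; apply/asboolP/PZ.
by move=> a b /asboolP Pa /asboolP Pb; apply/asboolP/PM.
Qed.

End Subalgebra.

Section Span.
Variables (K : comNzRingType) (R : algType K) (p : nat).
Hypothesis p_gt0 : (0 < p)%N.
Implicit Types (a b g h z : R) (gs : seq R).

(** Ordered monomials with exponents below p and central coefficients, nested in the same way as the
    Taylor expansions in [tensor_lift]. *)
Fixpoint cspan gs a : Prop :=
  if gs is g :: gs' then
    exists s : nat -> R, (forall l, cspan gs' (s l)) /\ a = \sum_(l < p) g ^+ l * s l
  else a \in @central R.

Lemma cspan0 gs : cspan gs 0.
Proof.
elim: gs => [|g gs IH] /=; first exact: (central0 R).
by exists (fun=> 0); split=> //; rewrite big1 // => l _; rewrite mulr0.
Qed.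

Lemma cspanD gs a b : cspan gs a -> cspan gs b -> cspan gs (a + b).
Proof.
elim: gs a b => [|g gs IH] a b /=; first exact: centralD.
move=> [s [Ks ->]] [t [Kt ->]]; exists (fun l => s l + t l).
by split=> [l|]; [apply: IH | rewrite -big_split /=; apply: eq_bigr => l _; rewrite mulrDr].
Qed.

Lemma cspanM gs a z : z \in @central R -> cspan gs a -> cspan gs (a * z).
Proof.
move=> cz; elim: gs a => [|g gs IH] a; first by move=> ca; apply: centralM.
move=> [s [Ks ->]]; exists (fun l => s l * z).
split=> [l|]; first exact/IH/Ks.
by rewrite mulr_suml; apply: eq_bigr => l _; rewrite mulrA.
Qed.

Lemma cspanZ gs (c : K) a : cspan gs a -> cspan gs (c *: a).
Proof. by rewrite -[a]mulr1 scalerAr mulr1; apply/cspanM/centralZ/central1. Qed.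

Lemma cspan_mulX gs g l a : (l < p)%N -> cspan gs a -> cspan (g :: gs) (g ^+ l * a).
Proof.
move=> lp Ka; exists (fun m => if m == l then a else 0); split=> [m|].
  by case: eqP => // _; apply: cspan0.
rewrite (bigD1 (Ordinal lp)) //= eqxx big1 ?addr0 // => i il.
by rewrite ifN ?mulr0 // (contra _ il) // => /eqP e; apply/eqP/val_inj.
Qed.

Lemma cspan_cons gs g a : cspan gs a -> cspan (g :: gs) a.
Proof. by move=> Ka; have := cspan_mulX g p_gt0 Ka; rewrite expr0 mul1r. Qed.

Lemma cspan1 gs : cspan gs 1.
Proof. by elim: gs => [|g gs IH]; [exact: (central1 R) | apply: cspan_cons]. Qed.

Lemma cspan_sum gs (I : Type) (r : seq I) (F : I -> R) :
  (forall i, cspan gs (F i)) -> cspan gs (\sum_(i <- r) F i).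
Proof.
move=> h; elim/big_ind: _ => //; first exact: cspan0.
by move=> *; apply: cspanD.
Qed.

(** The factor h is moved to its place; crossing g^l adds l g^(l-1) [h, g] with [h, g] central, and
    an exponent that reaches p is absorbed in the coefficient. *)
Lemma cspan_mul_gen gs h a : h \in gs ->
    (forall g, g \in gs -> g ^+ p \in @central R) ->
    (forall g, g \in gs -> commutator h g \in @central R) ->
  cspan gs a -> cspan gs (h * a).
Proof.
elim: gs a => // g gs IH a; rewrite inE => hgs cp cc [s [Ks0 ->]].
have Ks l : cspan gs (s l) := Ks0 l.
rewrite mulr_sumr; apply: cspan_sum => -[l lp]; rewrite [nat_of_ord _]/=.
have [->|nhg] := eqVneq h g.
  rewrite mulrA -exprS; case: (ltnP l.+1 p) => [lp'|lp']; first exact/cspan_mulX/Ks.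
  have -> : l.+1 = p by apply/eqP; rewrite eqn_leq lp lp'.
  have cg : g ^+ p \in @central R by apply: cp; rewrite inE eqxx.
  by rewrite (centralE cg); apply: cspanM => //; exact/cspan_cons/Ks.
have hgs' : h \in gs by move: hgs; rewrite (negPf nhg).
have Khs : cspan gs (h * s l).
  by apply: IH => // g' g'gs; [apply: cp | apply: cc]; rewrite inE g'gs orbT.
have cz : commutator h g \in @central R by apply: cc; rewrite inE eqxx.
have eh : h * g ^+ l = g ^+ l * h + (g ^+ l.-1 * commutator h g) *+ l.
  elim: l {lp Khs} => [|l IHl]; first by rewrite mulr0n addr0 !expr0 mul1r mulr1.
  rewrite exprSr mulrA IHl mulrDl -mulrA.
  have -> : h * g = g * h + commutator h g by rewrite addrC subrK.
  rewrite mulrDr mulrA -exprSr -addrA; congr (_ + _).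
  rewrite mulrSr addrC; congr (_ + _); case: l {IHl} => [|l]; first by rewrite !mulr0n mul0r.
  by rewrite mulrnAl -mulrA (centralE cz) mulrA -exprSr.
rewrite mulrA eh mulrDl; apply: cspanD.
  by rewrite -mulrA; apply: cspan_mulX.
rewrite mulrnAl -mulrA -mulr_natr; apply: cspanM; first by rewrite -scaler_nat; apply/centralZ/central1.
apply: cspan_mulX; first by rewrite (leq_ltn_trans (leq_pred _)).
by rewrite (centralE cz); apply: cspanM => //; apply: Ks.
Qed.

End Span.

Section HbarPowers.
Variables (k : comNzRingType) (R : algType (fps k)).

Definition hbar_ideal : set R := [set a | exists b, a = hbar *: b].

Lemma hbar_ideal_pow n a : ideal_pow hbar_ideal n a <-> exists b, a = hbar ^+ n *: b.
Proof.
elim: n a => [|n IHn] a.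
  by split=> // _; exists a; rewrite expr0 scale1r.
split=> [[s [sJ ->]]|[b ->]].
  elim: s sJ => [|u s IHs] sJ; first by exists 0; rewrite big_nil scaler0.
  have [[b eb] /IHn[c ec]] := sJ u (mem_head _ _).
  have [|d ed] := IHs; first by move=> v vs; apply: sJ; rewrite inE vs orbT.
  exists (b * c + d); rewrite big_cons ed eb ec scalerDr; congr (_ + _).
  by rewrite -scalerAl -scalerAr scalerA -exprS.
exists [:: (hbar *: 1, hbar ^+ n *: b)]; split=> [u|].
  by rewrite inE => /eqP-> /=; split; [exists 1 | apply/IHn; exists b].
by rewrite big_seq1 /= -scalerAl mul1r scalerA -exprS.
Qed.

End HbarPowers.

Section WeylSpan.
Variables (k : fieldType) (n : nat) (W0 : algType (fps k)) (x y : 'I_n -> W0).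
Hypothesis pres : weyl_presentation x y.

(** The generators lift to the subalgebra cut out by [P]. By uniqueness in the universal property,
    the map to it followed by the inclusion is the identity. *)
Lemma weyl_ind (P : W0 -> Prop) : P 1 -> (forall a b, P a -> P b -> P (a - b)) ->
    (forall a b, P a -> P b -> P (a * b)) -> (forall (c : fps k) a, P a -> P (c *: a)) ->
    (forall i, P (x i) /\ P (y i)) -> forall a, P a.
Proof.
move=> P1 PB PM PZ Pg a; have [rel univ] := pres.
pose cP := subalg_closed_of P1 PB PM PZ; pose S := subalg cP.
pose u i : S := Subalg _ (asboolT (Pg i).1); pose v i : S := Subalg _ (asboolT (Pg i).2).
have valC (s t : S) : val (commutator s t) = commutator (val s) (val t).
  by rewrite /commutator rmorphB !rmorphM.
have valZ (c : fps k) (s : S) : val (c *: s) = c *: val s by rewrite linearZ.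
have relS : weyl_relations u v.
  move=> i j; have [r1 r2 r3] := rel i j.
  split; apply: val_inj; rewrite ?valZ valC ?r1 ?r2 ?r3 ?rmorph0 //.
  by rewrite rmorph_nat.
have [h [hg _]] := univ S u v relS; have [h1 [_ uniq]] := univ W0 x y rel.
have e1 : idfun =1 h1 by apply: uniq.
have e2 : subalg_incl (cP := cP) \o h =1 h1.
  by apply: (uniq (subalg_incl (cP := cP) \o h)) => i /=; have [-> ->] := hg i.
have := valP (h a); rewrite (_ : val (h a) = a) => [/asboolP //|].
by rewrite -[LHS]/((subalg_incl (cP := cP) \o h) a) e2 -e1.
Qed.

Lemma weyl_commutant (R : algType (fps k)) (h : {lrmorphism W0 -> R}) r :
    (forall i, commutator (h (x i)) r = 0 /\ commutator (h (y i)) r = 0) ->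
  forall a, commutator (h a) r = 0.
Proof.
move=> hr a; suff: h a * r = r * h a by rewrite /commutator => ->; rewrite subrr.
have eq (b : R) : commutator b r = 0 -> b * r = r * b.
  by move/eqP; rewrite subr_eq0 => /eqP.
have hZ (c : fps k) b : h (c *: b) = c *: h b by rewrite linearZ.
move: a; apply: weyl_ind => [|a b ea eb|a b ea eb|c a ea|i].
- by rewrite rmorph1 mulr1 mul1r.
- by rewrite rmorphB /= mulrBl mulrBr ea eb.
- by rewrite rmorphM /= -mulrA eb mulrA ea mulrA.
- by rewrite hZ -scalerAl -scalerAr ea.
by split; apply: eq; case: (hr i).
Qed.

(** The order, y before x, is that of the coordinates in [conj_of]. *)
Definition weyl_gens : seq W0 := flatten [seq [:: y i; x i] | i <- enum 'I_n].

Lemma mem_weyl_gens g : g \in weyl_gens -> exists i, g = y i \/ g = x i.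
Proof.
by case/flattenP => l /mapP[i _ ->]; rewrite !inE => /orP[]/eqP->; exists i; auto.
Qed.

Lemma weyl_gens_mem i : x i \in weyl_gens /\ y i \in weyl_gens.
Proof.
by split; apply/flattenP; exists [:: y i; x i]; rewrite ?inE ?eqxx ?orbT //; apply/mapP;
  exists i; rewrite ?mem_enum.
Qed.

Lemma weyl_gens_commutator g h : g \in weyl_gens -> h \in weyl_gens ->
  commutator g h \in @central W0.
Proof.
have [rel _] := pres; have z0 := central0 W0.
have zn (m : nat) : hbar *: m%:R \in @central W0.
  by apply: centralZ; rewrite -scaler_nat; apply/centralZ/central1.
move=> /mem_weyl_gens[i hi] /mem_weyl_gens[j hj].
have [r1 r2 r3] := rel i j; have [_ _ r3'] := rel j i.
case: hi => ->; case: hj => ->; rewrite ?r1 ?r2 ?r3 //.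
by rewrite commutatorC r3' -scaleN1r; apply/centralZ/zn.
Qed.

Variable p : nat.
Hypotheses (chark : p \in [pchar k]) (p_gt2 : (2 < p)%N).

(** ad(g^p) = ad(g)^p, and two commutators with g already kill every generator. *)
Lemma weyl_gens_exp g : g \in weyl_gens -> g ^+ p \in @central W0.
Proof.
move=> gg; have comm h : h \in weyl_gens -> commutator (g ^+ p) h = 0.
  move=> hg; rewrite -iter_commutator_pchar ?pchar_fps_alg //.
  rewrite -(subnK p_gt2) -addn2 addnA iterD /=.
  have /centralP cz := weyl_gens_commutator gg hg.
  by rewrite cz; elim: (_ + _)%N => //= m ->; rewrite /commutator mulr0 mul0r subrr.
apply/centralP => a; apply: (weyl_commutant (h := idfun)) => i.
have [xg yg] := weyl_gens_mem i.
by split; rewrite commutatorC comm ?oppr0.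
Qed.

Lemma weyl_span a : cspan p weyl_gens a.
Proof.
have p0 : (0 < p)%N by apply: ltnW; apply: ltnW.
(* Strengthened for the induction: multiplication by [a] preserves the span. *)
rewrite -[a]mulr1; move: a (1 : W0) (cspan1 p0 weyl_gens).
have gen g b : g \in weyl_gens -> cspan p weyl_gens b -> cspan p weyl_gens (g * b).
  move=> gg; apply: cspan_mul_gen => // h hg; [exact: weyl_gens_exp|].
  exact: weyl_gens_commutator.
apply: weyl_ind => [b|a a' Ka Ka' b Kb|a a' Ka Ka' b Kb|c a Ka b Kb|i].
- by rewrite mul1r.
- rewrite mulrBl -mulN1r; apply: cspanD; first exact: Ka.
  by rewrite mulN1r -scaleN1r; apply: cspanZ; apply: Ka'.
- by rewrite -mulrA; apply: Ka; apply: Ka'.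
- by rewrite -scalerAl; apply: cspanZ; apply: Ka.
by have [xg yg] := weyl_gens_mem i; split=> b; apply: gen.
Qed.

End WeylSpan.

Section HbarCompletion.
Variables (k : fieldType) (W0 W : algType (fps k)) (j : {lrmorphism W0 -> W}).
Variable F : nat -> set W.
Hypotheses (Fid : forall n, two_sided_ideal (F n) /\ F n.+1 `<=` F n)
  (Fiota : forall n a, F n (j a) <-> ideal_pow (@hbar_ideal k W0) n a)
  (Fdense : forall n w, exists a, F n (w - j a))
  (Flim : forall a : nat -> W0, (forall n, ideal_pow (@hbar_ideal k W0) n (a n.+1 - a n)) ->
          exists! w, forall n, F n (w - j (a n))).

Let partial_sum (u : nat -> W0) n : W0 := \sum_(i < n) hbar ^+ i *: u i.

Let jZ (c : fps k) a : j (c *: a) = c *: j a.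
Proof. by rewrite linearZ. Qed.

Let F_eq w w' : (forall n, F n (w - w')) -> w = w'.
Proof. by move=> /(compl_sep Fid Flim)/eqP; rewrite subr_eq0 => /eqP. Qed.

(** The coefficients of each monomial are summed separately, and an hbar-adic limit of central
    elements is central. *)
Lemma cspan_lim p gs (u : nat -> W0) : (forall n, cspan p gs (u n)) ->
  exists2 X, cspan p (map j gs) X & forall n, F n (X - j (partial_sum u n)).
Proof.
elim: gs u => [|g gs IH] u Ku.
  have [|X [hX _]] := Flim (a := partial_sum u).
    move=> n; apply/hbar_ideal_pow; exists (u n).
    by rewrite /partial_sum big_ord_recr /= addrAC subrr add0r.
  exists X => //=; apply: centralI => w; apply: F_eq => n.
  have [a Fa] := Fdense n w; set z := partial_sum u n.
  have /centralE cz : z \in @central W0.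
    rewrite /z /partial_sum; elim/big_ind: _ => [|b c|i _].
    - exact: (central0 W0).
    - exact: centralD.
    exact/centralZ/Ku.
  have e1 : F n (X * w - j z * j a).
    apply: (compl_trans Fid (y := j z * w)); first by rewrite -mulrBl; apply: (complMr Fid); apply: hX.
    by rewrite -mulrBr; apply: (complMl Fid).
  have e2 : F n (w * X - j a * j z).
    apply: (compl_trans Fid (y := j a * X)); first by rewrite -mulrBl; apply: (complMr Fid).
    by rewrite -mulrBr; apply: (complMl Fid); apply: hX.
  by apply: (compl_trans Fid e1); rewrite -rmorphM cz rmorphM; apply: (compl_sym Fid).
have /choice[s hs] n : exists s : nat -> W0, (forall l, cspan p gs (s l)) /\
    u n = \sum_(l < p) g ^+ l * s l by apply: Ku.
have /choice[X hX] l : exists X, cspan p (map j gs) X /\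
    forall n, F n (X - j (partial_sum (fun m => s m l) n)).
  by have [X] := IH (fun n => s n l) (fun n => (hs n).1 l); exists X.
exists (\sum_(l < p) j g ^+ l * X l).
  by exists X; split=> // l; case: (hX l).
move=> n; have -> : partial_sum u n = \sum_(l < p) g ^+ l * partial_sum (fun m => s m l) n.
  transitivity (\sum_(i < n) \sum_(l < p) g ^+ l * (hbar ^+ i *: s i l)).
    apply: eq_bigr => i _; rewrite (hs i).2 scaler_sumr; apply: eq_bigr => l _.
    by rewrite scalerAr.
  by rewrite exchange_big; apply: eq_bigr => l _; rewrite mulr_sumr.
rewrite rmorph_sum -sumrB; elim/big_ind: _ => [|b c|l _].
- exact: (compl0 Fid).
- exact: (complD Fid).
rewrite rmorphM rmorphXn -mulrBr; apply: (complMl Fid).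
by have [_] := hX l; apply.
Qed.

Lemma cspan_completion p gs : (forall a, cspan p gs a) -> forall w, cspan p (map j gs) w.
Proof.
move=> Kgs w; have /choice[a ha] n : exists a, F n (w - j a) := Fdense n w.
have /choice[u hu] n : exists u, a n.+1 = a n + hbar ^+ n *: u.
  have [|u eu] := (hbar_ideal_pow n (a n.+1 - a n)).1.
    apply: (compl_iota_diff Fid Fiota) (ha n).
    exact: (complW Fid (leqnSn n)).
  by exists u; rewrite -eu addrC subrK.
(* The initial approximation [a 0] is included in the term of index 0 of the series. *)
pose u' n := if n is 0%N then a 0%N + u 0%N else u n.
have [X KX hX] := cspan_lim (fun n => Kgs (u' n)).
suff -> : w = X by [].
apply: F_eq => n; apply: (complW Fid (leqnSn n)).
have -> : w - X = (w - j (a n.+1)) - (X - j (a n.+1)) by rewrite opprB addrA subrK.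
apply: (complB Fid) => //; suff -> : a n.+1 = partial_sum u' n.+1 by apply: hX.
elim: n => [|n IHn]; first by rewrite /partial_sum big_ord1 hu expr0 !scale1r.
by rewrite hu IHn /partial_sum [RHS]big_ord_recr.
Qed.

Section Extension.
Variables (p : nat) (R : algType (fps k)) (G : nat -> set R).
Hypothesis CQ : complete_quantization p G.
Variable h0 : {lrmorphism W0 -> R}.

Let FQ := cq_filtered CQ.
Let h0Z (c : fps k) a : h0 (c *: a) = c *: h0 a.
Proof. by rewrite linearZ. Qed.

Let h0_ideal n a : ideal_pow (@hbar_ideal k W0) n a -> G n (h0 a).
Proof.
move=> /hbar_ideal_pow[b ->]; rewrite h0Z; apply: (filtW FQ _ (filt_hbarX FQ n (filtT FQ _))).
by rewrite addn0 leq_pmull.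
Qed.

Lemma hbar_completion_ext : exists h : {lrmorphism W -> R},
  forall n w a, F n (w - j a) -> G n (h w - h0 a).
Proof.
have /choice[h hP] (w : W) : exists X, forall n a, F n (w - j a) -> G n (X - h0 a).
  have /choice[a ha] n : exists a, F n (w - j a) := Fdense n w.
  have [|X hX] := cq_lim CQ (x := h0 \o a).
    move=> n /=; rewrite -rmorphB; apply: h0_ideal.
    apply: (compl_iota_diff Fid Fiota) (ha n).
    exact: (complW Fid (leqnSn n)).
  exists X => n b Fb; rewrite -[X - _](subrKA (h0 (a n))); apply: (filtD FQ); first exact: hX.
  by rewrite -rmorphB; apply: h0_ideal; apply: (compl_iota_diff Fid Fiota) Fb.
have uniq w X : (forall n a, F n (w - j a) -> exists2 b, F n (w - j b) & G n (X - h0 b)) -> h w = X.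
  move=> hX; apply/eqP; rewrite -subr_eq0; apply/eqP/(cq_sep CQ) => n.
  have [a Fa] := Fdense n w; have [b Fb Gb] := hX n a Fa.
  by have := filtB FQ (hP w n b Fb) Gb; rewrite opprB addrA subrK.
have approx n w : exists2 a, F n (w - j a) & G n (h w - h0 a).
  by have [a Fa] := Fdense n w; exists a => //; apply: hP.
have hB : zmod_morphism h.
  move=> v w; apply: uniq => n _ _.
  have [a Fa Ga] := approx n v; have [b Fb Gb] := approx n w.
  by exists (a - b); rewrite rmorphB subrACA; [apply: (complB Fid) | apply: (filtB FQ)].
have hM : monoid_morphism h.
  split; first by apply: uniq => n _ _; exists 1; rewrite rmorph1 subrr;
    [apply: (compl0 Fid) | apply: (filt0 FQ)].
  move=> v w; apply: uniq => n _ _.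
  have [a Fa Ga] := approx n v; have [b Fb Gb] := approx n w.
  exists (a * b); rewrite rmorphM.
    rewrite -[v * w - _](subrKA (j a * w)) -mulrBl -mulrBr.
    by apply: (complD Fid); [apply: (complMr Fid) | apply: (complMl Fid)].
  rewrite -[h v * h w - _](subrKA (h0 a * h w)) -mulrBl -mulrBr.
  by apply: (filtD FQ); [apply: (filtMr FQ) | apply: (filtMl FQ)].
have hZ : scalable h.
  move=> c w; apply: uniq => n _ _; have [a Fa Ga] := approx n w.
  by exists (c *: a); rewrite ?jZ ?h0Z -scalerBr; [apply: (complZ Fid) | apply: (filtZ FQ)].
pose H : {lrmorphism W -> R} := HB.pack_for {lrmorphism W -> R} h
  (GRing.isZmodMorphism.Build W R h hB) (GRing.isMonoidMorphism.Build W R h hM)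
  (GRing.isScalable.Build (fps k) W R *:%R h hZ).
by exists H => n w a; apply: hP.
Qed.

Lemma hbar_completion_commutant (h : {lrmorphism W -> R}) r :
    (forall n w a, F n (w - j a) -> G n (h w - h0 a)) ->
    (forall a, commutator (h0 a) r = 0) ->
  forall w, h w * r = r * h w.
Proof.
move=> hP h0r w; apply/eqP; rewrite -subr_eq0; apply/eqP/(cq_sep CQ) => n.
have [a /hP Ga] := Fdense n w.
have -> : h w * r - r * h w = commutator (h w - h0 a) r.
  by rewrite -[LHS]/(commutator _ _) -{1}[h w](subrK (h0 a)) commutatorDl h0r addr0.
by apply: (filtB FQ); [apply: (filtMr FQ) | apply: (filtMl FQ)].
Qed.

End Extension.

End HbarCompletion.

Section WeylTensor.
Variables (k : fieldType) (p : nat) (R : algType (fps k)) (G : nat -> set R).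
Hypothesis CQ : complete_quantization p G.
Hypothesis chark : p \in [pchar k].

Let FQ := cq_filtered CQ.

Fact hker_closed (hs : seq (R * R)) : GRing.subsemialg_closed (fun a => `[< hker hs a >]).
Proof. by apply: subalg_closed_of; case: (hker_subalg CQ hs). Qed.

Variables (W : algType (fps k)) (h : {lrmorphism W -> R}).
(* The conjugate pairs d of R, each with a preimage of d.1 under h. *)
Variable zd : seq (W * (R * R)).
Let ds := unzip2 zd.
Hypothesis sys : conj_sys p G ds.
Hypothesis h_gen : forall q, q \in zd -> h q.1 = q.2.1.
Hypothesis W_span : forall w, cspan p (unzip1 zd) w.
Hypothesis h_center : forall z, z \in @central W -> hker ds (h z).
Hypothesis h_commute : forall r w, hker ds r -> h w * r = r * h w.

Notation S := (subalg (hker_closed ds)).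

Let in_S (a : S) : hker ds (val a). Proof. by have /asboolP := valP a. Qed.

Let hZ (c : fps k) w : h (c *: w) = c *: h w. Proof. by rewrite linearZ. Qed.

Definition center_subalg_val (z : center W) : S :=
  Subalg (hker_closed ds) (asboolT (h_center (valP z))).

Lemma center_subalg_central z : center_subalg_val z \in @central S.
Proof.
apply: centralI => a; apply: val_inj; rewrite !rmorphM /=.
exact: h_commute (in_S a).
Qed.

Definition center_map (z : center W) : center S := Center (center_subalg_central z).

Fact center_map_zmod_morphism : zmod_morphism center_map.
Proof. by move=> u v; do 2!apply: val_inj; rewrite /= rmorphB. Qed.

Fact center_map_monoid_morphism : monoid_morphism center_map.
Proof.
split; first by do 2!apply: val_inj; rewrite /= rmorph1.
by move=> u v; do 2!apply: val_inj; rewrite /= rmorphM.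
Qed.

Fact center_map_scalable : scalable center_map.
Proof. by move=> c u; do 2!apply: val_inj; rewrite /= hZ. Qed.

HB.instance Definition _ := GRing.isZmodMorphism.Build (center W) (center S) center_map
  center_map_zmod_morphism.
HB.instance Definition _ := GRing.isMonoidMorphism.Build (center W) (center S) center_map
  center_map_monoid_morphism.
HB.instance Definition _ := GRing.isScalable.Build (fps k) (center W) (center S) *:%R center_map
  center_map_scalable.

Definition tensor (w : W) (a : S) : R := h w * val a.

Lemma tensor_balanced : balanced center_map tensor.
Proof.
split=> [w w' a|w a a'|w z a]; rewrite /tensor ?rmorphD ?mulrDl ?mulrDr //.
by rewrite !rmorphM /= mulrA.
Qed.

Lemma tensorM w w' a a' : tensor w a * tensor w' a' = tensor (w * w') (a * a').
Proof.
by rewrite /tensor !rmorphM /= -!mulrA; congr (_ * _); rewrite !mulrA (h_commute _ (in_S a)).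
Qed.

(** It is applied to [c = d.2] for a pair d preceding [zd']: what follows d in a monomial is a
    constant for d. *)
Lemma dl_span c zd' v (a : S) : cspan p (unzip1 zd') v -> {subset zd' <= zd} ->
    (forall q, q \in zd' -> dl c q.2.1 = 0) -> (forall r, hker ds r -> dl c r = 0) ->
  dl c (h v * val a) = 0.
Proof.
move=> Kv sub cq cr; rewrite (dlMr FQ) (cr _ (in_S a)) mulr0 addr0.
suff -> : dl c (h v) = 0 by rewrite mul0r.
elim: zd' v Kv sub cq => [|q zd' IH] v /=; first by move=> cv _ _; apply: cr; apply: h_center.
move=> [s [Ks ->]] sub cq; rewrite rmorph_sum (dl_sum FQ) big1 // => l _.
rewrite rmorphM rmorphXn /= (dlMr FQ) IH ?mulr0 ?addr0.
- suff -> : dl c (h q.1 ^+ l) = 0 by rewrite mul0r.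
  rewrite h_gen ?sub ?mem_head //; apply: (dl_gX_comm FQ); apply: cq; exact: mem_head.
- exact: Ks.
- by move=> q' q'zd; apply: sub; rewrite inE q'zd orbT.
by move=> q' q'zd; apply: cq; rewrite inE q'zd orbT.
Qed.

Section Universal.
Variables (M : zmodType) (b : W -> S -> M).
Hypothesis b_bal : balanced center_map b.

Let bDl w w' a : b (w + w') a = b w a + b w' a. Proof. by case: b_bal. Qed.
Let bDr w a a' : b w (a + a') = b w a + b w a'. Proof. by case: b_bal. Qed.

Let b0l a : b 0 a = 0.
Proof. by apply: (addrI (b 0 a)); rewrite -bDl !addr0. Qed.

(* R is free over the commutant of the conjugate pairs, with basis the monomials in
   their first components; b is evaluated on the Taylor expansion of r. *)
Fixpoint tensor_lift (zd' : seq (W * (R * R))) (e : W) (r : R) : M :=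
  if zd' is q :: zd'' then
    \sum_(l < p) tensor_lift zd'' (e * q.1 ^+ l) (ccoef p q.2.1 q.2.2 l r)
  else b e (insubd 0 r).

(** [hs] collects the pairs already expanded. The recursion ends with an element of the full
    commutant, where [insubd] does not fall back on its default 0. *)
Lemma tensor_liftD zd' hs e r r' : conj_sys p G (unzip2 zd') ->
    (forall f d, f \in hs -> d \in unzip2 zd' -> conj_compat f d) ->
    (forall x, hker (catrev (unzip2 zd') hs) x -> hker ds x) ->
    hker hs r -> hker hs r' ->
  tensor_lift zd' e (r + r') = tensor_lift zd' e r + tensor_lift zd' e r'.
Proof.
elim: zd' hs e r r' => [|[g d] zd' IH] hs e r r' /= => [_ _ sub hr hr'|].
  rewrite -bDr; congr (b _ _); apply: val_inj; rewrite rmorphD /= !val_insubd.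
  by do 3!(case: asboolP => [_|[]]; last by apply: sub => //; apply: (hkerD CQ)).
move=> [pd cd sys'] comp sub hr hr'; rewrite -big_split; apply: eq_bigr => l _.
have cd' f : f \in hs -> conj_compat f d by move=> fh; apply: comp; rewrite ?inE ?eqxx.
rewrite (ccoefD _ FQ); apply: (IH (d :: hs)) => //; first exact: conj_compat_cons comp.
- exact: (hker_ccoef_cons CQ chark).
exact: (hker_ccoef_cons CQ chark).
Qed.

(** The remaining factors being constants for [d.2], the l-th Taylor coefficient of the tensor comes
    from the l-th term of [v] alone. *)
Lemma tensor_lift_tensor zd' e v a : cspan p (unzip1 zd') v -> {subset zd' <= zd} ->
    conj_sys p G (unzip2 zd') ->
  tensor_lift zd' e (tensor v a) = b (e * v) a.
Proof.
elim: zd' e v => [|[g d] zd' IH] e v /= => [cv _ _|].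
  have [_ _ bz] := b_bal; rewrite -[v in RHS]/(val (Center cv)) bz.
  congr (b _ _); apply: val_inj; rewrite val_insubd /tensor rmorphM /=.
  by case: asboolP => // -[]; apply: (hkerM CQ) (in_S a); apply: h_center.
move=> [s [Ks ->]] sub [[Gd1 Gd2 dd dp _] cd sys'].
have gd : h g = d.1 by apply: (h_gen (sub _ (mem_head _ _))).
have dzd : d \in ds by apply/mapP; exists (g, d) => //; apply: sub; apply: mem_head.
have sub' : {subset zd' <= zd} by move=> q qz; apply: sub; rewrite inE qz orbT.
have ker l : dl d.2 (tensor (s l) a) = 0.
  apply: (dl_span a (Ks l) sub') => [q qz|r]; last by apply.
  by have [] := cd q.2 (map_f snd qz).
have e1 : tensor (\sum_(m < p) g ^+ m * s m) a = \sum_(m < p) d.1 ^+ m * tensor (s m) a.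
  rewrite /tensor rmorph_sum mulr_suml; apply: eq_bigr => m _.
  by rewrite rmorphM rmorphXn /= gd mulrA.
rewrite e1 mulr_sumr (big_morph (fun v => b v a) (fun v w => bDl v w a) (b0l a)).
apply: eq_bigr => l _; rewrite mulrA -IH //.
congr (tensor_lift _ _ _); rewrite (ccoef_sum _ FQ) (bigD1 l) //=.
rewrite (ccoef_exp FQ chark dd _ _ (ker l)) // eqxx big1 ?addr0 // => m ml.
rewrite (ccoef_exp FQ chark dd _ _ (ker m)) //; case: eqP => // e'.
by case/eqP: ml; apply: val_inj.
Qed.

End Universal.

(** Iterated Taylor expansion writes every element as a sum of pure tensors, which gives uniqueness
    in the universal property. *)
Lemma tensor_generates_ker (M : zmodType) (f f' : {additive R -> M}) zd' hs r w :
    (forall w a, f (tensor w a) = f' (tensor w a)) -> {subset zd' <= zd} ->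
    conj_sys p G (unzip2 zd') ->
    (forall e d, e \in hs -> d \in unzip2 zd' -> conj_compat e d) ->
    (forall x, hker (catrev (unzip2 zd') hs) x -> hker ds x) ->
    hker hs r ->
  f (h w * r) = f' (h w * r).
Proof.
move=> eqt; elim: zd' hs r w => [|[g d] zd' IH] hs r w sub /=.
  by move=> _ _ ker hr; have := eqt w (Subalg (hker_closed ds) (asboolT (ker _ hr))).
move=> [pd cd sys'] comp ker hr; have [_ _ dd dp _] := pd.
have gd : h g = d.1 by apply: (h_gen (sub _ (mem_head _ _))).
rewrite [r](taylor FQ chark dd dp) mulr_sumr !raddf_sum; apply: eq_bigr => l _ /=.
rewrite mulrA -gd -rmorphXn -rmorphM gd; apply: (IH (d :: hs)) => //.
- by move=> q qz; apply: sub; rewrite inE qz orbT.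
- exact: conj_compat_cons comp.
by apply: (hker_ccoef_cons CQ chark) => // e eh; apply: comp; rewrite ?inE ?eqxx.
Qed.

Lemma weyl_tensor : is_tensor_product center_map tensor.
Proof.
split=> [|M b b_bal|w w' a a'||c w a]; last first.
- by rewrite /tensor hZ scalerAl.
- by rewrite /tensor !rmorph1 mulr1.
- exact: tensorM.
- have nil (f0 d : R * R) : f0 \in [::] -> d \in ds -> conj_compat f0 d by [].
  have rev x : hker (catrev ds [::]) x -> hker ds x by move/hker_rev.
  have hD r r' : tensor_lift b zd 1 (r + r') = tensor_lift b zd 1 r + tensor_lift b zd 1 r'.
    exact: (tensor_liftD b_bal _ sys nil rev).
  have h0 : tensor_lift b zd 1 0 = 0.
    by apply: (addrI (tensor_lift b zd 1 0)); rewrite -hD !addr0.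
  have hB : zmod_morphism (tensor_lift b zd 1).
    move=> u v; apply/eqP; rewrite eq_sym subr_eq -hD subrK eqxx //.
  pose H : {additive R -> M} := HB.pack_for {additive R -> M} (tensor_lift b zd 1)
    (GRing.isZmodMorphism.Build R M (tensor_lift b zd 1) hB).
  have Ht w a : H (tensor w a) = b w a.
    by rewrite [LHS](tensor_lift_tensor b_bal 1 a (W_span w)) ?mul1r.
  exists H; split=> // h' h't r; rewrite -[r]mul1r -(rmorph1 h).
  by apply: (tensor_generates_ker 1 _ _ sys nil rev) => // w a; rewrite h't Ht.
exact: tensor_balanced.
Qed.

End WeylTensor.

(** * Reduction modulo hbar of a complete quantization *)

Section ResidueComplement.
Variables (k : fieldType) (R : lmodType (fps k)).
Implicit Types (a b r v : R).

Definition hbar_complement (V : set R) : Prop :=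
  (forall (c : k) v w, V v -> V w -> V (fpsC c *: v + w)) /\
  (forall t, V (hbar *: t) -> hbar *: t = 0).

Lemma hbar_complement_exists : exists V : set R,
  [/\ hbar_complement V, V 0 & forall r, exists2 v, V v & exists t, r - v = hbar *: t].
Proof.
have [V [[Vlin Vh] Vmax]] : exists V, hbar_complement V /\
    forall V', V `<` V' -> ~ hbar_complement V'.
  apply: Zorn_bigcup => C sub tot; split=> [c v w [X CX Xv] [X' CX' Xw]|t [X CX Xt]].
    have [XX'|X'X] := tot X X' CX CX'.
      by exists X' => //; apply: (sub _ CX').1 => //; apply: XX'.
    by exists X => //; apply: (sub _ CX).1 => //; apply: X'X.
  exact: (sub _ CX).2 Xt.
(* The empty set is excluded by maximality, being smaller than the zero subspace. *)
have V0 : V 0.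
  apply: contrapT => V0; have nV v : ~ V v.
    by move=> Vv; apply: V0; have := Vlin (-1) v v Vv Vv; rewrite rmorphN1 scaleN1r addNr.
  apply: (Vmax [set 0]).
    by split=> [v /nV //|/(_ 0 erefl)].
  by split=> [c v w -> ->|t //]; rewrite scaler0 addr0.
have VZ (c : k) v : V v -> V (fpsC c *: v).
  by move=> Vv; rewrite -[_ *: v]addr0; apply: Vlin.
exists V; split=> // r; apply: contrapT => nr.
pose V' : set R := [set x | exists (c : k) v, V v /\ x = fpsC c *: r + v].
apply: (Vmax V').
  split=> [v Vv|sub]; first by exists 0, v; rewrite rmorph0 scale0r add0r.
  apply: nr; exists r; last by exists 0; rewrite subrr scaler0.
  by apply: sub; exists 1, 0; rewrite rmorph1 scale1r addr0.
split=> [c _ _ [d [v [Vv ->]]] [d' [w [Vw ->]]]|t [c [v [Vv et]]]].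
  exists (c * d + d'), (fpsC c *: v + w); split; first exact: Vlin.
  by rewrite rmorphD rmorphM scalerDl -scalerA scalerDr addrACA.
have [c0|nc] := eqVneq c 0.
  move: et; rewrite c0 rmorph0 scale0r add0r => et.
  by apply: Vh; rewrite et.
exfalso; apply: nr; exists (fpsC (- c^-1) *: v); first exact: VZ.
exists (fpsC c^-1 *: t); rewrite scalerA mulrC -scalerA et scalerDr scalerA -rmorphM mulVf //.
by rewrite rmorph1 scale1r rmorphN scaleNr opprK.
Qed.

Lemma hbar_projection_exists : exists f : R -> R,
  [/\ forall a b, f (a - b) = f a - f b, forall (c : k) a, f (fpsC c *: a) = fpsC c *: f a,
      forall a, exists t, a - f a = hbar *: t & forall a, f (hbar *: a) = 0].
Proof.
have [V [[Vlin Vh] V0 dec]] := hbar_complement_exists.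
have /choice[f hf] r : exists v, V v /\ exists t, r - v = hbar *: t.
  by have [v] := dec r; exists v.
have uniq r v : V v -> (exists t, r - v = hbar *: t) -> f r = v.
  move=> Vv [t et]; have [Vf [s es]] := hf r.
  have e : f r - v = hbar *: (t - s) by rewrite scalerBr -et -es subrACA subrr sub0r opprB.
  apply/eqP; rewrite -subr_eq0; apply/eqP; rewrite e; apply: Vh; rewrite -e addrC.
  by rewrite -scaleN1r -(rmorphN1 (@fpsC k)); apply: Vlin.
exists f; split=> [a b|c a|a|a].
- have [Va [s es]] := hf a; have [Vb [t et]] := hf b; apply: uniq.
    by rewrite addrC -scaleN1r -(rmorphN1 (@fpsC k)); apply: Vlin.
  by exists (s - t); rewrite scalerBr -es -et subrACA.
- have [Va [s es]] := hf a; apply: uniq.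
    by rewrite -[_ *: f a]addr0; apply: Vlin.
  by exists (fpsC c *: s); rewrite scalerA mulrC -scalerA -es scalerBr.
- by have [] := hf a.
by apply: uniq => //; exists a; rewrite subr0.
Qed.

End ResidueComplement.

(* A k-linear projection of R along hbar R; its image is a model of R / hbar R. *)
Record residue_projection (k : fieldType) (R : algType (fps k)) := ResidueProjection {
  resp :> R -> R;
  respB : forall a b, resp (a - b) = resp a - resp b;
  respZ : forall (c : k) a, resp (fpsC c *: a) = fpsC c *: resp a;
  resp_sub : forall a, exists t, a - resp a = hbar *: t;
  resp_hbar : forall a : R, resp (hbar *: a) = 0;
  resp_comm : forall a b : R, exists c : R, a * b - b * a = hbar *: c;
  resp1 : resp 1 != 0 }.

Section ResidueAlgebra.
Variables (k : fieldType) (R : algType (fps k)) (f : residue_projection R).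
Implicit Types a b : R.

Record residue := Residue { residue_val : R; _ : f residue_val == residue_val }.

HB.instance Definition _ := [isSub for residue_val].
HB.instance Definition _ := [Choice of residue by <:].

Lemma resp0 : f 0 = 0.
Proof. by have := respB f 0 0; rewrite !subrr. Qed.

Lemma respD a b : f (a + b) = f a + f b.
Proof.
have fN : f (- b) = - f b by have := respB f 0 b; rewrite !sub0r resp0 sub0r.
by rewrite -{1}[b]opprK respB fN opprK.
Qed.

Lemma resp_eq a b t : a - b = hbar *: t -> f a = f b.
Proof.
by move=> e; apply/eqP; rewrite -subr_eq0 -respB e resp_hbar.
Qed.

Lemma respK a : f (f a) == f a.
Proof. by have [t e] := resp_sub f a; apply/eqP/esym/(resp_eq e). Qed.

Lemma respMl a b : f (f a * b) = f (a * b).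
Proof.
have [t e] := resp_sub f a; apply/esym/(resp_eq (t := t * b)).
by rewrite -mulrBl e scalerAl.
Qed.

Lemma respMr a b : f (a * f b) = f (a * b).
Proof.
have [t e] := resp_sub f b; apply/esym/(resp_eq (t := a * t)).
by rewrite -mulrBr e scalerAr.
Qed.

Fact residue_zmod_closed : zmod_closed (fun a => f a == a).
Proof.
split=> [|a b /eqP ea /eqP eb]; rewrite unfold_in; first by rewrite resp0.
by rewrite respB ea eb.
Qed.

HB.instance Definition _ :=
  GRing.SubChoice_isSubZmodule.Build R (fun a => f a == a) residue residue_zmod_closed.

Definition to_residue a : residue := Residue (respK a).

Lemma residue_valK (u : residue) : to_residue (val u) = u.
Proof. by apply: val_inj => /=; apply/eqP; apply: (valP u). Qed.

Definition residue_mul (u v : residue) : residue := to_residue (val u * val v).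
Definition residue_scale (c : k) (u : residue) : residue := to_residue (fpsC c *: val u).

Fact residue_mulA : associative residue_mul.
Proof. by move=> u v w; apply: val_inj; rewrite /= respMl respMr mulrA. Qed.

Fact residue_mulC : commutative residue_mul.
Proof.
move=> u v; apply: val_inj => /=.
by have [c e] := resp_comm f (val u) (val v); apply: (resp_eq e).
Qed.

Fact residue_mul1 : left_id (to_residue 1) residue_mul.
Proof. by move=> u; apply: val_inj; rewrite /= respMl mul1r; apply/eqP/(valP u). Qed.

Fact residue_mulDl : left_distributive residue_mul +%R.
Proof. by move=> u v w; apply: val_inj; rewrite /= mulrDl respD. Qed.

Fact residue1_neq0 : to_residue 1 != 0.
Proof. by rewrite -(inj_eq val_inj) /= resp1. Qed.

HB.instance Definition _ := GRing.Zmodule_isComNzRing.Build residue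
  residue_mulA residue_mulC residue_mul1 residue_mulDl residue1_neq0.

Lemma val_residue_scale c u : val (residue_scale c u) = fpsC c *: val u.
Proof. by rewrite /= respZ; congr (_ *: _); apply/eqP/(valP u). Qed.

Let valD (u v : residue) : val (u + v) = val u + val v. Proof. by rewrite raddfD. Qed.

Fact residue_scaleA c d u : residue_scale c (residue_scale d u) = residue_scale (c * d) u.
Proof. by apply: val_inj; rewrite !val_residue_scale scalerA rmorphM. Qed.

Fact residue_scale1 : left_id 1 residue_scale.
Proof. by move=> u; apply: val_inj; rewrite val_residue_scale rmorph1 scale1r. Qed.

Fact residue_scaleDr : right_distributive residue_scale +%R.
Proof.
by move=> c u v; apply: val_inj; rewrite val_residue_scale !valD !val_residue_scale scalerDr.
Qed.

Fact residue_scaleDl u : {morph residue_scale^~ u : c d / c + d}.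
Proof.
move=> c d; apply: val_inj; rewrite val_residue_scale valD !val_residue_scale.
by rewrite rmorphD scalerDl.
Qed.

HB.instance Definition _ := GRing.Zmodule_isLmodule.Build k residue
  residue_scaleA residue_scale1 residue_scaleDr residue_scaleDl.

Lemma val_residueZ (c : k) (u : residue) : val (c *: u) = fpsC c *: val u.
Proof. exact: val_residue_scale. Qed.

Lemma val_residueM (u v : residue) : val (u * v) = f (val u * val v).
Proof. by []. Qed.

Fact residue_scaleAl (c : k) (u v : residue) : c *: (u * v) = (c *: u) * v.
Proof.
by apply: val_inj; rewrite val_residueZ !val_residueM val_residueZ -scalerAl respZ.
Qed.

HB.instance Definition _ := GRing.Lmodule_isLalgebra.Build k residue residue_scaleAl.
HB.instance Definition _ := GRing.Lalgebra_isComAlgebra.Build k residue.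

Fact to_residue_zmod_morphism : zmod_morphism to_residue.
Proof. by move=> a b; apply: val_inj; rewrite /= respB. Qed.

Lemma to_residueM a b : to_residue (a * b) = to_residue a * to_residue b.
Proof. by apply: val_inj; rewrite /= respMl respMr. Qed.

Fact to_residue_monoid_morphism : monoid_morphism to_residue.
Proof. by split=> // a b; apply: to_residueM. Qed.

HB.instance Definition _ := GRing.isZmodMorphism.Build R residue to_residue
  to_residue_zmod_morphism.
HB.instance Definition _ := GRing.isMonoidMorphism.Build R residue to_residue
  to_residue_monoid_morphism.

Lemma to_residue_eq0 a : to_residue a = 0 <-> exists t, a = hbar *: t.
Proof.
split=> [/(congr1 val) /= e|[t ->]]; last by apply: val_inj; rewrite /= resp_hbar.
by have [t] := resp_sub f a; rewrite e subr0; exists t.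
Qed.

Lemma to_residueZ (c : fps k) a : to_residue (c *: a) = c 0%N *: to_residue a.
Proof.
apply: val_inj; rewrite val_residueZ /= -respZ.
apply: (resp_eq (t := Fps (fun n => c n.+1) *: a)).
by rewrite {1}[c]fps_split -scalerBl scalerA addrC addKr.
Qed.

End ResidueAlgebra.

Section ResidueQuantization.
Variables (k : fieldType) (p : nat) (R : algType (fps k)) (G : nat -> set R).
Hypothesis CQ : complete_quantization p G.
Variable f : residue_projection R.
Implicit Types (a b : R) (u v w : nat -> residue f).

Let FQ := cq_filtered CQ.
Notation rho := (to_residue f).

Lemma residue_ind (P : residue f -> Prop) : (forall a, P (rho a)) -> forall x, P x.
Proof. by move=> h x; rewrite -(residue_valK x). Qed.

Lemma residue_split a : exists t, a = val (rho a) + hbar *: t.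
Proof. by have [t e] := resp_sub f a; exists t; rewrite -e addrC subrK. Qed.

Definition residue_br (x y : residue f) : residue f := rho (dl (val x) (val y)).

Lemma residue_br_rho a b : residue_br (rho a) (rho b) = rho (dl a b).
Proof.
have [s es] := residue_split a; have [t et] := residue_split b.
rewrite {2}es {2}et (dlDl FQ) (dlZl FQ) (dlDr FQ) (dlZr FQ) !rmorphD /=.
by rewrite [X in _ + X + _](to_residue_eq0 f _).2 ?[X in _ + X](to_residue_eq0 f _).2 ?addr0; eauto.
Qed.

Lemma rhoZk (c : k) a : c *: rho a = rho (fpsC c *: a).
Proof. by rewrite to_residueZ. Qed.

Let rhoM a b : rho a * rho b = rho (a * b).
Proof. by rewrite to_residueM. Qed.

Let rhoD a b : rho (a + b) = rho a + rho b. Proof. by rewrite rmorphD. Qed.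
Let rho0 : rho 0 = 0. Proof. by rewrite rmorph0. Qed.
Let rho_hbar a : rho (hbar *: a) = 0. Proof. by apply/to_residue_eq0; exists a. Qed.

Lemma residue_poisson : poisson_bracket residue_br.
Proof.
split.
- split; elim/residue_ind=> a c; elim/residue_ind=> b; elim/residue_ind=> d.
    by rewrite rhoZk -rmorphD !residue_br_rho rhoZk -rmorphD (dlDr FQ) (dlZr FQ).
  by rewrite rhoZk -rmorphD !residue_br_rho rhoZk -rmorphD (dlDl FQ) (dlZl FQ).
- by elim/residue_ind=> a; rewrite residue_br_rho (dlxx FQ) rmorph0.
- elim/residue_ind=> a; elim/residue_ind=> b; elim/residue_ind=> c.
  rewrite !residue_br_rho -!rmorphD (dl_jacobi FQ a) (dlC FQ c a) (dlC FQ c (dl a b)) (dlNr FQ).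
  by rewrite addrK addrN rmorph0.
elim/residue_ind=> a; elim/residue_ind=> b; elim/residue_ind=> c.
by rewrite rhoM !residue_br_rho !rhoM -rmorphD -(dlMr FQ).
Qed.

Definition hbar_sum u n : R := \sum_(i < n) hbar ^+ i *: val (u i).

Lemma hbar_series_exists u : exists a, forall n, G n (a - hbar_sum u n).
Proof.
apply: (cq_lim CQ) => n; rewrite /hbar_sum big_ord_recr /= addrAC subrr add0r.
by apply: (filtW FQ _ (filt_hbarX FQ n (filtT FQ _))); rewrite addn0 leq_pmull.
Qed.

Definition hbar_series u : R := projT1 (cid (hbar_series_exists u)).

Lemma hbar_seriesP u n : G n (hbar_series u - hbar_sum u n).
Proof. by rewrite /hbar_series; case: cid. Qed.

Lemma hbar_series_eq u a : (forall n, G n (a - hbar_sum u n)) -> hbar_series u = a.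
Proof.
move=> h; apply/eqP; rewrite -subr_eq0; apply/eqP/(cq_sep CQ) => n.
by rewrite -(subrKA (hbar_sum u n)) -[_ - a]opprB; apply: (filtB FQ);
  [exact: hbar_seriesP | exact: h].
Qed.

Lemma hbar_seriesD u v : hbar_series (fun n => u n + v n) = hbar_series u + hbar_series v.
Proof.
apply: hbar_series_eq => n.
have -> : hbar_sum (fun n => u n + v n) n = hbar_sum u n + hbar_sum v n.
  by rewrite /hbar_sum -big_split; apply: eq_bigr => i _; rewrite /= -scalerDr.
by rewrite opprD addrACA; apply: (filtD FQ); apply: hbar_seriesP.
Qed.

Lemma hbar_seriesZ (c : k) u : hbar_series (fun n => c *: u n) = fpsC c *: hbar_series u.
Proof.
apply: hbar_series_eq => n.
have -> : hbar_sum (fun n => c *: u n) n = fpsC c *: hbar_sum u n.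
  rewrite /hbar_sum scaler_sumr; apply: eq_bigr => i _.
  by rewrite val_residueZ !scalerA mulrC.
by rewrite -scalerBr; apply/(filtZ FQ)/hbar_seriesP.
Qed.

Lemma hbar_seriesS u : hbar_series u = val (u 0%N) + hbar *: hbar_series (fun n => u n.+1).
Proof.
apply: hbar_series_eq => n; rewrite -(subrKA (hbar_sum u n.+1)); apply: (filtD FQ).
  have -> : hbar_sum u n.+1 = val (u 0%N) + hbar *: hbar_sum (fun n => u n.+1) n.
    rewrite /hbar_sum big_ord_recl expr0 scale1r scaler_sumr; congr (_ + _).
    by apply: eq_bigr => i _; rewrite scalerA -exprS.
  by rewrite opprD addrACA subrr add0r -scalerBr; apply/(filtZ FQ)/hbar_seriesP.
rewrite /hbar_sum big_ord_recr /= addrAC subrr add0r.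
by apply: (filtW FQ _ (filt_hbarX FQ n (filtT FQ _))); rewrite addn0 leq_pmull.
Qed.

Lemma rho_hbar_series u : rho (hbar_series u) = u 0%N.
Proof. by rewrite hbar_seriesS rhoD residue_valK rho_hbar addr0. Qed.

(** Proved modulo every power of hbar: removing the constant term of c leaves hbar times the same
    statement for the shifted series. *)
Lemma hbar_series_scale (c : fps k) u : hbar_series (fps_scale c u) = c *: hbar_series u.
Proof.
apply/eqP; rewrite -subr_eq0; apply/eqP/(cq_sep CQ) => n.
suff [t ->] : exists t, hbar_series (fps_scale c u) - c *: hbar_series u = hbar ^+ n *: t.
  by apply: (filtW FQ _ (filt_hbarX FQ n (filtT FQ _))); rewrite addn0 leq_pmull.
elim: n c u => [|n IH] c u; first by eexists; rewrite expr0 scale1r.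
pose c' : fps k := Fps (fun n => c n.+1); have [t et] := IH c' u; exists t.
have e : (fun n => fps_scale c u n.+1) = (fun n => c 0%N *: u n.+1 + fps_scale c' u n).
  by apply/funext => m; rewrite /fps_scale [LHS]big_ord_recl subn0.
have e0 : fpsC (c 0%N) *: hbar_series u =
    val (fps_scale c u 0%N) + hbar *: (fpsC (c 0%N) *: hbar_series (fun n => u n.+1)).
  rewrite {1}hbar_seriesS scalerDr /fps_scale big_ord1 subn0 val_residueZ !scalerA.
  by rewrite [hbar * _]mulrC.
rewrite hbar_seriesS e hbar_seriesD hbar_seriesZ [in X in _ - X](fps_split c) scalerDl e0.
by rewrite scalerDr addrA opprD addrACA subrr add0r -scalerA -scalerBr et scalerA -exprS.
Qed.

Lemma hbar_series_inj u v : hbar_series u = hbar_series v -> u = v.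
Proof.
have ker w : hbar_series w = 0 -> forall n, w n = 0.
  move=> e n; elim: n w e => [|n IH] w e; have w0 : w 0%N = 0 by rewrite -rho_hbar_series e rho0.
    by [].
  apply: (IH (fun n => w n.+1)); apply: (filt_tf FQ).
  by rewrite -e [RHS]hbar_seriesS w0 raddf0 add0r.
move=> e; apply/funext => n; apply/eqP; rewrite -subr_eq0; apply/eqP.
rewrite -scaleN1r; apply: (ker (fun n => u n + (-1) *: v n)).
by rewrite hbar_seriesD hbar_seriesZ rmorphN1 scaleN1r e subrr.
Qed.

Lemma hbar_series_surj a : exists u, hbar_series u = a.
Proof.
have /choice[t ht] b := residue_split b.
pose s := fix s n := if n is n'.+1 then t (s n') else a.
exists (fun n => rho (s n)); apply: hbar_series_eq => n.
have -> : a - hbar_sum (fun n => rho (s n)) n = hbar ^+ n *: s n.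
  elim: n => [|n IH]; first by rewrite /hbar_sum big_ord0 subr0 expr0 scale1r.
  rewrite /hbar_sum big_ord_recr opprD addrA IH -scalerBr.
  by rewrite {1}[s n]ht addrAC subrr add0r scalerA -exprSr.
by apply: (filtW FQ _ (filt_hbarX FQ n (filtT FQ _))); rewrite addn0 leq_pmull.
Qed.

Lemma residue_topologically_free : topologically_free R.
Proof.
exists (residue f), hbar_series; split=> [|u v|c u].
- have /choice[g hg] := hbar_series_surj.
  by exists g => [u|//]; apply: hbar_series_inj; rewrite hg.
- exact: hbar_seriesD.
exact: hbar_series_scale.
Qed.

Lemma residue_quantization : quantization residue_br rho.
Proof.
split.
- exact: residue_topologically_free.
- exact: to_residueZ.
- by elim/residue_ind=> a; exists a.
- exact: to_residue_eq0.
by move=> a b c /(dl_eq FQ) <-; apply: residue_br_rho.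
Qed.

End ResidueQuantization.

Section ResidueLocal.
Variables (k : fieldType) (p : nat) (R : algType (fps k)) (G : nat -> set R).
Hypothesis CQ : complete_quantization p G.
Hypothesis G1_proper : ~ G 1%N 1.
Hypothesis isotropic : forall a b, G 1%N a -> G 1%N b -> G 1%N (dl a b).
Variable zs : seq R.
Hypothesis zs_filt : forall i, G 1%N zs`_i.
Hypothesis zs_gen : forall m, G 1%N m -> exists (c : nat -> R) r,
  m = \sum_(i < size zs) zs`_i * c i + hbar *: r.
Hypothesis AR : forall n, exists m, forall a, G m (hbar *: a) -> G n a.
Variable f : residue_projection R.
Implicit Types (a b : R) (x y : residue f).

Let FQ := cq_filtered CQ.
Notation rho := (to_residue f).

Let rhoM a b : rho a * rho b = rho (a * b). Proof. by rewrite to_residueM. Qed.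
Let rhoD a b : rho (a + b) = rho a + rho b. Proof. by rewrite rmorphD. Qed.
Let rhoB a b : rho (a - b) = rho a - rho b. Proof. by rewrite rmorphB. Qed.
Let rho0 : rho 0 = 0. Proof. by rewrite rmorph0. Qed.
Let rho_hbar a : rho (hbar *: a) = 0. Proof. by apply/to_residue_eq0; exists a. Qed.

Definition residue_filt n : set (residue f) := [set x | exists2 a, G n a & rho a = x].

Let C := residue_filt.

Lemma residue_filtD n x y : C n x -> C n y -> C n (x + y).
Proof. by move=> [a Ga <-] [b Gb <-]; exists (a + b); [apply: (filtD FQ) | rewrite rhoD]. Qed.

Lemma residue_filtB n x y : C n x -> C n y -> C n (x - y).
Proof. by move=> [a Ga <-] [b Gb <-]; exists (a - b); [apply: (filtB FQ) | rewrite rhoB]. Qed.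

Lemma residue_filt0 n : C n 0.
Proof. by exists 0; [apply: (filt0 FQ) | rewrite rho0]. Qed.

Lemma residue_filtM i j x y : C i x -> C j y -> C (i + j)%N (x * y).
Proof. by move=> [a Ga <-] [b Gb <-]; exists (a * b); [apply: (filtM FQ) | rewrite rhoM]. Qed.

Lemma residue_filtW n m x : (m <= n)%N -> C n x -> C m x.
Proof. by move=> le_mn [a Ga <-]; exists a => //; apply: filtW Ga. Qed.

Lemma residue_filtMl n x y : C n y -> C n (x * y).
Proof.
elim/residue_ind: x => a Cy; rewrite -[n]add0n; apply: residue_filtM => //.
by exists a => //; apply: (filtT FQ).
Qed.

Lemma residue_filt_rho a : C 1%N (rho a) <-> G 1%N a.
Proof.
split=> [[b Gb e]|]; last by exists a.
have : rho (a - b) = 0 by rewrite rhoB e subrr.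
move=> /to_residue_eq0[t et]; rewrite -[a](subrK b) et.
by apply: (filtD FQ) => //; apply/(filtS FQ)/(filt_hbar FQ)/(filtT FQ).
Qed.

Lemma AR_monotone : exists m : nat -> nat,
  [/\ forall n a, G (m n) (hbar *: a) -> G n a, forall n, (n <= m n)%N &
      forall i j, (i <= j)%N -> (m i <= m j)%N].
Proof.
have /choice[m hm] n : exists m, forall a, G m (hbar *: a) -> G n a by apply: AR.
exists (fun n => n + \sum_(i < n.+1) m i)%N; split=> [n a|n|i j le_ij].
- move=> Ga; apply: hm; apply: filtW Ga => //.
  by rewrite big_ord_recr /= addnA leq_addl.
- exact: leq_addr.
elim: j le_ij => [|j IH]; first by rewrite leqn0 => /eqP->.
rewrite leq_eqVlt => /predU1P[->//|/IH h]; apply: leq_trans h _.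
by rewrite [in leqRHS]big_ord_recr /=; lia.
Qed.

(** An element arbitrarily close to hbar R belongs to it, because by Artin-Rees its approximate
    quotients by hbar converge. *)
Lemma residue_sep x : (forall n, C n x) -> x = 0.
Proof.
elim/residue_ind: x => a Ca; have [m [hm le_m mono]] := AR_monotone.
have /choice[t ht] n : exists t, G (m n) (a - hbar *: t).
  have [b Gb e] := Ca (m n); have : rho (a - b) = 0 by rewrite rhoB e subrr.
  by move=> /to_residue_eq0[t et]; exists t; rewrite -et opprB addrC subrK.
have [|T hT] := cq_lim CQ (x := t).
  move=> n; apply: hm; rewrite scalerBr -[_ - _](subrKA a) -[hbar *: t n.+1 - a]opprB addrC.
  apply: (filtB FQ) => //; apply: filtW (ht n.+1) => //; exact: mono.
suff -> : a = hbar *: T by [].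
apply/eqP; rewrite -subr_eq0; apply/eqP/(cq_sep CQ) => n.
rewrite -(subrKA (hbar *: t n)) -scalerBr; apply: (filtD FQ).
  by apply: filtW (ht n) => //.
by rewrite -opprB scalerN; apply/(filtN FQ)/(filtZ FQ).
Qed.

Definition residue_max : {pred residue f} := fun x => `[< C 1%N x >].

Lemma residue_maxP a : rho a \in residue_max <-> G 1%N a.
Proof. by split=> [/asboolP/residue_filt_rho|/residue_filt_rho h] //; apply/asboolP. Qed.

Lemma residue_max_proper : 1 \notin residue_max.
Proof. by apply/negP => /(residue_maxP 1). Qed.

Lemma residue_max_ideal : idealr_closed residue_max.
Proof.
split; [exact/asboolP/residue_filt0 | exact: residue_max_proper|].
move=> x u v /asboolP Cu /asboolP Cv; apply/asboolP.
by apply: residue_filtD => //; apply: residue_filtMl.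
Qed.

Lemma residue_unit x : x \notin residue_max -> exists y, y * x = 1.
Proof.
elim/residue_ind: x => a aM; have [s Gs] := cq_residue CQ a.
have s0 : s != 0.
  apply: contra aM => /eqP s0; apply/residue_maxP.
  by rewrite s0 rmorph0 scale0r subr0 in Gs.
have [|b _ ba] := unit_residue1 CQ (a := fpsC s^-1 *: a).
  have -> : 1 = fpsC s^-1 *: (fpsC s *: 1) :> R.
    by rewrite scalerA -rmorphM mulVf // rmorph1 scale1r.
  by rewrite -scalerBr; apply: (filtZ FQ).
exists (rho (fpsC s^-1 *: b)); rewrite rhoM -scalerAl scalerAr ba.
by [].
Qed.

Lemma proper_ideal_sub (Q : {pred residue f}) : idealr_closed Q -> {subset Q <= residue_max}.
Proof.
move=> [Q0 Q1 QM] x Qx; apply: contraT => /residue_unit[y yx].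
by case/negP: Q1; rewrite -yx -[y * x]addr0; apply: QM.
Qed.

Lemma residue_max_maximal : maximal_ideal residue_max.
Proof. by split=> [|Q /proper_ideal_sub //]; apply: residue_max_ideal. Qed.

Lemma residue_max_unique (Q : {pred residue f}) : maximal_ideal Q -> Q =i residue_max.
Proof.
move=> [idQ maxQ] x; apply/idP/idP; first exact: proper_ideal_sub.
by apply: maxQ; [exact: residue_max_ideal | exact: proper_ideal_sub].
Qed.

Lemma residue_max_two_sided : two_sided_ideal [set` residue_max].
Proof.
split=> [|x y /asboolP Cx /asboolP Cy|x y /asboolP Cy]; rewrite /=.
- exact/asboolP/residue_filt0.
- exact/asboolP/residue_filtB.
by rewrite [y * x]mulrC; split; apply/asboolP/residue_filtMl.
Qed.

(** Isotropy handles brackets inside the maximal ideal, and this is enough: every element is a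
    constant plus an element of that ideal, and constants have zero bracket. *)
Lemma residue_max_poisson : poisson_ideal (@residue_br _ _ f) [set` residue_max].
Proof.
split; first exact: residue_max_two_sided.
elim/residue_ind=> a; elim/residue_ind=> b /= /residue_maxP Gb.
rewrite (residue_br_rho CQ); apply/residue_maxP; have [s Gs] := cq_residue CQ a.
have := isotropic Gs Gb; rewrite (dlBl FQ) (dlZl FQ).
by rewrite (dl_central_l FQ b (central1 R)) scaler0 subr0.
Qed.

Let Mpow := ideal_pow [set` residue_max].

Let idM := residue_max_two_sided.
Let Mpow0 n : Mpow n 0. Proof. exact: ideal_pow0. Qed.
Let MpowD n x y : Mpow n x -> Mpow n y -> Mpow n (x + y). Proof. exact: ideal_powD. Qed.
Let MpowMl n x y : Mpow n y -> Mpow n (x * y). Proof. exact: (ideal_powMl idM). Qed.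

Lemma residue_pow_filt n x : Mpow n x -> C n x.
Proof.
elim: n x => [|n IH] x; first by elim/residue_ind: x => a _; exists a => //; apply: (filtT FQ).
move=> [s [sM ->]]; rewrite big_seq; elim/big_ind: _ => [|y z|u /sM[/asboolP Cu /IH Cv]].
- exact: residue_filt0.
- exact: residue_filtD.
by rewrite -add1n; apply: residue_filtM.
Qed.

Lemma residue_pow_gen n x : Mpow n.+1 x -> exists c : 'I_(size zs) -> residue f,
  (forall i, Mpow n (c i)) /\ x = \sum_(i < size zs) rho zs`_i * c i.
Proof.
move=> [s [sM ->]]; rewrite big_seq.
pose P x := exists c : 'I_(size zs) -> residue f,
  (forall i, Mpow n (c i)) /\ x = \sum_(i < size zs) rho zs`_i * c i.
apply: (big_ind P) => [|_ _ [c [hc ->]] [d [hd ->]]|u /sM[Mu Mv]].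
- exists (fun=> 0); split=> [i|]; first exact: Mpow0.
  by rewrite big1 // => i _; rewrite mulr0.
- exists (fun i => c i + d i); split=> [i|].
    exact: MpowD.
  by rewrite -big_split; apply: eq_bigr => i _; rewrite mulrDr.
case: u Mu Mv => u v /=; elim/residue_ind: u => m /residue_maxP/zs_gen[c [r ->]] Mv.
exists (fun i => rho (c i) * v); split=> [i|].
  exact: MpowMl.
rewrite rhoD rho_hbar addr0 (big_morph _ rhoD rho0) mulr_suml; apply: eq_bigr => i _.
by rewrite mulrA rhoM.
Qed.

Lemma residue_max_gen i : rho zs`_i \in residue_max.
Proof. exact/residue_maxP. Qed.

(** The sum must lie in the n-th power of the maximal ideal, not only in weight n. Writing the terms
    on finitely many generators lowers n by one and leaves finitely many series of coefficients. *)
Lemma residue_series n (d : nat -> residue f) : (forall i, Mpow (n + i) (d i)) ->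
  exists2 D, Mpow n D & forall m, C m (D - \sum_(i < m) d i).
Proof.
elim: n d => [|n IH] d Md.
  have /choice[r hr] i : exists r, G i r /\ rho r = d i.
    by have [r] := residue_pow_filt (Md i); exists r.
  have [|X hX] := cq_lim CQ (x := fun n => \sum_(i < n) r i).
    by move=> i; rewrite big_ord_recr /= addrAC subrr add0r; case: (hr i).
  exists (rho X) => // m; exists (X - \sum_(i < m) r i) => //.
  rewrite rhoB (big_morph _ rhoD rho0); congr (_ - _).
  by apply: eq_bigr => i _; case: (hr i).
have /choice[c hc] i : exists c : 'I_(size zs) -> residue f,
    (forall j, Mpow (n + i) (c j)) /\ d i = \sum_(j < size zs) rho zs`_j * c j.
  exact: residue_pow_gen (Md i).
have /choice[D hD] j : exists D, Mpow n D /\ forall m, C m (D - \sum_(i < m) c i j).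
  by have [|D] := IH (fun i => c i j) => [i|]; [case: (hc i) | exists D].
exists (\sum_(j < size zs) rho zs`_j * D j).
  elim/big_ind: _ => [|x y|j _].
  - exact: Mpow0.
  - exact: MpowD.
  by apply: ideal_powM; [apply: residue_max_gen | case: (hD j)].
move=> m; have -> : \sum_(i < m) d i = \sum_(j < size zs) rho zs`_j * (\sum_(i < m) c i j).
  rewrite (eq_bigr (fun i : 'I_m => \sum_(j < size zs) rho zs`_j * c i j)) => [|i _]; last by case: (hc i).
  by rewrite exchange_big; apply: eq_bigr => j _; rewrite mulr_sumr.
rewrite -sumrB; elim/big_ind: _ => [|x y|j _].
- exact: residue_filt0.
- exact: residue_filtD.
by rewrite -mulrBr; apply: residue_filtMl; have [_] := hD j; apply.
Qed.

Lemma residue_complete : adically_complete [set` residue_max].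
Proof.
move=> a Ma; pose d n := a n.+1 - a n.
have sum_d n m : \sum_(i < m) d (n + i)%N = a (n + m)%N - a n.
  elim: m => [|m IH]; first by rewrite big_ord0 addn0 subrr.
  by rewrite big_ord_recr /= IH /d addnS addrC addrA subrK.
have series n : exists2 D, Mpow n D & forall m, C m (D - (a (n + m)%N - a n)).
  have [|D MD hD] := @residue_series n (fun i => d (n + i)%N); first by move=> i; apply: Ma.
  by exists D => // m; rewrite -sum_d.
have [D0 _ hD0] := series 0%N.
have lim n : Mpow n (a 0%N + D0 - a n).
  have [D MD hD] := series n; suff -> : a 0%N + D0 - a n = D by [].
  apply/eqP; rewrite -subr_eq0; apply/eqP/residue_sep => m.
  have -> : a 0%N + D0 - a n - D = (D0 - (a (0 + (n + m))%N - a 0%N)) - (D - (a (n + m)%N - a n)).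
    rewrite add0n [RHS]subrACA [X in _ = _ - X]subrACA subrr sub0r opprK.
    by rewrite [_ + D0]addrC -addrA [- _ - D]addrC addrACA.
  by apply: residue_filtB => //; apply: residue_filtW (hD0 _); apply: leq_addl.
exists (a 0%N + D0); split=> // x hx.
apply/eqP; rewrite -subr_eq0; apply/eqP/residue_sep => n.
rewrite -(subrKA (a n)) -[a n - x]opprB.
by apply: residue_filtB; apply: residue_pow_filt; [exact: lim | exact: hx].
Qed.

Lemma residue_complete_local : complete_local_poisson (@residue_br _ _ f).
Proof.
split; first exact: (residue_poisson CQ).
exists residue_max; split.
- exact: residue_max_maximal.
- exact: residue_max_unique.
- exact: residue_max_poisson.
exact: residue_complete.
Qed.

End ResidueLocal.

(** * The commutant as a complete quantization *)

Section Commutant.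
Variables (k : fieldType) (p : nat) (R : algType (fps k)) (G : nat -> set R).
Hypothesis CQ : complete_quantization p G.
Hypotheses (chark : p \in [pchar k]) (p_gt2 : (2 < p)%N) (G1_proper : ~ G 1%N 1).

Let FQ := cq_filtered CQ.

Lemma complete_weakly_central : weakly_central p R.
Proof.
move=> a; have [s Gs] := cq_residue CQ a.
have [b _ hb] := cq_restricted CQ (isT : (0 < 1)%N) Gs.
have hc : ppow p (fpsC s *: 1 : R) 0.
  by rewrite /ppow scaler0 subr0; apply/centralX/centralZ/central1.
have := ppowD FQ chark p_gt2 hb hc.
by rewrite subrK => h; eexists; apply: h.
Qed.

Lemma residue_projection_exists : inhabited (residue_projection R).
Proof.
have [f [fB fZ f_sub f_hbar]] := hbar_projection_exists R.
split; apply: (@ResidueProjection _ _ f) => // [a b|].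
  by exists (dl a b); apply: (dlE FQ).
apply/eqP => f1; have [t] := f_sub 1; rewrite f1 subr0 => e.
by apply: G1_proper; rewrite e; apply/(filtS FQ)/(filt_hbar FQ)/(filtT FQ).
Qed.

Variable hs : seq (R * R).
Notation S := (subalg (hker_closed CQ hs)).

Definition sub_filt n : set S := [set a | G n (val a)].

Let in_S (a : S) : hker hs (val a). Proof. by have /asboolP := valP a. Qed.
Let to_S a (ha : hker hs a) : S := Subalg (hker_closed CQ hs) (asboolT ha).

Let valZ (c : fps k) (a : S) : val (c *: a) = c *: val a. Proof. by rewrite linearZ. Qed.
Let valB (a b : S) : val (a - b) = val a - val b. Proof. by rewrite rmorphB. Qed.
Let valM (a b : S) : val (a * b) = val a * val b. Proof. by rewrite rmorphM. Qed.
Let val1 : val (1 : S) = 1. Proof. by rewrite rmorph1. Qed.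
Let val0 : val (0 : S) = 0. Proof. by rewrite rmorph0. Qed.

Lemma commutator_sub (a b : S) :
  commutator a b = hbar *: to_S (hker_dl CQ (in_S a) (in_S b)).
Proof. by apply: val_inj; rewrite /commutator rmorphB !rmorphM valZ /= -(dlE FQ). Qed.

Lemma sub_filtered : filtered_quantization sub_filt.
Proof.
split; rewrite /sub_filt /mkset.
- by move=> a; apply: (filtT FQ).
- by move=> n; rewrite val0; apply: (filt0 FQ).
- by move=> n a b; rewrite valB; apply: (filtB FQ).
- by move=> n a; apply: (filtS FQ).
- by move=> i j a b; rewrite valM; apply: (filtM FQ).
- by move=> n a; rewrite valZ; apply: (filt_hbar FQ).
- move=> i j a b Ga Gb; exists (to_S (hker_dl CQ (in_S a) (in_S b))).
    exact: (dl_filt FQ).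
  exact: commutator_sub.
by move=> a e; apply: val_inj; apply: (filt_tf FQ); rewrite -valZ e.
Qed.

Lemma val_dl (a b : S) : val (dl a b) = dl (val a) (val b).
Proof. by rewrite (dl_eq sub_filtered (commutator_sub a b)). Qed.

(** A commutant is closed under limits, under division by hbar and, by [ppow_commute], under
    restricted powers. *)
Lemma sub_complete : complete_quantization p sub_filt.
Proof.
split; first exact: sub_filtered.
- move=> n a n0 Ga; have [b Gb hb] := cq_restricted CQ n0 Ga.
  have Kb : hker hs b by move=> d dh; apply: (ppow_commute FQ hb); apply: in_S.
  exists (to_S Kb) => //; apply: centralI => c; apply: val_inj.
  by rewrite !valM valB valZ rmorphXn /= (centralE hb).
- move=> x hx; have [X hX] := cq_lim CQ (x := fun n => val (x n)) hx.
  suff KX : hker hs X by exists (to_S KX).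
  move=> d dh; apply: (cq_sep CQ) => n.
  have e : dl d.2 (val (x n.+2)) = 0 by apply: in_S.
  rewrite -[X](subrK (val (x n.+2))) (dlDr FQ) e addr0.
  by have := dl_filt FQ (filtT FQ d.2) (hX n.+2); rewrite add0n subn2.
- by move=> a Ga; apply: val_inj; rewrite val0; apply: (cq_sep CQ).
by move=> a; have [s Gs] := cq_residue CQ (val a); exists s; rewrite /sub_filt /mkset valB valZ val1.
Qed.

End Commutant.

Section PointGenerators.
Variables (k : closedFieldType) (B : comAlgType k).
Hypothesis B_fg : finitely_generated_algebra B.

(** The generators of B, translated so as to vanish at P. The elements b with b - b(P) in their
    ideal form a subalgebra. *)
Lemma point_generators (P : spec B) x : char_at P x -> exists s : seq B,
  (forall i, s`_i \in prime_of P) /\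
  forall b, b \in prime_of P -> exists c : nat -> B, b = \sum_(i < size s) s`_i * c i.
Proof.
move=> cx; have [xc xP] := cx; have [gs hgs] := B_fg.
pose s := [seq g - (x g)%:A | g <- gs].
exists s; split=> [i|b Pb].
  have [lt_i|le_i] := ltnP i (size gs); last by rewrite nth_default ?size_map // spec0.
  by rewrite (nth_map 0) //; apply: char_sub.
pose I b := exists c : nat -> B, b = \sum_(i < size s) s`_i * c i.
have I0 : I 0 by exists (fun=> 0); rewrite big1 // => i _; rewrite mulr0.
have ID u v : I u -> I v -> I (u + v).
  move=> [c ->] [d ->]; exists (fun i => c i + d i).
  by rewrite -big_split; apply: eq_bigr => i _; rewrite mulrDr.
have IM u v : I v -> I (u * v).
  move=> [c ->]; exists (fun i => u * c i).
  by rewrite mulr_sumr; apply: eq_bigr => i _; rewrite mulrCA.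
suff : b - (x b)%:A \in [pred b | `[< I b >]].
  by move=> /asboolP; have := xP b; rewrite Pb => /esym/eqP->; rewrite scale0r subr0.
suff : b \in [pred b | `[< I (b - (x b)%:A) >]] by [].
apply: hgs => [|g gs_g]; last first.
  apply/asboolP; exists (fun i => (i == index g gs)%:R).
  have lt_g : (index g gs < size s)%N by rewrite size_map index_mem.
  rewrite (bigD1 (Ordinal lt_g)) //= eqxx mulr1 (nth_map 0) ?index_mem // nth_index //.
  rewrite big1 ?addr0 // => i ne; suff -> : (nat_of_ord i == index g gs) = false by rewrite mulr0.
  by apply: contraNF ne => /eqP e; apply/eqP/val_inj.
split=> [|c u v /asboolP Iu /asboolP Iv|u v /asboolP Iu /asboolP Iv]; apply/asboolP.
- by rewrite rmorph1 scale1r subrr.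
- rewrite rmorphD (char_scale _ _ cx) scalerDl opprD addrACA -scalerA -scalerBr.
  by apply: ID => //; rewrite -[_ *: _]mul1r -scalerAr scalerAl; apply: IM.
have -> : u * v - (x (u * v))%:A = v * (u - (x u)%:A) + (x u)%:A * (v - (x v)%:A).
  rewrite rmorphM mulrBr mulrBr addrA [v * u]mulrC [v * _]mulrC subrK.
  by rewrite -scalerAl mul1r scalerA.
by apply: ID; apply: IM.
Qed.

End PointGenerators.

Section DarbouxWeyl.
Variables (k : fieldType) (p : nat) (R : algType (fps k)) (G : nat -> set R).
Hypothesis CQ : complete_quantization p G.
Hypotheses (chark : p \in [pchar k]) (p_gt2 : (2 < p)%N).
Variables (n : nat) (s : seq (R * R)).
Hypotheses (s_sys : darboux_sys p G s) (s_size : size s = n).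
Variable W : algType (fps k).
Hypothesis W_weyl : complete_weyl_algebra n W.

Let FQ := cq_filtered CQ.
Let pair i := nth (0, 0) s i.

Lemma darboux_sys_nth i j : (i < size s)%N -> (j < size s)%N ->
  [/\ dl (pair i).1 (pair j).1 = 0, dl (pair i).2 (pair j).2 = 0 &
      dl (pair i).1 (pair j).2 = (i == j)%:R].
Proof.
rewrite /pair; elim: s i j s_sys => // q s' IH [|i] [|j] /= [[_ _ q12 _ _] comm sys] li lj.
- by rewrite !(dlxx FQ) q12.
- have [h1 h2 h3 h4] := comm _ (mem_nth (0, 0) lj).
  by rewrite (dlC FQ q.1 _.1) h1 (dlC FQ q.2 _.2) h4 (dlC FQ q.1 _.2) h3 !oppr0.
- by have [h1 h2 h3 h4] := comm _ (mem_nth (0, 0) li); rewrite h1 h2 h4.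
by have [h1 h2 h3] := IH i j sys li lj.
Qed.

Lemma darboux_weyl_relations :
  weyl_relations (fun i : 'I_n => (pair i).1) (fun i : 'I_n => (pair i).2).
Proof.
move=> i j; have lt (l : 'I_n) : (l < size s)%N by rewrite s_size.
have [h1 h2 h3] := darboux_sys_nth (lt i) (lt j).
by rewrite !(dlE FQ) h1 h2 h3 !scaler0 -(inj_eq val_inj).
Qed.

Lemma darboux_weyl_map : exists (h : {lrmorphism W -> R}) (zd : seq (W * (R * R))),
  [/\ unzip2 zd = conj_of s,
      forall q, q \in zd -> h q.1 = q.2.1,
      forall w, cspan p (unzip1 zd) w,
      forall z, z \in @central W -> hker (conj_of s) (h z) &
      forall r w, hker (conj_of s) r -> h w * r = r * h w].
Proof.
have [W0 [x [y [j [pres [F [Fid Fiota Fdense Flim]]]]]]] := W_weyl.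
have [_ univ] := pres.
have [h0 [h0g _]] := univ R _ _ darboux_weyl_relations.
have [h hP] := hbar_completion_ext Fid Fiota Fdense CQ h0.
have hj a : h (j a) = h0 a.
  apply/eqP; rewrite -subr_eq0; apply/eqP/(cq_sep CQ) => m; apply: hP.
  by rewrite subrr; apply: (compl0 Fid).
have s_enum : s = [seq pair i | i : 'I_n <- enum 'I_n].
  rewrite (map_comp pair val) val_enum_ord -[LHS](mkseq_nth (0, 0)) s_size //.
exists h, (flatten [seq [:: (j (y i), ((pair i).2, (pair i).1)); (j (x i), ((pair i).1, - (pair i).2))]
  | i : 'I_n <- enum 'I_n]); split.
- rewrite [in RHS]s_enum /conj_of /unzip2 map_flatten -!map_comp.
  by congr flatten; apply: eq_map.
- move=> q /flattenP[l /mapP[i _ ->]]; rewrite !inE => /orP[]/eqP-> /=; rewrite hj.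
    by case: (h0g i).
  by case: (h0g i).
- have -> : unzip1 (flatten [seq [:: (j (y i), ((pair i).2, (pair i).1));
      (j (x i), ((pair i).1, - (pair i).2))] | i : 'I_n <- enum 'I_n]) = map j (weyl_gens x y).
    rewrite /weyl_gens /unzip1 !map_flatten -!map_comp.
    by congr flatten; apply: eq_map.
  apply: (cspan_completion Fid Fiota Fdense Flim) => a.
  exact: (weyl_span pres chark).
- move=> z /centralE cz; apply/(hker_conj_of CQ) => q qs.
  have lt_q : (index q s < n)%N by rewrite -s_size index_mem.
  have [e1 e2] := h0g (Ordinal lt_q); rewrite /pair /= nth_index // in e1 e2.
  by rewrite -e1 -e2 -!hj; split; apply/(dl_commute FQ); rewrite -!rmorphM cz.
move=> r w hr; apply: (hbar_completion_commutant Fdense CQ hP).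
apply: (weyl_commutant pres) => i; have [-> ->] := h0g i.
have li : (i < size s)%N by rewrite s_size.
have [e1 e2] := (hker_conj_of CQ s r).1 hr _ (mem_nth (0, 0) li).
by rewrite !(dlE FQ) e1 e2 scaler0.
Qed.

End DarbouxWeyl.

(** The two inputs for the completeness of S / hbar S are inherited by S: finite generation through
    the projections, Artin-Rees by restriction. *)
Lemma weyl_factorization (k : fieldType) (p : nat) (R : algType (fps k)) (G : nat -> set R)
    (n : nat) (W : algType (fps k)) :
    p \in [pchar k] -> (2 < p)%N -> complete_quantization p G -> ~ G 1%N 1 ->
    symplectic_rank G (2 * n)%N -> fin_gen_ker G [::] ->
    (forall i, exists j, forall a, G j (hbar *: a) -> G i a) ->
    complete_weyl_algebra n W ->
  exists (Ap : algType (fps k)) (C : comAlgType k) (brC : C -> C -> C)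
         (rhoC : {rmorphism Ap -> C}) (phi : {lrmorphism center W -> center Ap})
         (t : W -> Ap -> R),
    [/\ complete_local_poisson brC, quantization brC rhoC, weakly_central p Ap &
        is_tensor_product phi t].
Proof.
move=> chark p_gt2 CQ proper rank fg AR W_weyl.
have [s s_size s_sys] := darboux_sys_exists CQ chark p_gt2 proper rank (leqnn n).
have [h [zd [zdE h_gen W_span h_center h_commute]]] :=
  darboux_weyl_map CQ chark p_gt2 s_sys s_size W_weyl.
have sys := conj_of_sys CQ s_sys.
have iso := darboux_sys_isotropic CQ proper rank s_sys s_size.
have [zs [zs_ker zs_gen]] : fin_gen_ker G (catrev (conj_of s) [::]).
  by apply: (fin_gen_ker_sys CQ chark sys).
have {}zs_ker i : hker (conj_of s) zs`_i /\ G 1%N zs`_i.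
  by have [/hker_rev] := zs_ker i.
have {}zs_gen m : hker (conj_of s) m -> G 1%N m -> exists (c : nat -> R) r,
    [/\ forall i, hker (conj_of s) (c i), hker (conj_of s) r &
        m = \sum_(i < size zs) zs`_i * c i + hbar *: r].
  move=> /hker_rev Km Gm; have [c [r [Kc /hker_rev Kr em]]] := zs_gen m Km Gm.
  by exists c, r; split=> // i; apply/hker_rev.
rewrite -zdE in sys h_center h_commute iso zs_ker zs_gen.
have tens := weyl_tensor CQ chark sys h_gen W_span h_center h_commute.
have CQ' := sub_complete CQ (unzip2 zd).
have proper' : ~ sub_filt 1%N (1 : subalg (hker_closed CQ (unzip2 zd))).
  by rewrite /sub_filt /mkset rmorph1.
have in_S (a : subalg (hker_closed CQ (unzip2 zd))) : hker (unzip2 zd) (val a) by have /asboolP := valP a.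
pose to_S a (ha : hker (unzip2 zd) a) := Subalg (hker_closed CQ (unzip2 zd)) (asboolT ha).
have [f] := residue_projection_exists CQ' proper'.
exists (subalg (hker_closed CQ (unzip2 zd))), (residue f), (@residue_br _ _ f), (to_residue f).
exists (center_map CQ h_center h_commute), (tensor h (zd := zd)); split=> //.
- pose zs' := [seq to_S _ (zs_ker i).1 | i <- iota 0 (size zs)].
  have size_zs' : size zs' = size zs by rewrite size_map size_iota.
  have val_zs i : (i < size zs)%N -> val zs'`_i = zs`_i.
    by move=> lt_i; rewrite (nth_map 0%N) ?size_iota // nth_iota.
  apply: (@residue_complete_local _ _ _ _ CQ' proper' _ zs').
  + by move=> a b Ga Gb; rewrite /sub_filt /mkset val_dl; apply: iso.
  + move=> i; rewrite /sub_filt /mkset; have [lt_i|le_i] := ltnP i (size zs).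
      by rewrite val_zs //; case: (zs_ker i).
    by rewrite nth_default ?size_zs' // rmorph0; apply: (filt0 (cq_filtered CQ)).
  + move=> m Gm; have [c [r [Kc Kr em]]] := zs_gen _ (in_S m) Gm.
    exists (fun i => to_S _ (Kc i)), (to_S _ Kr); apply: val_inj.
    rewrite rmorphD rmorph_sum /= em size_zs'; congr (_ + _).
    by apply: eq_bigr => i _; rewrite -(val_zs _ (ltn_ord i)).
  move=> i; have [j hj] := AR i; exists j => a; rewrite /sub_filt /mkset linearZ /=.
  exact: hj.
- exact: (residue_quantization CQ').
exact: (complete_weakly_central CQ' chark p_gt2).
Qed.

Theorem theorem1p4 (k : closedFieldType) (p : nat)
  (char_k : p \in [pchar k]) (p_gt2 : (2 < p)%N)
  (B : comAlgType k) (B_fg : finitely_generated_algebra B)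
  (br : B -> B -> B) (br_poisson : poisson_bracket br)
  (A : algType (fps k)) (rho : {rmorphism A -> B})
  (A_quant : quantization br rho) (A_wc : weakly_central p A)
  (y : spec B) (y_closed : closed [set y])
  (Y : set (spec B)) (Y_leaf : symplectic_leaf br Y) (yY : Y y)
  (n : nat) (Y_dim : krull_dim Y (2 * n)%N)
  (Ay : algType (fps k)) (iota : {lrmorphism A -> Ay})
  (Ay_completion : is_completion [set a | rho a \in prime_of y] iota)
  (W : algType (fps k)) (W_weyl : complete_weyl_algebra n W) :
  exists (Ap : algType (fps k))
         (C : comAlgType k) (brC : C -> C -> C) (rhoC : {rmorphism Ap -> C})
         (phi : {lrmorphism center W -> center Ap})
         (T : algType (fps k)) (t : W -> Ap -> T),
    [/\ complete_local_poisson brC, quantization brC rhoC, weakly_central p Ap,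
        is_tensor_product phi t & alg_isomorphic Ay T].
Proof.
have [x cx] := closed_point_char B_fg y_closed.
have resM b : exists c : k, b - c%:A \in prime_of y by exists (x b); apply: char_sub.
have [gs [gs_y gs_gen]] := point_generators B_fg cx.
have idM := prime_of_ideal y.
have [F [Fid Fiota Fdense Flim]] := Ay_completion.
have /choice[lift liftK] := rho_surj A_quant.
pose zs := map lift gs.
have rho_zs i : (i < size gs)%N -> rho zs`_i = gs`_i by move=> lt_i; rewrite (nth_map 0).
have zs_J i : Jset rho (prime_of y) zs`_i.
  rewrite /Jset /=; have [/rho_zs->//|le_i] := ltnP i (size gs).
  by rewrite nth_default ?size_map // rmorph0 spec0.
have gen_M b : b \in prime_of y -> exists c : nat -> B, b = \sum_(i < size zs) rho zs`_i * c i.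
  move=> /gs_gen[c ->]; exists c; rewrite size_map.
  by apply: eq_bigr => i _; rewrite rho_zs.
have accB := fg_acc B_fg.
have [[Y_lc Y_conn Y_pois Y_smooth Y_sympl] _] := Y_leaf.
have [e [gram [ye gramP gramU rad]]] :=
  symplectic_data B_fg br_poisson Y_lc Y_conn Y_pois Y_smooth Y_sympl Y_dim yY y_closed.
have CQ := cfilt_complete char_k p_gt2 A_quant A_wc idM resM gen_M zs_J accB Fid Fiota Fdense Flim.
have rank := cfilt_symplectic char_k p_gt2 A_quant A_wc idM resM gen_M zs_J accB
  Fid Fiota Fdense Flim ye gramP gramU rad.
have fg := cfilt_fin_gen char_k p_gt2 A_quant A_wc idM resM gen_M zs_J accB Fid Fiota Fdense Flim.
have AR := cfilt_AR char_k p_gt2 A_quant A_wc idM resM gen_M zs_J accB Fid Fiota Fdense.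
have [Ap [C [brC [rhoC [phi [t [? ? ? tens]]]]]]] :=
  weyl_factorization char_k p_gt2 CQ (cfilt1_proper idM Fiota) rank fg AR W_weyl.
(* The tensor product is realised on [Ay] itself, so the isomorphism is the identity. *)
exists Ap, C, brC, rhoC, phi, Ay, t; split=> //.
by exists idfun; exists idfun.
Qed.
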